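(* Let $\alpha,\beta\ge 0$ be real numbers and let $n\ge 0$ be an integer. Let $w_n(\cdot\,;\alpha,\beta):\mathbb{C}_+\to\Omega_n(\alpha,\beta)$ be the normalized conformal mapping and $C_n(\alpha,\beta)$ its associated constant. Let $\xi_j=w_n^{-1}(\infty_j;\alpha,\beta)$, $1\le j\le n$. Then $$e^{w_n(t;\alpha,\beta)}=t^\alpha(1-t)^\beta e^{C_{n}(\alpha,\beta)}(t-\xi_1)\cdots(t-\xi_{n}),$$ where $$\tilde{\mathcal J}_n(t;\alpha,\beta):=(t-\xi_1)\cdots(t-\xi_{n})=t^n+\dots$$ is the polynomial of least deviation from zero on $[0,1]$ with respect to the weight $t^\alpha(1-t)^\beta$. Moreover, $$\|\tilde{\mathcal J}_n(t;\alpha,\beta)\| = \sup_{0\le t\le 1}t^\alpha(1-t)^\beta |\tilde{\mathcal J}_n(t;\alpha,\beta)|=e^{-C_{n}(\alpha,\beta)},$$ that is, $$e^{w_n(t;\alpha,\beta)}=t^\alpha(1-t)^\beta \mathcal J_n(t;\alpha,\beta),$$ where $\mathcal J_n(t;\alpha,\beta):=\tilde{\mathcal J}_n(t;\alpha,\beta)/\|\tilde{\mathcal J}_n(t;\alpha,\beta)\|$.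
   Context: The polynomial of least deviation from zero on $[0,1]$ with respect to the weight $t^\alpha(1-t)^\beta$ (of degree $n$) is the monic polynomial $p$ of degree $n$ minimizing $\sup_{0\le t\le 1}t^\alpha(1-t)^\beta|p(t)|$. For nonnegative real numbers $\alpha,\beta$ and an integer $n\ge 0$, let $$\Omega_n(\alpha,\beta) = \{ w = u+iv : - \beta < \tfrac v \pi < \alpha + n \}\setminus \bigcup_{j=0}^{n} \{ w = u+iv : \tfrac v\pi= j,\ u \le 0 \}.$$ The boundary of the domain contains $n+3$ infinite points: $\infty_0=-\infty+iv$, $n<\frac v\pi<n+\alpha$; $\infty_j=-\infty+iv$, $n-j<\frac v\pi<n-j+1$ ($1\le j\le n$); $\infty_{n+1}=-\infty+iv$, $-\beta<\frac v\pi<0$; $\infty_{n+2}=+\infty+iv$, $-\beta<\frac v\pi<\alpha+n$. Let $w=w_n(\cdot\,;\alpha,\beta)$ be the conformal mapping of the upper half-plane $\mathbb{C}_+$ onto $\Omega_n(\alpha,\beta)$ with the normalization $w(0)=\infty_0$, $w(1)=\infty_{n+1}$, $w(\infty)=\infty_{n+2}$. The real constant $C_n(\alpha,\beta)$ is uniquely defined by the domain through the asymptotics $$w_n(z;\alpha,\beta)=(\alpha+\beta+n)\ln z+C_n(\alpha,\beta)-\beta\pi i+ O(1/z),\qquad z\to\infty.$$ The points $\xi_j$ are the preimages of the infinite boundary points $\infty_j$ under the boundary correspondence, and for real $t$, $w_n(t;\alpha,\beta)$ denotes the boundary value of $w_n$ at $t$. *)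

(* Defs.v *)
From Stdlib Require Import Reals List.
From Coquelicot Require Import Coquelicot.

Open Scope R_scope.

Definition Cexp (z : C) : C :=
  (exp (Re z) * cos (Im z), exp (Re z) * sin (Im z)).

(* The branch of the logarithm with argument in [0, PI], meaningful for
   z <> 0 in the closed upper half-plane (where the argument is the arccosine
   of Re z / |z|). *)
Definition Clog_upper (z : C) : C := (ln (Cmod z), acos (Re z / Cmod z)).

(* Stdlib's [Rpower 0 a] is 1 for every [a]; here 0^a = 0 for a <> 0, and
   0^0 = 1.  Only used for 0 <= x and 0 <= a. *)
Definition rpow (x a : R) : R :=
  if Req_EM_T x 0 then (if Req_EM_T a 0 then 1 else 0) else Rpower x a.

Definition upper (z : C) : Prop := 0 < Im z.

(* The filters "z -> t" (t real) and "z -> infinity" inside the upper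
   half-plane. *)
Definition near_real (t : R) : (C -> Prop) -> Prop :=
  within upper (@locally C_UniformSpace (RtoC t)).
Definition near_infty : (C -> Prop) -> Prop :=
  fun P => exists M : R, forall z : C, upper z -> M < Cmod z -> P z.

Definition Omega (n : nat) (alpha beta : R) (w : C) : Prop :=
  - beta < Im w / PI < alpha + INR n /\
  ~ (exists j : nat, (j <= n)%nat /\ Im w / PI = INR j /\ Re w <= 0).

(* Neighbourhood filters of the infinite boundary points -oo + iv and +oo + iv
   with a < v/PI < b. *)
Definition left_end (a b : R) : (C -> Prop) -> Prop :=
  fun P => exists M : R,
    forall w : C, Re w < M -> a < Im w / PI < b -> P w.
Definition right_end (a b : R) : (C -> Prop) -> Prop :=
  fun P => exists M : R,
    forall w : C, M < Re w -> a < Im w / PI < b -> P w.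

(* When alpha = 0 the half-strip n < v/PI < n + alpha is empty: [infty_first]
   is then the end point i PI n of the slit v = PI n, to which the boundary
   point shrinks as alpha -> 0.  Likewise [infty_last] is 0 when beta = 0. *)
Definition infty_first (n : nat) (alpha : R) : (C -> Prop) -> Prop :=
  if Req_EM_T alpha 0
  then @locally C_UniformSpace (0, PI * INR n)
  else left_end (INR n) (INR n + alpha).
Definition infty_mid (n j : nat) : (C -> Prop) -> Prop :=
  left_end (INR n - INR j) (INR n - INR j + 1).
Definition infty_last (beta : R) : (C -> Prop) -> Prop :=
  if Req_EM_T beta 0
  then @locally C_UniformSpace (RtoC 0)
  else left_end (- beta) 0.
Definition infty_right (n : nat) (alpha beta : R) : (C -> Prop) -> Prop :=
  right_end (- beta) (alpha + INR n).

(* Only the values of [w] on the upper half-plane matter. *)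
Definition conformal_onto (D : C -> Prop) (w : C -> C) : Prop :=
  (forall z : C, upper z ->
     @ex_derive C_AbsRing C_NormedModule w z) /\
  (forall z : C, upper z -> D (w z)) /\
  (forall z1 z2 : C, upper z1 -> upper z2 -> w z1 = w z2 -> z1 = z2) /\
  (forall v : C, D v -> exists z : C, upper z /\ w z = v).

Definition normalized_map (n : nat) (alpha beta : R) (w : C -> C) : Prop :=
  conformal_onto (Omega n alpha beta) w /\
  filterlim w (near_real 0) (infty_first n alpha) /\
  filterlim w (near_real 1) (infty_last beta) /\
  filterlim w near_infty (infty_right n alpha beta).

Definition asymptotic_const (n : nat) (alpha beta : R) (w : C -> C) (c : R)
  : Prop :=
  exists K M : R, forall z : C, upper z -> M < Cmod z ->
    Cmod (w z - (RtoC (alpha + beta + INR n) * Clog_upper z + RtoC c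
                 - RtoC (beta * PI) * Ci))%C <= K / Cmod z.

(* Boundary value of [w] at the real point t: a finite point, or one of the
   infinite boundary points with real part -oo, at which e^w is read as 0. *)
Inductive bvalue : Type :=
  | BFinite (v : C)
  | BMinusInfty.

Definition has_bvalue (w : C -> C) (t : R) (b : bvalue) : Prop :=
  match b with
  | BFinite v => filterlim w (near_real t) (@locally C_UniformSpace v)
  | BMinusInfty =>
      filterlim (fun z => Re (w z)) (near_real t) (Rbar_locally m_infty)
  end.

Definition exp_bvalue (b : bvalue) : C :=
  match b with
  | BFinite v => Cexp v
  | BMinusInfty => RtoC 0
  end.

(* e^{w(t)} = v for the boundary value w(t). *)
Definition exp_boundary_eq (w : C -> C) (t : R) (v : C) : Prop :=
  exists b : bvalue, has_bvalue w t b /\ exp_bvalue b = v.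

Definition weight (alpha beta t : R) : R := rpow t alpha * rpow (1 - t) beta.

(* t^alpha (1-t)^beta for any real t: the boundary value, from the upper
   half-plane, of the branch of z^alpha (1-z)^beta that is positive on (0,1).
   Thus t has argument PI for t < 0, and 1 - t has argument -PI for t > 1; on
   [0,1] this is [weight]. *)
Definition cweight (alpha beta t : R) : C :=
  (RtoC (rpow (Rabs t) alpha) *
     Cexp (0, if Rlt_dec t 0 then (alpha * PI)%R else 0%R) *
   (RtoC (rpow (Rabs (1 - t)) beta) *
     Cexp (0, if Rlt_dec 1 t then (- (beta * PI))%R else 0%R)))%C.

Definition monic_poly (n : nat) (p : R -> R) : Prop :=
  exists a : nat -> R,
    a n = 1 /\ forall t : R, p t = sum_f_R0 (fun k => a k * t ^ k) n.

Definition wnorm (alpha beta : R) (p : R -> R) : Rbar :=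
  Lub_Rbar (fun y => exists t : R,
    0 <= t <= 1 /\ y = weight alpha beta t * Rabs (p t)).

(* p is the (unique) monic polynomial of degree n with minimal norm. *)
Definition least_deviation (n : nat) (alpha beta : R) (p : R -> R) : Prop :=
  monic_poly n p /\
  (forall q : R -> R, monic_poly n q ->
     Rbar_le (wnorm alpha beta p) (wnorm alpha beta q)) /\
  (forall q : R -> R, monic_poly n q ->
     wnorm alpha beta q = wnorm alpha beta p -> forall t : R, q t = p t).

(* (t - xi_1) ... (t - xi_n) *)
Definition Jtilde (n : nat) (xi : nat -> R) (t : R) : R :=
  fold_right Rmult 1 (map (fun j => t - xi j) (seq 1 n)).

Definition Jnormalized (n : nat) (alpha beta : R) (xi : nat -> R) (t : R) : R :=
  Jtilde n xi t / real (wnorm alpha beta (Jtilde n xi)).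

(* Main.v *)
(* The imaginary part of w minus the logarithm of the claimed product is a bounded
   harmonic function on the upper half-plane.  A half-plane point is close to the
   real axis when its image is close to the boundary of Omega, and following the
   sign of Re z - xi_j along the boundary of the slit strip, from the right end,
   around the tips and through the left ends other than infinity_j, shows that
   the argument of z - xi_j jumps exactly when the strip of infinity_j is crossed.
   Hence the harmonic function vanishes on the finite boundary, and so identically
   by a Phragmen-Lindelof argument; this gives the formula for w.  Boundary
   values of w avoid Omega, which bounds the weighted polynomial by e^(-C), and the
   n + 1 tips of the slits are attained in [0, 1], which is the alternation that
   characterizes the polynomial of least deviation. *)

Require Import Defs.
From Stdlib Require Import Reals List Lra Lia Classical ClassicalEpsilon.
From Coquelicot Require Import Coquelicot.

Open Scope R_scope.

(** * Bisection and Goursat's lemma *)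

(** The hypotheses give limits of w only at 0, 1, the xi_j and infinity. Up to the formula, boundary
    arguments therefore run in the image: a point v outside Omega stands for a boundary point, and
    statements about it concern all z with w z close to v. For the same reason the barrier is a
    function of w. The hyperbolic cosine of a multiple of w, centred on the strip, grows at the left
    ends and at the right end alike, so all infinite boundary points are controlled at once. Real
    boundary values of w are then read off from the formula. The imaginary part is treated first
    because its boundary values are known, bounded and locally constant. The real part follows up to
    an additive constant, which the asymptotics determine through C. The complex analysis underneath
    is built from Goursat's lemma on rectangles, transported to circles by the exponential; the mean
    value property gives both the open mapping argument and the maximum principle. *)

Lemma nested_halves (s : nat -> R) (h : R) :
  0 <= h ->
  (forall N, s N <= s (S N) <= s N + h / 2 ^ S N) ->
  exists x, forall N, s N <= x <= s N + h / 2 ^ N.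
Proof.
intros Hh Hs.
assert (Hp : forall N, 0 < 2 ^ N) by (intro; apply pow_lt; lra).
assert (Hhalf : forall N, h / 2 ^ N = h / 2 ^ S N + h / 2 ^ S N).
{ intro N. simpl. field. apply Rgt_not_eq; apply Hp. }
assert (Hpos : forall N, 0 <= h / 2 ^ N).
{ intro N. apply Rmult_le_pos; [exact Hh|]. apply Rlt_le, Rinv_0_lt_compat; apply Hp. }
assert (Hup : forall N k, s N <= s (k + N)%nat /\
                     s (k + N)%nat + h / 2 ^ (k + N) <= s N + h / 2 ^ N).
{ intros N k. induction k as [|k IH]; simpl Nat.add; [lra|].
  specialize (Hs (k + N)%nat). rewrite (Hhalf (k + N)%nat) in IH. lra. }
assert (Hle : forall N M, s M <= s N + h / 2 ^ N).
{ intros N M. pose proof (Hpos M) as PM. pose proof (Hpos N) as PN.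
  destruct (Nat.le_ge_cases N M) as [H|H].
  - destruct (Hup N (M - N)%nat) as [_ H1].
    replace (M - N + N)%nat with M in H1 by lia. lra.
  - destruct (Hup M (N - M)%nat) as [H1 _].
    replace (N - M + M)%nat with N in H1 by lia. lra. }
destruct (completeness (fun y => exists N, y = s N)) as [x [Hx1 Hx2]].
- exists (s 0%nat + h / 2 ^ 0). intros y [N ->]. apply Hle.
- exists (s 0%nat). now exists 0%nat.
- exists x. intro N. split.
  + apply Hx1. now exists N.
  + apply Hx2. intros y [M ->]. apply Hle.
Qed.

(* [Q a c h k] speaks of the rectangle with lower left corner (a, c), width h
   and height k. *)
Lemma rect_bisect (Q : R -> R -> R -> R -> Prop) (a c h k : R) :
  0 <= h -> 0 <= k ->
  (forall a c h k, 0 <= h -> 0 <= k -> Q a c h k ->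
     exists a' c', (a' = a \/ a' = a + h / 2) /\ (c' = c \/ c' = c + k / 2) /\
       Q a' c' (h / 2) (k / 2)) ->
  Q a c h k ->
  exists x y, (a <= x <= a + h) /\ (c <= y <= c + k) /\
    forall N, exists a' c', Q a' c' (h / 2 ^ N) (k / 2 ^ N) /\
      (a' <= x <= a' + h / 2 ^ N) /\ (c' <= y <= c' + k / 2 ^ N).
Proof.
intros Hh Hk Hstep H0.
set (nxt := fun (N : nat) (p p' : R * R) =>
  (fst p' = fst p \/ fst p' = fst p + h / 2 ^ S N) /\
  (snd p' = snd p \/ snd p' = snd p + k / 2 ^ S N) /\
  Q (fst p') (snd p') (h / 2 ^ S N) (k / 2 ^ S N)).
set (s := fix s N := match N with
  | O => (a, c)
  | S N => epsilon (inhabits (0, 0)) (nxt N (s N)) end).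
assert (Hp : forall N, 0 < 2 ^ N) by (intro; apply pow_lt; lra).
assert (Hpos : forall h N, 0 <= h -> 0 <= h / 2 ^ N).
{ intros h' N Hh'. apply Rmult_le_pos; [exact Hh'|].
  apply Rlt_le, Rinv_0_lt_compat; apply Hp. }
assert (Hn : forall N, Q (fst (s N)) (snd (s N)) (h / 2 ^ N) (k / 2 ^ N) ->
   nxt N (s N) (s (S N))).
{ intros N HQ. change (s (S N)) with (epsilon (inhabits (0, 0)) (nxt N (s N))).
  apply epsilon_spec.
  destruct (Hstep _ _ _ _ (Hpos h N Hh) (Hpos k N Hk) HQ)
    as (a' & c' & Ha & Hc & HQ').
  exists (a', c'). unfold nxt. simpl fst. simpl snd.
  replace (h / 2 ^ S N) with (h / 2 ^ N / 2)
    by (simpl; field; apply Rgt_not_eq; apply Hp).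
  replace (k / 2 ^ S N) with (k / 2 ^ N / 2)
    by (simpl; field; apply Rgt_not_eq; apply Hp).
  now repeat split. }
assert (HQ : forall N, Q (fst (s N)) (snd (s N)) (h / 2 ^ N) (k / 2 ^ N)).
{ induction N as [|N IH].
  - simpl. now rewrite !Rdiv_1_r.
  - apply (Hn N IH). }
destruct (nested_halves (fun N => fst (s N)) h Hh) as [x Hx].
{ intro N. destruct (Hn N (HQ N)) as [H _]. pose proof (Hpos h (S N) ltac:(assumption)).
  cbv beta. lra. }
destruct (nested_halves (fun N => snd (s N)) k Hk) as [y Hy].
{ intro N. destruct (Hn N (HQ N)) as [_ [H _]]. pose proof (Hpos k (S N) ltac:(assumption)).
  cbv beta. lra. }
exists x, y. split; [|split].
- specialize (Hx 0%nat). simpl in Hx. lra.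
- specialize (Hy 0%nat). simpl in Hy. lra.
- intro N. exists (fst (s N)), (snd (s N)). auto.
Qed.

Lemma div_pow2_small (h e : R) : 0 < e -> exists N, h / 2 ^ N < e.
Proof.
intros He. destruct (Pow_x_infinity 2 ltac:(rewrite Rabs_pos_eq; lra) (h / e + 1))
  as [N HN].
exists N. specialize (HN N (Nat.le_refl N)).
assert (Hp : 0 < 2 ^ N) by (apply pow_lt; lra).
rewrite Rabs_pos_eq in HN by lra.
apply Rmult_lt_reg_r with (2 ^ N); [exact Hp|].
replace (h / 2 ^ N * 2 ^ N) with (h / e * e) by (field; lra).
nra.
Qed.

(* Bolzano-Weierstrass for a monotone family of sets of points of a rectangle. *)
Lemma cluster_point (E : R -> R -> R -> Prop) (a b c d : R) :
  (forall del del' x y, del <= del' -> E del x y -> E del' x y) ->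
  (forall del, 0 < del -> exists x y, a <= x <= b /\ c <= y <= d /\ E del x y) ->
  exists x y, a <= x <= b /\ c <= y <= d /\
    forall del, 0 < del ->
      exists x' y', Rabs (x' - x) < del /\ Rabs (y' - y) < del /\ E del x' y'.
Proof.
intros Hmon Hne.
assert (Hab : a <= b) by (destruct (Hne 1 Rlt_0_1) as (x & y & H); lra).
assert (Hcd : c <= d) by (destruct (Hne 1 Rlt_0_1) as (x & y & H); lra).
set (Q := fun a c h k => forall del, 0 < del ->
  exists x y, a <= x <= a + h /\ c <= y <= c + k /\ E del x y).
destruct (rect_bisect Q a c (b - a) (d - c)) as (x & y & Hx & Hy & HN);
  [lra|lra| | |].
- clear - Hmon. intros a c h k Hh Hk HQ.
  apply NNPP. intro Hno.
  assert (Hno' : forall a' c', (a' = a \/ a' = a + h / 2) ->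
    (c' = c \/ c' = c + k / 2) ->
    exists del, 0 < del /\ forall x y, a' <= x <= a' + h / 2 ->
      c' <= y <= c' + k / 2 -> ~ E del x y).
  { intros a' c' Ha Hc. apply NNPP. intro H. apply Hno. exists a', c'.
    repeat split; try assumption. intros del Hdel. apply NNPP. intro H'.
    apply H. exists del. split; [exact Hdel|]. intros x y Hx Hy HE. apply H'.
    now exists x, y. }
  destruct (Hno' a c) as (d1 & Hd1 & H1); auto.
  destruct (Hno' (a + h / 2) c) as (d2 & Hd2 & H2); auto.
  destruct (Hno' a (c + k / 2)) as (d3 & Hd3 & H3); auto.
  destruct (Hno' (a + h / 2) (c + k / 2)) as (d4 & Hd4 & H4); auto.
  set (e := Rmin (Rmin d1 d2) (Rmin d3 d4)).
  assert (He : 0 < e) by (unfold e; repeat apply Rmin_pos; assumption).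
  assert (He1 : e <= d1 /\ e <= d2 /\ e <= d3 /\ e <= d4).
  { unfold e, Rmin. repeat destruct Rle_dec; lra. }
  destruct (HQ e He) as (x & y & Hx & Hy & HE).
  destruct (Rle_dec x (a + h / 2)); destruct (Rle_dec y (c + k / 2)).
  + apply (H1 x y); [lra|lra|]. apply Hmon with e; [lra|exact HE].
  + apply (H3 x y); [lra|lra|]. apply Hmon with e; [lra|exact HE].
  + apply (H2 x y); [lra|lra|]. apply Hmon with e; [lra|exact HE].
  + apply (H4 x y); [lra|lra|]. apply Hmon with e; [lra|exact HE].
- intros del Hdel. destruct (Hne del Hdel) as (x & y & Hx & Hy & HE).
  exists x, y. repeat split; try lra. exact HE.
- exists x, y. split; [lra|]. split; [lra|]. intros del Hdel.
  destruct (div_pow2_small (b - a + (d - c)) del Hdel) as [N HN1].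
  destruct (HN N) as (a' & c' & HQ & Hx' & Hy').
  destruct (HQ del Hdel) as (x' & y' & Hx1 & Hy1 & HE).
  assert (Hp : 0 < / 2 ^ N) by (apply Rinv_0_lt_compat, pow_lt; lra).
  unfold Rdiv in *.
  assert (0 <= (b - a) * / 2 ^ N) by (apply Rmult_le_pos; lra).
  assert (0 <= (d - c) * / 2 ^ N) by (apply Rmult_le_pos; lra).
  exists x', y'. repeat split; try exact HE; apply Rabs_def1; lra.
Qed.

(* The rectangle is [a, a + h] x [c, c + k]. *)
Definition flux (P Q : R -> R -> R) (a c h k : R) : R :=
  RInt (fun y => P (a + h) y - P a y) c (c + k) +
  RInt (fun x => Q x (c + k) - Q x c) a (a + h).

Lemma continuity_2d_pt_section (f : R -> R -> R) (x y : R) :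
  continuity_2d_pt f x y ->
  continuous (fun t => f x t) y /\ continuous (fun t => f t y) x.
Proof.
intro Hf. split; apply continuity_pt_filterlim; intros e He;
  destruct (Hf (mkposreal e He)) as [d Hd]; exists d;
  (split; [apply cond_pos|]); intros t [_ Ht]; apply Hd; try exact Ht;
  rewrite Rminus_diag, Rabs_R0; apply cond_pos.
Qed.

Lemma ex_RInt_section (f : R -> R -> R) (a b c d : R) :
  a <= b -> c <= d ->
  (forall x y, a <= x <= b -> c <= y <= d -> continuity_2d_pt f x y) ->
  (forall x u v, a <= x <= b -> c <= u -> u <= v -> v <= d ->
     ex_RInt (fun t => f x t) u v) /\
  (forall y u v, c <= y <= d -> a <= u -> u <= v -> v <= b ->
     ex_RInt (fun t => f t y) u v).
Proof.
intros Hab Hcd Hf. split.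
- intros x u v Hx Hu Huv Hv. apply (ex_RInt_continuous (V := R_CompleteNormedModule)).
  rewrite Rmin_left, Rmax_right by lra. intros z Hz.
  apply (continuity_2d_pt_section f x z). apply Hf; lra.
- intros y u v Hy Hu Huv Hv. apply (ex_RInt_continuous (V := R_CompleteNormedModule)).
  rewrite Rmin_left, Rmax_right by lra. intros z Hz.
  apply (continuity_2d_pt_section f z y). apply Hf; lra.
Qed.

Lemma ex_RInt_Rminus (f g : R -> R) (a b : R) :
  ex_RInt f a b -> ex_RInt g a b -> ex_RInt (fun x => f x - g x) a b.
Proof. apply (ex_RInt_minus (V := R_NormedModule)). Qed.

Lemma RInt_Rminus (f g : R -> R) (a b : R) :
  ex_RInt f a b -> ex_RInt g a b ->
  RInt (fun x => f x - g x) a b = RInt f a b - RInt g a b.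
Proof. apply (RInt_minus (V := R_CompleteNormedModule)). Qed.

Lemma RInt_RChasles (f : R -> R) (a b c : R) :
  ex_RInt f a b -> ex_RInt f b c -> RInt f a c = RInt f a b + RInt f b c.
Proof. intros. symmetry. now apply (RInt_Chasles (V := R_CompleteNormedModule)). Qed.

(** The two inner edges are traversed by adjacent quarters with opposite signs, so their
    contributions cancel. *)
Lemma flux_quarters (P Q : R -> R -> R) (a c h k : R) :
  0 <= h -> 0 <= k ->
  (forall x y, a <= x <= a + h -> c <= y <= c + k ->
     continuity_2d_pt P x y /\ continuity_2d_pt Q x y) ->
  flux P Q a c h k =
    flux P Q a c (h / 2) (k / 2) + flux P Q (a + h / 2) c (h / 2) (k / 2) +
    flux P Q a (c + k / 2) (h / 2) (k / 2) +
    flux P Q (a + h / 2) (c + k / 2) (h / 2) (k / 2).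
Proof.
intros Hh Hk Hc. unfold flux.
destruct (ex_RInt_section P a (a + h) c (c + k)) as [HP _]; [lra|lra|apply Hc|].
destruct (ex_RInt_section Q a (a + h) c (c + k)) as [_ HQ]; [lra|lra|apply Hc|].
replace (a + h / 2 + h / 2) with (a + h) by field.
replace (c + k / 2 + k / 2) with (c + k) by field.
set (m := a + h / 2). set (n := c + k / 2).
assert (Hm : a <= m <= a + h) by (unfold m; lra).
assert (Hn : c <= n <= c + k) by (unfold n; lra).
assert (SP : forall x1 x2, a <= x1 <= a + h -> a <= x2 <= a + h ->
  RInt (fun y => P x1 y - P x2 y) c n =
    RInt (fun y => P x1 y) c n - RInt (fun y => P x2 y) c n /\
  RInt (fun y => P x1 y - P x2 y) n (c + k) =
    RInt (fun y => P x1 y) n (c + k) - RInt (fun y => P x2 y) n (c + k) /\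
  RInt (fun y => P x1 y - P x2 y) c (c + k) =
    RInt (fun y => P x1 y) c n + RInt (fun y => P x1 y) n (c + k) -
    (RInt (fun y => P x2 y) c n + RInt (fun y => P x2 y) n (c + k))).
{ intros. rewrite <- !RInt_RChasles by (apply HP; lra).
  repeat split; apply RInt_Rminus; apply HP; lra. }
assert (SQ : forall y1 y2, c <= y1 <= c + k -> c <= y2 <= c + k ->
  RInt (fun x => Q x y1 - Q x y2) a m =
    RInt (fun x => Q x y1) a m - RInt (fun x => Q x y2) a m /\
  RInt (fun x => Q x y1 - Q x y2) m (a + h) =
    RInt (fun x => Q x y1) m (a + h) - RInt (fun x => Q x y2) m (a + h) /\
  RInt (fun x => Q x y1 - Q x y2) a (a + h) =
    RInt (fun x => Q x y1) a m + RInt (fun x => Q x y1) m (a + h) -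
    (RInt (fun x => Q x y2) a m + RInt (fun x => Q x y2) m (a + h))).
{ intros. rewrite <- !RInt_RChasles by (apply HQ; lra).
  repeat split; apply RInt_Rminus; apply HQ; lra. }
destruct (SP (a + h) a) as (P1 & P2 & P3); [lra|lra|].
destruct (SP m a) as (P4 & P5 & _); [lra|lra|].
destruct (SP (a + h) m) as (P6 & P7 & _); [lra|lra|].
destruct (SQ (c + k) c) as (Q1 & Q2 & Q3); [lra|lra|].
destruct (SQ n c) as (Q4 & Q5 & _); [lra|lra|].
destruct (SQ (c + k) n) as (Q6 & Q7 & _); [lra|lra|].
rewrite P3, Q3, P4, P5, P6, P7, Q4, Q5, Q6, Q7.
ring.
Qed.

Lemma Rabs_RInt_le (f : R -> R) (a b m : R) :
  a <= b -> ex_RInt f a b -> (forall t, a <= t <= b -> Rabs (f t) <= m) ->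
  Rabs (RInt f a b) <= m * (b - a).
Proof. intros. rewrite Rmult_comm. now apply abs_RInt_le_const. Qed.

Lemma RInt_near_const (f : R -> R) (a b v m : R) :
  a <= b -> ex_RInt f a b -> (forall t, a <= t <= b -> Rabs (f t - v) <= m) ->
  Rabs (RInt f a b - v * (b - a)) <= m * (b - a).
Proof.
intros Hab Hf Hm.
assert (Hc : ex_RInt (fun _ : R => v) a b) by apply ex_RInt_const.
replace (v * (b - a)) with (RInt (fun _ => v) a b)
  by (rewrite RInt_const; unfold scal; simpl; unfold mult; simpl; ring).
rewrite <- RInt_Rminus by assumption.
apply Rabs_RInt_le; [exact Hab| now apply ex_RInt_Rminus|exact Hm].
Qed.

(* Goursat's lemma: no continuity of the partial derivatives is needed. *)
Lemma flux_divergence_free (P Q : R -> R -> R) (a c h k : R) :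
  0 < h -> 0 < k ->
  (forall x y, a <= x <= a + h -> c <= y <= c + k -> exists A B C,
     differentiable_pt_lim P x y A B /\ differentiable_pt_lim Q x y C (- A)) ->
  flux P Q a c h k = 0.
Proof.
intros Hh Hk Hd.
assert (Hc : forall x y, a <= x <= a + h -> c <= y <= c + k ->
     continuity_2d_pt P x y /\ continuity_2d_pt Q x y).
{ intros x y Hx Hy. destruct (Hd x y Hx Hy) as (A & B & C & H1 & H2).
  split; apply differentiable_continuity_pt; eexists; eexists; eassumption. }
apply NNPP. intro Hne.
assert (Habs : 0 < Rabs (flux P Q a c h k)) by now apply Rabs_pos_lt.
(* Half of the mean flux density: the factor 2 makes the bound strict on the initial rectangle, and
   some quarter always inherits it. *)
set (eta := Rabs (flux P Q a c h k) / (2 * (h * k))).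
assert (Hhk : 0 < h * k) by now apply Rmult_lt_0_compat.
assert (Heta : 0 < eta) by (apply Rdiv_lt_0_compat; lra).
destruct (rect_bisect (fun a' c' h' k' =>
   (a <= a' /\ a' + h' <= a + h) /\ (c <= c' /\ c' + k' <= c + k) /\
   eta * (h' * k') < Rabs (flux P Q a' c' h' k')) a c h k)
  as (x & y & Hx & Hy & HN); [lra|lra| | |].
- intros a' c' h' k' Hh' Hk' (Ha' & Hc' & Hbig).
  rewrite flux_quarters in Hbig; [|lra|lra|intros; apply Hc; lra].
  apply NNPP. intro Hno.
  assert (Hs : forall a'' c'', (a'' = a' \/ a'' = a' + h' / 2) ->
    (c'' = c' \/ c'' = c' + k' / 2) ->
    Rabs (flux P Q a'' c'' (h' / 2) (k' / 2)) <= eta * (h' / 2 * (k' / 2))).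
  { intros a'' c'' Ha Hcc. apply Rnot_lt_le. intro Hlt. apply Hno.
    exists a'', c''. repeat split; try assumption; lra. }
  pose proof (Hs a' c' ltac:(auto) ltac:(auto)) as H1.
  pose proof (Hs (a' + h' / 2) c' ltac:(auto) ltac:(auto)) as H2.
  pose proof (Hs a' (c' + k' / 2) ltac:(auto) ltac:(auto)) as H3.
  pose proof (Hs (a' + h' / 2) (c' + k' / 2) ltac:(auto) ltac:(auto)) as H4.
  clear - Hbig H1 H2 H3 H4.
  revert Hbig H1 H2 H3 H4.
  generalize (flux P Q a' c' (h' / 2) (k' / 2))
    (flux P Q (a' + h' / 2) c' (h' / 2) (k' / 2))
    (flux P Q a' (c' + k' / 2) (h' / 2) (k' / 2))
    (flux P Q (a' + h' / 2) (c' + k' / 2) (h' / 2) (k' / 2)).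
  intros f1 f2 f3 f4 Hbig H1 H2 H3 H4.
  pose proof (Rabs_triang (f1 + f2 + f3) f4).
  pose proof (Rabs_triang (f1 + f2) f3).
  pose proof (Rabs_triang f1 f2).
  lra.
- repeat split; try lra. unfold eta.
  replace (Rabs (flux P Q a c h k) / (2 * (h * k)) * (h * k))
    with (Rabs (flux P Q a c h k) / 2) by (field; lra).
  lra.
- destruct (Hd x y Hx Hy) as (A & B & C & HP & HQ).
  (* Tuned so that the final error 2 e r r, with r the sum of the two sides of a small rectangle,
     equals eta times its area. *)
  assert (He : 0 < eta * (h * k) / (2 * (h + k) * (h + k))).
  { apply Rdiv_lt_0_compat; [apply Rmult_lt_0_compat; lra|].
    apply Rmult_lt_0_compat; lra. }
  set (e := mkposreal _ He).
  destruct (HP e) as [d1 Hd1]. destruct (HQ e) as [d2 Hd2].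
  destruct (div_pow2_small (h + k) (Rmin d1 d2)) as [N HNs];
    [apply Rmin_pos; apply cond_pos|].
  destruct (HN N) as (a' & c' & (Ha' & Hc' & Hbig) & Hx' & Hy'). clear HN.
  assert (Hp : 0 < / 2 ^ N) by (apply Rinv_0_lt_compat, pow_lt; lra).
  assert (Heq : e * (2 * ((h + k) / 2 ^ N) * ((h + k) / 2 ^ N)) =
                eta * (h / 2 ^ N * (k / 2 ^ N))).
  { unfold e; simpl. field. split; [apply pow_nonzero|]; lra. }
  assert (Hsum : (h + k) / 2 ^ N = h / 2 ^ N + k / 2 ^ N)
    by (unfold Rdiv; ring).
  rewrite Hsum in *.
  assert (Hh' : 0 < h / 2 ^ N) by (apply Rmult_lt_0_compat; lra).
  assert (Hk' : 0 < k / 2 ^ N) by (apply Rmult_lt_0_compat; lra).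
  set (h' := h / 2 ^ N) in *. set (k' := k / 2 ^ N) in *.
  set (r := h' + k') in *.
  assert (Hr1 : r < d1) by (apply Rlt_le_trans with (1 := HNs); apply Rmin_l).
  assert (Hr2 : r < d2) by (apply Rlt_le_trans with (1 := HNs); apply Rmin_r).
  assert (Her : 0 < e) by apply cond_pos.
  assert (HPb : forall u v, a' <= u <= a' + h' -> c' <= v <= c' + k' ->
     Rabs (P u v - P x y - (A * (u - x) + B * (v - y))) <= e * r).
  { intros u v Hu Hv.
    assert (Hux : Rabs (u - x) <= r) by (apply Rabs_le; unfold r; lra).
    assert (Hvy : Rabs (v - y) <= r) by (apply Rabs_le; unfold r; lra).
    eapply Rle_trans; [apply Hd1; lra|].
    apply Rmult_le_compat_l; [lra|]. now apply Rmax_lub. }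
  assert (HQb : forall u v, a' <= u <= a' + h' -> c' <= v <= c' + k' ->
     Rabs (Q u v - Q x y - (C * (u - x) + - A * (v - y))) <= e * r).
  { intros u v Hu Hv.
    assert (Hux : Rabs (u - x) <= r) by (apply Rabs_le; unfold r; lra).
    assert (Hvy : Rabs (v - y) <= r) by (apply Rabs_le; unfold r; lra).
    eapply Rle_trans; [apply Hd2; lra|].
    apply Rmult_le_compat_l; [lra|]. now apply Rmax_lub. }
  destruct (ex_RInt_section P a (a + h) c (c + k)) as [HPi _]; [lra|lra|apply Hc|].
  destruct (ex_RInt_section Q a (a + h) c (c + k)) as [_ HQi]; [lra|lra|apply Hc|].
  (* The affine part of [P] contributes A h' k' and that of [Q] contributes - A h' k'. These cancel,
     which leaves only the remainders. *)
  assert (I1 : Rabs (RInt (fun v => P (a' + h') v - P a' v) c' (c' + k') -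
                 A * h' * (c' + k' - c')) <= 2 * (e * r) * (c' + k' - c')).
  { apply RInt_near_const; [lra|apply ex_RInt_Rminus; apply HPi; lra|].
    intros v Hv.
    pose proof (HPb (a' + h') v ltac:(lra) Hv) as H1.
    pose proof (HPb a' v ltac:(lra) Hv) as H2.
    apply Rabs_le_between in H1. apply Rabs_le_between in H2.
    apply Rabs_le. lra. }
  assert (I2 : Rabs (RInt (fun u => Q u (c' + k') - Q u c') a' (a' + h') -
                 (- A * k') * (a' + h' - a')) <= 2 * (e * r) * (a' + h' - a')).
  { apply RInt_near_const; [lra|apply ex_RInt_Rminus; apply HQi; lra|].
    intros u Hu.
    pose proof (HQb u (c' + k') Hu ltac:(lra)) as H1.
    pose proof (HQb u c' Hu ltac:(lra)) as H2.
    apply Rabs_le_between in H1. apply Rabs_le_between in H2.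
    apply Rabs_le. lra. }
  unfold flux in Hbig.
  apply Rabs_le_between in I1. apply Rabs_le_between in I2.
  apply Rlt_not_le in Hbig. apply Hbig. rewrite <- Heq.
  apply Rabs_le. unfold r in *. lra.
Qed.

(** * Complex derivatives and the mean value property *)

(** Additive form of the complex derivative: there is no quotient, so h = 0 is included and real and
    imaginary parts separate directly. *)
Definition cderiv (f : C -> C) (z d : C) : Prop :=
  forall e, 0 < e -> exists r, 0 < r /\ forall h : C, Cmod h < r ->
    Cmod (f (z + h) - f z - d * h)%C <= e * Cmod h.

Lemma Cmod_minus_sym (a b : C) : Cmod (a - b) = Cmod (b - a).
Proof. rewrite <- Cmod_opp. f_equal. ring. Qed.

Lemma Im_le_Cmod (z : C) : Rabs (Im z) <= Cmod z.
Proof. eapply Rle_trans; [apply Rmax_r|apply Rmax_Cmod]. Qed.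

Lemma Cmod_le_Re_Im (z : C) : Cmod z <= Rabs (Re z) + Rabs (Im z).
Proof.
replace z with (RtoC (Re z) + RtoC (Im z) * Ci)%C at 1.
- eapply Rle_trans; [apply Cmod_triangle|].
  rewrite Cmod_mult, !Cmod_R, Cmod_Ci. lra.
- destruct z as [x y]. apply injective_projections; simpl; ring.
Qed.

Lemma Cmod_sum_lt (a b c : C) (e : R) :
  Cmod (a - b) < e / 2 -> Cmod (b - c) < e / 2 -> Cmod (a - c) < e.
Proof.
intros H1 H2. replace (a - c)%C with ((a - b) + (b - c))%C by ring.
eapply Rle_lt_trans; [apply Cmod_triangle|]. lra.
Qed.

Lemma locally_C_ball (z : C) (P : C -> Prop) :
  @locally C_UniformSpace z P <->
  exists r, 0 < r /\ forall y : C, Cmod (y - z) < r -> P y.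
Proof.
split.
- intros [e He]. exists e. split; [apply cond_pos|]. intros y Hy. apply He.
  now apply C_NormedModule_mixin_compat1.
- intros (r & Hr & H).
  assert (Hr2 : 0 < r / 2) by lra.
  exists (mkposreal _ Hr2). intros y Hy. apply H.
  eapply Rlt_le_trans; [exact (C_NormedModule_mixin_compat2 z y _ Hy)|]. simpl.
  assert (sqrt 2 <= 2).
  { rewrite <- (sqrt_square 2) at 2 by lra. apply sqrt_le_1_alt. lra. }
  nra.
Qed.

Lemma ex_derive_cderiv (f : C -> C) (z : C) :
  @ex_derive C_AbsRing C_NormedModule f z -> exists d, cderiv f z d.
Proof.
intros [d [_ Hd]]. exists d. intros e He.
specialize (Hd z (fun P H => H) (mkposreal e He)).
destruct Hd as [r Hr]. exists r. split; [apply cond_pos|]. intros h Hh.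
assert (Hh' : Cmod (z + h - z) < r) by now replace (z + h - z)%C with h by ring.
specialize (Hr (z + h)%C Hh').
change (Cmod (f (z + h) - f z - (z + h - z) * d)%C <= e * Cmod (z + h - z)%C) in Hr.
replace (z + h - z)%C with h in Hr by ring.
rewrite (Cmult_comm d h). auto.
Qed.

Lemma cderiv_cont (f : C -> C) (z d : C) : cderiv f z d ->
  forall e, 0 < e -> exists r, 0 < r /\ forall y, Cmod (y - z) < r ->
    Cmod (f y - f z) < e.
Proof.
intros Hf e He. destruct (Hf 1 Rlt_0_1) as (r & Hr & H).
pose proof (Cmod_ge_0 d) as Hd.
exists (Rmin r (e / (2 + Cmod d))).
assert (He2 : 0 < e / (2 + Cmod d)) by (apply Rdiv_lt_0_compat; lra).
split; [now apply Rmin_pos|]. intros y Hy.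
specialize (H (y - z)%C).
pose proof (Rmin_l r (e / (2 + Cmod d))). pose proof (Rmin_r r (e / (2 + Cmod d))).
assert (H' : Cmod (y - z) < r) by lra. specialize (H H').
replace (z + (y - z))%C with y in H by ring.
replace (f y - f z)%C with ((f y - f z - d * (y - z)) + d * (y - z))%C by ring.
eapply Rle_lt_trans; [apply Cmod_triangle|]. rewrite Cmod_mult.
assert (Hy2 : Cmod (y - z) < e / (2 + Cmod d)) by lra.
apply Rmult_lt_compat_r with (r := 2 + Cmod d) in Hy2; [|lra].
replace (e / (2 + Cmod d) * (2 + Cmod d)) with e in Hy2 by (field; lra).
pose proof (Cmod_ge_0 (y - z)). lra.
Qed.

Lemma cderiv_const (c z : C) : cderiv (fun _ => c) z 0.
Proof.
intros e He. exists 1. split; [lra|]. intros h _.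
replace (c - c - 0 * h)%C with (RtoC 0) by ring. rewrite Cmod_0.
pose proof (Cmod_ge_0 h). nra.
Qed.

Lemma cderiv_id (z : C) : cderiv (fun x => x) z 1.
Proof.
intros e He. exists 1. split; [lra|]. intros h _.
replace (z + h - z - 1 * h)%C with (RtoC 0) by ring. rewrite Cmod_0.
pose proof (Cmod_ge_0 h). nra.
Qed.

Lemma cderiv_plus (f g : C -> C) (z d d' : C) :
  cderiv f z d -> cderiv g z d' -> cderiv (fun x => f x + g x)%C z (d + d').
Proof.
intros Hf Hg e He.
destruct (Hf (e / 2) ltac:(lra)) as (r & Hr & H).
destruct (Hg (e / 2) ltac:(lra)) as (r' & Hr' & H').
exists (Rmin r r'). split; [now apply Rmin_pos|]. intros h Hh.
pose proof (Rmin_l r r'). pose proof (Rmin_r r r').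
specialize (H h ltac:(lra)). specialize (H' h ltac:(lra)).
replace (f (z + h) + g (z + h) - (f z + g z) - (d + d') * h)%C with
  ((f (z + h) - f z - d * h) + (g (z + h) - g z - d' * h))%C by ring.
eapply Rle_trans; [apply Cmod_triangle|]. lra.
Qed.

(** Here k is the increment of g; the error splits into that of f at k and d times that of g at h,
    each allotted half of e. *)
Lemma cderiv_comp (f g : C -> C) (z d d' : C) :
  cderiv g z d' -> cderiv f (g z) d -> cderiv (fun x => f (g x)) z (d * d').
Proof.
intros Hg Hf e He.
pose proof (Cmod_ge_0 d) as Hd. pose proof (Cmod_ge_0 d') as Hd'.
assert (E1 : 0 < e / (2 * (1 + Cmod d'))) by (apply Rdiv_lt_0_compat; lra).
assert (E2 : 0 < Rmin 1 (e / (2 * (1 + Cmod d))))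
  by (apply Rmin_pos; [|apply Rdiv_lt_0_compat]; lra).
destruct (Hf _ E1) as (r & Hr & H).
destruct (Hg _ E2) as (r' & Hr' & H').
destruct (cderiv_cont g z d' Hg r Hr) as (r'' & Hr'' & H'').
exists (Rmin r' r''). split; [now apply Rmin_pos|]. intros h Hh.
pose proof (Rmin_l r' r''). pose proof (Rmin_r r' r'').
specialize (H' h ltac:(lra)).
specialize (H'' (z + h)%C). replace (z + h - z)%C with h in H'' by ring.
specialize (H'' ltac:(lra)).
specialize (H (g (z + h) - g z)%C H'').
replace (g z + (g (z + h) - g z))%C with (g (z + h)%C) in H by ring.
set (k := (g (z + h)%C - g z)%C) in *.
assert (HK1 : Cmod (k - d' * h) <= Cmod h).
{ eapply Rle_trans; [exact H'|]. pose proof (Cmod_ge_0 h).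
  pose proof (Rmin_l 1 (e / (2 * (1 + Cmod d)))). nra. }
assert (HK2 : Cmod (k - d' * h) <= e / (2 * (1 + Cmod d)) * Cmod h).
{ eapply Rle_trans; [exact H'|]. pose proof (Cmod_ge_0 h).
  pose proof (Rmin_r 1 (e / (2 * (1 + Cmod d)))). nra. }
assert (Hk : Cmod k <= (1 + Cmod d') * Cmod h).
{ replace k with ((k - d' * h) + d' * h)%C by ring.
  eapply Rle_trans; [apply Cmod_triangle|]. rewrite Cmod_mult. lra. }
replace (f (g (z + h)) - f (g z) - d * d' * h)%C with
  ((f (g (z + h)) - f (g z) - d * k) + d * (k - d' * h))%C by ring.
eapply Rle_trans; [apply Cmod_triangle|]. rewrite Cmod_mult.
assert (A1 : e / (2 * (1 + Cmod d')) * Cmod k <= e / 2 * Cmod h).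
{ replace (e / 2 * Cmod h) with
    (e / (2 * (1 + Cmod d')) * ((1 + Cmod d') * Cmod h)) by (field; lra).
  apply Rmult_le_compat_l; lra. }
assert (A2 : Cmod d * Cmod (k - d' * h) <= e / 2 * Cmod h).
{ replace (e / 2 * Cmod h) with
    ((1 + Cmod d) * (e / (2 * (1 + Cmod d)) * Cmod h)) by (field; lra).
  apply Rmult_le_compat; try lra. apply Cmod_ge_0. }
lra.
Qed.

Lemma cderiv_scal (c : C) (f : C -> C) (z d : C) :
  cderiv f z d -> cderiv (fun x => c * f x)%C z (c * d).
Proof.
intro Hf. apply (cderiv_comp (fun x => c * x)%C f z c d Hf).
intros e He. exists 1. split; [lra|]. intros h _.
replace (c * (f z + h) - c * f z - c * h)%C with (RtoC 0) by ring.
rewrite Cmod_0. pose proof (Cmod_ge_0 h). nra.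
Qed.

Lemma cderiv_minus (f g : C -> C) (z d d' : C) :
  cderiv f z d -> cderiv g z d' -> cderiv (fun x => f x - g x)%C z (d - d').
Proof.
intros Hf Hg. apply (cderiv_scal (-(1))%C) in Hg.
pose proof (cderiv_plus _ _ _ _ _ Hf Hg) as H.
intros e He. destruct (H e He) as (r & Hr & H'). exists r. split; [exact Hr|].
intros h Hh. specialize (H' h Hh).
replace (f (z + h) - g (z + h) - (f z - g z) - (d - d') * h)%C with
  (f (z + h) + - (1) * g (z + h) - (f z + - (1) * g z) - (d + - (1) * d') * h)%C
  by ring. exact H'.
Qed.

Lemma cderiv_inv (z : C) : z <> 0%C -> cderiv Cinv z (- / (z * z)).
Proof.
intros Hz e He.
assert (Hm : 0 < Cmod z) by now apply Cmod_gt_0.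
assert (Hm3 : 0 < Cmod z * Cmod z * Cmod z)
  by (repeat apply Rmult_lt_0_compat; exact Hm).
exists (Rmin (Cmod z / 2) (e * (Cmod z * Cmod z * Cmod z) / 2)).
split; [apply Rmin_pos; [lra|]; apply Rmult_lt_0_compat; [|lra];
  now apply Rmult_lt_0_compat|].
intros h Hh.
pose proof (Rmin_l (Cmod z / 2) (e * (Cmod z * Cmod z * Cmod z) / 2)).
pose proof (Rmin_r (Cmod z / 2) (e * (Cmod z * Cmod z * Cmod z) / 2)).
assert (Hzh : Cmod z / 2 <= Cmod (z + h)).
{ pose proof (Cmod_triangle (z + h) (- h)) as T. rewrite Cmod_opp in T.
  replace (z + h + - h)%C with z in T by ring. lra. }
assert (Hzh0 : (z + h)%C <> 0%C).
{ apply Cmod_gt_0. lra. }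
replace (/ (z + h) - / z - - / (z * z) * h)%C with
  (h * (h * / ((z + h) * (z * z))))%C by (field; auto).
rewrite !Cmod_mult, Cmod_inv, !Cmod_mult
  by (repeat apply Cmult_neq_0; assumption).
rewrite Rmult_comm. apply Rmult_le_compat_r; [apply Cmod_ge_0|].
assert (Hp : 0 < Cmod (z + h) * (Cmod z * Cmod z))
  by (repeat apply Rmult_lt_0_compat; lra).
apply Rmult_le_reg_r with (1 := Hp).
rewrite Rmult_assoc, Rinv_l, Rmult_1_r by lra.
apply Rle_trans with (e * (Cmod z / 2 * (Cmod z * Cmod z))); [lra|].
apply Rmult_le_compat_l; [lra|]. apply Rmult_le_compat_r; [|exact Hzh].
nra.
Qed.

Lemma Cexp_plus (z h : C) : Cexp (z + h) = (Cexp z * Cexp h)%C.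
Proof.
destruct z as [x y], h as [a b]. unfold Cexp, Re, Im; simpl.
rewrite exp_plus, cos_plus, sin_plus.
apply injective_projections; simpl; ring.
Qed.

Lemma derivable_pt_lim_bound (f : R -> R) (x l : R) :
  derivable_pt_lim f x l -> forall e, 0 < e -> exists r, 0 < r /\
  forall h, Rabs h < r -> Rabs (f (x + h) - f x - l * h) <= e * Rabs h.
Proof.
intros Hf e He. destruct (Hf e He) as [r Hr]. exists r.
split; [apply cond_pos|]. intros h Hh.
destruct (Req_dec h 0) as [->|H0].
- rewrite Rplus_0_r, Rminus_diag, Rmult_0_r, Rminus_diag, Rabs_R0. lra.
- replace (f (x + h) - f x - l * h) with (((f (x + h) - f x) / h - l) * h)
    by (field; exact H0).
  rewrite Rabs_mult. apply Rmult_le_compat_r; [apply Rabs_pos|].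
  apply Rlt_le. now apply Hr.
Qed.

Lemma cderiv_exp (z : C) : cderiv Cexp z (Cexp z).
Proof.
(* Only the origin needs estimates; the functional equation carries the derivative to z. *)
assert (H0 : cderiv Cexp 0 1).
{ intros e He. set (e' := Rmin (e / 10) 1).
  assert (He' : 0 < e' /\ e' <= e / 10 /\ e' <= 1).
  { unfold e'. split; [apply Rmin_pos; lra|]. split; [apply Rmin_l|apply Rmin_r]. }
  destruct (derivable_pt_lim_bound _ _ _ (derivable_pt_lim_exp_0) e' ltac:(lra))
    as (r1 & Hr1 & H1).
  destruct (derivable_pt_lim_bound _ _ _ (derivable_pt_lim_cos 0) e' ltac:(lra))
    as (r2 & Hr2 & H2).
  destruct (derivable_pt_lim_bound _ _ _ (derivable_pt_lim_sin_0) e' ltac:(lra))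
    as (r3 & Hr3 & H3).
  exists (Rmin (Rmin r1 r2) (Rmin r3 e')).
  split; [repeat apply Rmin_pos; lra|]. intros h Hh.
  pose proof (Rmin_l (Rmin r1 r2) (Rmin r3 e')).
  pose proof (Rmin_r (Rmin r1 r2) (Rmin r3 e')).
  pose proof (Rmin_l r1 r2). pose proof (Rmin_r r1 r2).
  pose proof (Rmin_l r3 e'). pose proof (Rmin_r r3 e').
  pose proof (re_le_Cmod h) as Ha. pose proof (Im_le_Cmod h) as Hb.
  assert (Hm : 0 <= Cmod h < e') by (split; [apply Cmod_ge_0|lra]).
  specialize (H1 (Re h) ltac:(lra)). specialize (H2 (Im h) ltac:(lra)).
  specialize (H3 (Im h) ltac:(lra)).
  replace (0 + h)%C with h by ring.
  rewrite !Rplus_0_l in *. rewrite exp_0 in H1. rewrite cos_0, sin_0 in H2.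
  rewrite sin_0 in H3.
  eapply Rle_trans; [apply Cmod_le_Re_Im|].
  destruct h as [a b]. unfold Cexp, Re, Im in *; simpl in *.
  rewrite exp_0, cos_0, sin_0.
  set (m := Cmod (a, b)) in *.
  set (p := exp a - 1 - 1 * a) in *.
  set (q := cos b - 1 - - 0 * b) in *.
  set (s := sin b - 0 - 1 * b) in *.
  assert (Hp : Rabs p <= e' * m) by (clear - H1 Ha He'; nra).
  assert (Hq : Rabs q <= e' * m) by (clear - H2 Hb He'; nra).
  assert (Hs : Rabs s <= e' * m) by (clear - H3 Hb He'; nra).
  assert (Hee : e' * m <= m) by (clear - He' Hm; nra).
  (* With exp a = 1 + a + p, cos b = 1 + q and sin b = b + s, both parts of the error become sums of
     remainders and of one product of two first order terms. The total is at most 9 e' m, which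
     explains e / 10. *)
  match goal with |- Rabs ?u + Rabs ?v <= _ =>
    replace u with (p + (1 + a + p) * q) by (unfold p, q; ring);
    replace v with (s + (a + p) * (b + s)) by (unfold p, s; ring) end.
  assert (Hbs : Rabs (b + s) <= 2 * m)
    by (pose proof (Rabs_triang b s); lra).
  assert (Hap : Rabs (a + p) <= 2 * m)
    by (pose proof (Rabs_triang a p); lra).
  assert (Hap1 : Rabs (1 + a + p) <= 3).
  { replace (1 + a + p) with (1 + (a + p)) by ring.
    pose proof (Rabs_triang 1 (a + p)) as T. rewrite Rabs_R1 in T. lra. }
  pose proof (Rabs_triang p ((1 + a + p) * q)) as T1.
  pose proof (Rabs_triang s ((a + p) * (b + s))) as T2.
  rewrite Rabs_mult in T1, T2.
  assert (B1 : Rabs (1 + a + p) * Rabs q <= 3 * (e' * m))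
    by (apply Rmult_le_compat; try apply Rabs_pos; lra).
  assert (B2 : Rabs (a + p) * Rabs (b + s) <= (2 * m) * (2 * m))
    by (apply Rmult_le_compat; try apply Rabs_pos; lra).
  assert (B3 : m * m <= e' * m) by (clear - Hm; nra).
  assert (B4 : 10 * (e' * m) <= e * m) by (clear - Hm He'; nra).
  assert (0 <= e' * m) by (clear - Hm He'; nra). lra. }
intros e He.
assert (Hpos : 0 < e / (1 + Cmod (Cexp z)))
  by (apply Rdiv_lt_0_compat; [|pose proof (Cmod_ge_0 (Cexp z))]; lra).
destruct (H0 _ Hpos) as (r & Hr & H). exists r. split; [exact Hr|].
intros h Hh. specialize (H h Hh).
rewrite Cexp_plus.
replace (0 + h)%C with h in H by ring.
assert (E0 : Cexp 0 = 1%C).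
{ unfold Cexp, Re, Im; simpl. rewrite exp_0, cos_0, sin_0.
  apply injective_projections; simpl; ring. }
rewrite E0 in H.
replace (Cexp z * Cexp h - Cexp z - Cexp z * h)%C with
  (Cexp z * (Cexp h - 1 - 1 * h))%C by ring.
rewrite Cmod_mult.
pose proof (Cmod_ge_0 (Cexp z)). pose proof (Cmod_ge_0 h).
apply Rle_trans with ((1 + Cmod (Cexp z)) * (e / (1 + Cmod (Cexp z)) * Cmod h)).
- apply Rmult_le_compat; try lra. apply Cmod_ge_0.
- right. field. lra.
Qed.

Lemma cderiv_differentiable (f : C -> C) (x y : R) (d : C) :
  cderiv f (x, y) d ->
  differentiable_pt_lim (fun u v => Re (f (u, v))) x y (Re d) (- Im d) /\
  differentiable_pt_lim (fun u v => Im (f (u, v))) x y (Im d) (Re d).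
Proof.
intros Hf.
assert (Hb : forall e : posreal, locally_2d (fun u v =>
  Cmod (f (u, v) - f (x, y) - d * (u - x, v - y)%R)%C <=
    e * Rmax (Rabs (u - x)) (Rabs (v - y))) x y).
{ intros [e He]. destruct (Hf (e / 2) ltac:(lra)) as (r & Hr & H).
  assert (Hr2 : 0 < r / 2) by lra.
  exists (mkposreal _ Hr2). intros u v Hu Hv. simpl in Hu, Hv.
  set (h := (u - x, v - y)%R : C).
  assert (Hh : Cmod h <= 2 * Rmax (Rabs (u - x)) (Rabs (v - y))).
  { eapply Rle_trans; [apply Cmod_le_Re_Im|]. unfold h, Re, Im; simpl.
    pose proof (Rmax_l (Rabs (u - x)) (Rabs (v - y))).
    pose proof (Rmax_r (Rabs (u - x)) (Rabs (v - y))). lra. }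
  assert (Hm : Rmax (Rabs (u - x)) (Rabs (v - y)) < r / 2)
    by now apply Rmax_lub_lt.
  specialize (H h ltac:(lra)).
  replace ((x, y) + h)%C with ((u, v) : C) in H
    by (unfold h; apply injective_projections; simpl; ring).
  eapply Rle_trans; [exact H|]. simpl. nra. }
split; intros e; destruct (Hb e) as [r Hr]; exists r; intros u v Hu Hv;
  specialize (Hr u v Hu Hv); eapply Rle_trans; try exact Hr.
- eapply Rle_trans; [|apply re_le_Cmod]. right. f_equal.
  unfold Re, Im; simpl. ring.
- eapply Rle_trans; [|apply Im_le_Cmod]. right. f_equal.
  unfold Re, Im; simpl. ring.
Qed.

Lemma Cmod_Cexp (z : C) : Cmod (Cexp z) = exp (Re z).
Proof.
unfold Cexp, Cmod; simpl.
replace (_ + _) with (exp (Re z) * exp (Re z)).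
- apply sqrt_square. apply Rlt_le, exp_pos.
- pose proof (sin2_cos2 (Im z)) as H. unfold Rsqr in H.
  transitivity (exp (Re z) * exp (Re z) *
    (sin (Im z) * sin (Im z) + cos (Im z) * cos (Im z))); [rewrite H|]; ring.
Qed.

Lemma differentiable_pt_lim_opp (f : R -> R -> R) (x y lx ly : R) :
  differentiable_pt_lim f x y lx ly ->
  differentiable_pt_lim (fun u v => - f u v) x y (- lx) (- ly).
Proof.
intros Hf e. destruct (Hf e) as [r Hr]. exists r. intros u v Hu Hv.
eapply Rle_trans; [|exact (Hr u v Hu Hv)]. right.
rewrite <- Rabs_Ropp. f_equal. ring.
Qed.

(* In the coordinate zeta = log (z - z0) the two horizontal sides of a rectangle
   of height 2 pi contribute opposite fluxes, by periodicity. *)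
Lemma circle_integral_const (f : C -> C) (z0 : C) (s0 s1 : R) :
  s0 < s1 ->
  (forall z, Cmod (z - z0) <= exp s1 -> exists d, cderiv f z d) ->
  RInt (fun th => Re (f (z0 + Cexp (s1, th)))%C) 0 (2 * PI) =
  RInt (fun th => Re (f (z0 + Cexp (s0, th)))%C) 0 (2 * PI) /\
  (forall s, s0 <= s <= s1 -> forall a b, 0 <= a -> a <= b -> b <= 2 * PI ->
     ex_RInt (fun th => Re (f (z0 + Cexp (s, th)))%C) a b).
Proof.
intros Hs Hf. pose proof PI_RGT_0 as HPI.
set (P := fun s th => Re (f (z0 + Cexp (s, th)))%C).
set (Q := fun s th => - Im (f (z0 + Cexp (s, th)))%C).
assert (Hd : forall s th, s0 <= s <= s0 + (s1 - s0) -> exists A B C,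
     differentiable_pt_lim P s th A B /\ differentiable_pt_lim Q s th C (- A)).
{ intros s th Hs'.
  destruct (Hf (z0 + Cexp (s, th))%C) as [d Hd].
  { replace (z0 + Cexp (s, th) - z0)%C with (Cexp (s, th)) by ring.
    rewrite Cmod_Cexp. simpl. destruct (Req_dec s s1) as [->|Hne]; [lra|].
    apply Rlt_le, exp_increasing. unfold Re; simpl. lra. }
  pose proof (cderiv_plus _ _ _ _ _ (cderiv_const z0 (s, th)) (cderiv_exp (s, th)))
    as H1.
  pose proof (cderiv_comp f (fun z => z0 + Cexp z)%C (s, th) _ _ H1 Hd) as H2.
  destruct (cderiv_differentiable _ _ _ _ H2) as [D1 D2].
  match type of D1 with differentiable_pt_lim _ _ _ ?a ?b =>
    exists a, b end.
  eexists. split; [exact D1|].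
  exact (differentiable_pt_lim_opp _ _ _ _ _ D2). }
pose proof (flux_divergence_free P Q s0 0 (s1 - s0) (2 * PI) ltac:(lra) ltac:(lra)
  (fun s th H _ => Hd s th H)) as H0.
assert (HcP : forall s th, s0 <= s <= s0 + (s1 - s0) -> 0 <= th <= 0 + 2 * PI ->
  continuity_2d_pt P s th).
{ intros s th Hs' _. destruct (Hd s th Hs') as (A & B & C & D & _).
  apply differentiable_continuity_pt. eexists; eexists; exact D. }
destruct (ex_RInt_section P s0 (s0 + (s1 - s0)) 0 (0 + 2 * PI)) as [HP _];
  [lra|lra|exact HcP|].
split.
- unfold flux in H0. replace (s0 + (s1 - s0)) with s1 in * by ring.
  rewrite Rplus_0_l in *.
  rewrite RInt_Rminus in H0 by (apply HP; lra).
  rewrite (RInt_ext (fun x => Q x (2 * PI) - Q x 0) (fun _ => 0)) in H0.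
  + rewrite RInt_const in H0. unfold scal in H0; simpl in H0.
    unfold mult in H0; simpl in H0. fold (P s1) (P s0). lra.
  + intros x _. unfold Q.
    replace (Cexp (x, 2 * PI)) with (Cexp (x, 0)); [now apply Rminus_diag_eq|].
    unfold Cexp, Re, Im; simpl.
    now rewrite cos_2PI, sin_2PI, cos_0, sin_0.
- intros s Hs' a b Ha Hb Hab. apply HP; lra.
Qed.

(** The circle integral does not depend on the radius. On a circle so small that f varies by less
    than 1 / (4 pi) of the supposed defect, the defect would be at most half of itself. *)
Lemma mean_value (f : C -> C) (z0 : C) (r : R) :
  0 < r ->
  (forall z, Cmod (z - z0) <= r -> exists d, cderiv f z d) ->
  RInt (fun th => Re (f (z0 + Cexp (ln r, th)))%C) 0 (2 * PI) =
    2 * PI * Re (f z0) /\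
  (forall a b, 0 <= a -> a <= b -> b <= 2 * PI ->
     ex_RInt (fun th => Re (f (z0 + Cexp (ln r, th)))%C) a b).
Proof.
intros Hr Hf. pose proof PI_RGT_0 as HPI.
assert (Hf' : forall z, Cmod (z - z0) <= exp (ln r) -> exists d, cderiv f z d)
  by (rewrite exp_ln by exact Hr; exact Hf).
split.
2:{ intros a b Ha Hab Hb.
  destruct (circle_integral_const f z0 (ln r - 1) (ln r) ltac:(lra) Hf') as [_ H].
  apply H; lra. }
apply NNPP. intro Hne.
set (I := RInt (fun th => Re (f (z0 + Cexp (ln r, th)))%C) 0 (2 * PI)) in *.
assert (He : 0 < Rabs (I - 2 * PI * Re (f z0)) / (4 * PI)).
{ apply Rdiv_lt_0_compat; [apply Rabs_pos_lt|]; lra. }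
destruct (Hf z0) as [d Hd].
{ replace (z0 - z0)%C with (RtoC 0) by ring. rewrite Cmod_0. lra. }
destruct (cderiv_cont f z0 d Hd _ He) as (t & Ht & H).
set (s0 := Rmin (ln r - 1) (ln (t / 2))).
assert (Hs0 : s0 <= ln r - 1 /\ s0 <= ln (t / 2))
  by (split; [apply Rmin_l|apply Rmin_r]).
destruct (circle_integral_const f z0 s0 (ln r) ltac:(lra) Hf') as [H1 H2].
fold I in H1.
pose proof (RInt_near_const (fun th => Re (f (z0 + Cexp (s0, th)))%C) 0 (2 * PI)
  (Re (f z0)) (Rabs (I - 2 * PI * Re (f z0)) / (4 * PI)) ltac:(lra)
  (H2 s0 ltac:(lra) 0 (2 * PI) ltac:(lra) ltac:(lra) ltac:(lra))) as H3.
rewrite <- H1 in H3.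
replace (Re (f z0) * (2 * PI - 0)) with (2 * PI * Re (f z0)) in H3 by ring.
assert (H4 : Rabs (I - 2 * PI * Re (f z0)) <=
  Rabs (I - 2 * PI * Re (f z0)) / (4 * PI) * (2 * PI - 0)).
{ apply H3. intros th _.
  replace (Re (f (z0 + Cexp (s0, th))%C) - Re (f z0)) with
    (Re (f (z0 + Cexp (s0, th)) - f z0)%C) by (unfold Re; simpl; ring).
  eapply Rle_trans; [apply re_le_Cmod|]. apply Rlt_le, H.
  replace (z0 + Cexp (s0, th) - z0)%C with (Cexp (s0, th)) by ring.
  rewrite Cmod_Cexp. unfold Re; simpl.
  apply Rle_lt_trans with (exp (ln (t / 2))).
  - destruct (Req_dec s0 (ln (t / 2))) as [->|]; [lra|].
    apply Rlt_le, exp_increasing. lra.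
  - rewrite exp_ln; lra. }
replace (Rabs (I - 2 * PI * Re (f z0)) / (4 * PI) * (2 * PI - 0)) with
  (Rabs (I - 2 * PI * Re (f z0)) / 2) in H4 by (field; lra).
assert (0 < Rabs (I - 2 * PI * Re (f z0))) by (apply Rabs_pos_lt; lra).
lra.
Qed.

Lemma circle_point (z0 : C) (r th : R) :
  0 < r -> Cmod (z0 + Cexp (ln r, th) - z0) = r.
Proof.
intro Hr. replace (z0 + Cexp (ln r, th) - z0)%C with (Cexp (ln r, th)) by ring.
rewrite Cmod_Cexp. unfold Re; simpl. now apply exp_ln.
Qed.

Lemma Re_le_circle (f : C -> C) (z0 : C) (r m : R) :
  0 < r ->
  (forall z, Cmod (z - z0) <= r -> exists d, cderiv f z d) ->
  (forall z, Cmod (z - z0) = r -> Re (f z) <= m) ->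
  Re (f z0) <= m.
Proof.
intros Hr Hf Hm. pose proof PI_RGT_0.
destruct (mean_value f z0 r Hr Hf) as [H1 H2].
assert (H3 : RInt (fun th => Re (f (z0 + Cexp (ln r, th)))%C) 0 (2 * PI) <=
             RInt (fun _ => m) 0 (2 * PI)).
{ apply RInt_le; [lra|apply H2; lra|apply ex_RInt_const|].
  intros th _. apply Hm. now apply circle_point. }
rewrite RInt_const, H1 in H3. unfold scal in H3; simpl in H3.
unfold mult in H3; simpl in H3. nra.
Qed.

(** If the top value fell short of m, continuity would give an arc on which Re f stays below m by a
    fixed amount, and the mean would be less than m. The top of the circle is singled out because
    [phragmen_lindelof] climbs along a vertical ray. *)
Lemma Re_max_circle (f : C -> C) (z0 : C) (r m : R) :
  0 < r ->
  (forall z, Cmod (z - z0) <= r -> exists d, cderiv f z d) ->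
  (forall z, Cmod (z - z0) = r -> Re (f z) <= m) ->
  Re (f z0) = m -> Re (f (z0 + RtoC r * Ci)%C) = m.
Proof.
intros Hr Hf Hm H0. pose proof PI_RGT_0.
destruct (mean_value f z0 r Hr Hf) as [H1 H2].
set (p := fun th => Re (f (z0 + Cexp (ln r, th)))%C) in *.
assert (Hp : forall th, p th <= m).
{ intro th. apply Hm. now apply circle_point. }
assert (Htop : (z0 + RtoC r * Ci)%C = (z0 + Cexp (ln r, (PI / 2)%R))%C).
{ f_equal. unfold Cexp, Re, Im; simpl. rewrite exp_ln, cos_PI2, sin_PI2 by exact Hr.
  apply injective_projections; simpl; ring. }
rewrite Htop. fold (p (PI / 2)).
apply Rle_antisym; [apply Hp|]. apply Rnot_lt_le. intro Hlt.
set (e := (m - p (PI / 2)) / 2). assert (He : 0 < e) by (unfold e; lra).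
destruct (Hf (z0 + Cexp (ln r, (PI / 2)%R))%C) as [d Hd].
{ rewrite circle_point by exact Hr. lra. }
pose proof (cderiv_comp f (fun z => z0 + Cexp z)%C (ln r, PI / 2) _ _
  (cderiv_plus _ _ _ _ _ (cderiv_const z0 _) (cderiv_exp _)) Hd) as Hd2.
destruct (cderiv_cont _ _ _ Hd2 e He) as (t & Ht & Hc).
set (s := Rmin (t / 2) (PI / 4)).
assert (Hs : 0 < s /\ s <= t / 2 /\ s <= PI / 4).
{ unfold s. split; [apply Rmin_pos; lra|]. split; [apply Rmin_l|apply Rmin_r]. }
assert (Hnear : forall th, PI / 2 <= th <= PI / 2 + s -> p th <= m - e).
{ intros th Hth. specialize (Hc (ln r, th)).
  assert (Hc' : Cmod ((ln r, th) - (ln r, PI / 2)) < t).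
  { eapply Rle_lt_trans; [apply Cmod_le_Re_Im|]. unfold Re, Im; simpl.
    replace (ln r + - ln r) with 0 by ring. rewrite Rabs_R0.
    rewrite Rabs_pos_eq; lra. }
  specialize (Hc Hc').
  pose proof (re_le_Cmod (f (z0 + Cexp (ln r, th)) - f (z0 + Cexp (ln r, (PI / 2)%R)))%C)
    as Hre.
  assert (Heq : Re (f (z0 + Cexp (ln r, th)) - f (z0 + Cexp (ln r, (PI / 2)%R)))%C =
    p th - p (PI / 2)) by (unfold p, Re; simpl; ring).
  rewrite Heq in Hre. apply Rabs_le_between in Hre.
  assert (m = p (PI / 2) + 2 * e) by (unfold e; field). lra. }
rewrite (RInt_RChasles p 0 (PI / 2)) in H1 by (apply H2; lra).
rewrite (RInt_RChasles p (PI / 2) (PI / 2 + s)) in H1 by (apply H2; lra).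
assert (K : forall a b v, 0 <= a -> a <= b -> b <= 2 * PI ->
  (forall th, a <= th <= b -> p th <= v) -> RInt p a b <= v * (b - a)).
{ intros a b v Ha Hab Hb Hv.
  replace (v * (b - a)) with (RInt (fun _ => v) a b)
    by (rewrite RInt_const; unfold scal; simpl; unfold mult; simpl; ring).
  apply RInt_le; [lra|apply H2; lra|apply ex_RInt_const|].
  intros th Hth. apply Hv. lra. }
pose proof (K 0 (PI / 2) m ltac:(lra) ltac:(lra) ltac:(lra) (fun th _ => Hp th)).
pose proof (K (PI / 2) (PI / 2 + s) (m - e) ltac:(lra) ltac:(lra) ltac:(lra) Hnear).
pose proof (K (PI / 2 + s) (2 * PI) m ltac:(lra) ltac:(lra) ltac:(lra) (fun th _ => Hp th)).
nra.
Qed.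

(** * Open mappings, logarithm and argument *)

Lemma cluster_point_C (E : R -> C -> Prop) (a b c d : R) :
  (forall del del' z, del <= del' -> E del z -> E del' z) ->
  (forall del, 0 < del -> exists z, a <= Re z <= b /\ c <= Im z <= d /\ E del z) ->
  exists z, a <= Re z <= b /\ c <= Im z <= d /\
    forall del, 0 < del -> exists z', Cmod (z' - z) < del /\ E del z'.
Proof.
intros Hmon Hne.
destruct (cluster_point (fun del x y => E del (x, y)) a b c d)
  as (x & y & Hx & Hy & H).
- intros del del' x y. apply Hmon.
- intros del Hdel. destruct (Hne del Hdel) as ([x y] & Hx & Hy & HE).
  now exists x, y.
- exists (x, y). repeat split; try (unfold Re, Im; simpl; lra).
  intros del Hdel. destruct (H (del / 2) ltac:(lra)) as (x' & y' & Hx' & Hy' & HE).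
  exists (x', y'). split; [|apply (Hmon (del / 2)); [lra|exact HE]].
  eapply Rle_lt_trans; [apply Cmod_le_Re_Im|]. unfold Re, Im; simpl.
  unfold Rminus in *. lra.
Qed.

Lemma Cmod_triang_sub (a b : C) : Rabs (Cmod a - Cmod b) <= Cmod (a - b).
Proof.
pose proof (Cmod_triangle (a - b) b) as H1.
pose proof (Cmod_triangle (b - a) a) as H2.
replace (a - b + b)%C with a in H1 by ring.
replace (b - a + a)%C with b in H2 by ring.
rewrite (Cmod_minus_sym b a) in H2. apply Rabs_le. lra.
Qed.

Lemma Cmod_small_eq (a b : C) : (forall e, 0 < e -> Cmod (a - b) < e) -> a = b.
Proof.
intro H. assert (H0 : Cmod (a - b) = 0).
{ apply Rle_antisym; [|apply Cmod_ge_0]. apply le_epsilon. intros e He.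
  rewrite Rplus_0_l. apply Rlt_le, H, He. }
apply Cmod_eq_0 in H0. replace a with (a - b + b)%C by ring. rewrite H0. ring.
Qed.

(** If f omitted a value v close to f z0, then 1 / (f - v) would be holomorphic on the disc, at most
    2 / m in modulus on the circle, and larger than 2 / m at the centre, against the mean value
    bound. *)
Lemma injective_open (f : C -> C) (z0 : C) (r : R) :
  0 < r ->
  (forall z, Cmod (z - z0) <= r -> exists d, cderiv f z d) ->
  (forall z, Cmod (z - z0) = r -> f z <> f z0) ->
  exists rho, 0 < rho /\ forall v, Cmod (v - f z0) < rho ->
    exists z, Cmod (z - z0) <= r /\ f z = v.
Proof.
intros Hr Hf Hinj.
assert (Hm : exists m, 0 < m /\ forall z, Cmod (z - z0) = r -> m <= Cmod (f z - f z0)).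
{ apply NNPP. intro Hno.
  destruct (cluster_point_C (fun del z => Cmod (z - z0) = r /\ Cmod (f z - f z0) < del)
    (Re z0 - r) (Re z0 + r) (Im z0 - r) (Im z0 + r)) as (z & _ & _ & Hz).
  - intros del del' z Hdel [H1 H2]. split; [exact H1|lra].
  - intros del Hdel. apply NNPP. intro Hno'. apply Hno. exists del.
    split; [exact Hdel|]. intros z Hz. apply Rnot_lt_le. intro Hlt. apply Hno'.
    exists z. pose proof (re_le_Cmod (z - z0)) as A.
    pose proof (Im_le_Cmod (z - z0)) as B.
    rewrite Hz in A, B. apply Rabs_le_between in A. apply Rabs_le_between in B.
    unfold Re, Im in *; simpl in A, B. repeat split; try lra; assumption.
  - assert (Hzr : Cmod (z - z0) = r).
    { apply Rminus_diag_uniq. apply NNPP. intro Hne.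
      destruct (Hz _ (Rabs_pos_lt _ Hne)) as (z' & H1 & H2 & _).
      pose proof (Cmod_triang_sub (z' - z0) (z - z0)) as T.
      replace (z' - z0 - (z - z0))%C with (z' - z)%C in T by ring.
      rewrite H2, Rabs_minus_sym in T. lra. }
    apply (Hinj z Hzr). apply Cmod_small_eq. intros e He.
    destruct (Hf z ltac:(lra)) as [d Hd].
    destruct (cderiv_cont f z d Hd (e / 2) ltac:(lra)) as (t & Ht & Hc).
    destruct (Hz (Rmin t (e / 2)) ltac:(apply Rmin_pos; lra)) as (z' & H1 & _ & H2).
    pose proof (Rmin_l t (e / 2)). pose proof (Rmin_r t (e / 2)).
    apply Cmod_sum_lt with (f z'); [|lra].
    rewrite Cmod_minus_sym. apply Hc. lra. }
destruct Hm as (m & Hm0 & Hm). exists (m / 2). split; [lra|].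
intros v Hv. apply NNPP. intro Hno.
assert (Hne : forall z, Cmod (z - z0) <= r -> (f z - v)%C <> 0%C).
{ intros z Hz H0. apply Hno. exists z. split; [exact Hz|].
  replace (f z) with (f z - v + v)%C by ring. rewrite H0. ring. }
assert (Hz0 : Cmod (z0 - z0) <= r).
{ replace (z0 - z0)%C with (RtoC 0) by ring. rewrite Cmod_0. lra. }
pose proof (Hne z0 Hz0) as Hne0. rewrite Cmod_minus_sym in Hv.
assert (Hp0 : 0 < Cmod (f z0 - v)) by now apply Cmod_gt_0.
(* The constant factor makes the value at z0 of the function below real
   and positive, hence equal to its modulus. *)
set (c := ((f z0 - v) * RtoC (/ Cmod (f z0 - v)))%C).
assert (Hc : Cmod c = 1).
{ unfold c. rewrite Cmod_mult, Cmod_R, Rabs_pos_eq.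
  - field. lra.
  - apply Rlt_le, Rinv_0_lt_compat, Hp0. }
assert (Hle : Re (c * / (f z0 - v))%C <= 2 / m).
{ apply (Re_le_circle (fun z => c * / (f z - v))%C z0 r); [exact Hr| |].
  - intros z Hz. destruct (Hf z Hz) as [d Hd]. eexists.
    apply cderiv_scal.
    apply (cderiv_comp Cinv (fun z => f z - v)%C).
    + apply cderiv_minus; [exact Hd|apply cderiv_const].
    + apply cderiv_inv. now apply Hne.
  - intros z Hz. eapply Rle_trans; [apply Rle_abs|].
    eapply Rle_trans; [apply re_le_Cmod|].
    rewrite Cmod_mult, Hc, Rmult_1_l, Cmod_inv by (apply Hne; lra).
    specialize (Hm z Hz).
    pose proof (Cmod_triangle (f z - v) (v - f z0)) as T.
    replace (f z - v + (v - f z0))%C with (f z - f z0)%C in T by ring.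
    rewrite (Cmod_minus_sym v) in T.
    replace (2 / m) with (/ (m / 2)) by (field; lra).
    apply Rinv_le_contravar; lra. }
assert (Heq : (c * / (f z0 - v))%C = RtoC (/ Cmod (f z0 - v))).
{ unfold c. field. exact Hne0. }
rewrite Heq in Hle. unfold Re in Hle; simpl in Hle.
assert (2 / m < / Cmod (f z0 - v)).
{ replace (2 / m) with (/ (m / 2)) by (field; lra).
  apply Rinv_lt_contravar; [|exact Hv]. apply Rmult_lt_0_compat; lra. }
lra.
Qed.

(** Monotonicity of cos is used instead of a derivative, since the end points -1 and 1 are exactly
    the arguments needed near the real axis. *)
Lemma acos_cont (x0 e : R) : -1 <= x0 <= 1 -> 0 < e ->
  exists d, 0 < d /\ forall x, -1 <= x <= 1 -> Rabs (x - x0) < d ->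
    Rabs (acos x - acos x0) < e.
Proof.
intros Hx0 He. pose proof (acos_bound x0) as Ht.
assert (Hup : exists d, 0 < d /\ forall x, -1 <= x <= 1 -> x0 - d < x ->
  acos x < acos x0 + e).
{ destruct (Rle_dec (acos x0 + e) PI) as [H|H].
  - exists (x0 - cos (acos x0 + e)). split.
    + pose proof (cos_decreasing_1 (acos x0) (acos x0 + e)) as T.
      rewrite (cos_acos x0) in T by exact Hx0. lra.
    + intros x Hx Hd. pose proof (acos_bound x).
      apply cos_decreasing_0; try lra. rewrite (cos_acos x) by exact Hx. lra.
  - exists 1. split; [lra|]. intros x Hx _. pose proof (acos_bound x). lra. }
assert (Hlo : exists d, 0 < d /\ forall x, -1 <= x <= 1 -> x < x0 + d ->
  acos x0 - e < acos x).
{ destruct (Rle_dec 0 (acos x0 - e)) as [H|H].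
  - exists (cos (acos x0 - e) - x0). split.
    + pose proof (cos_decreasing_1 (acos x0 - e) (acos x0)) as T.
      rewrite (cos_acos x0) in T by exact Hx0. lra.
    + intros x Hx Hd. pose proof (acos_bound x).
      apply cos_decreasing_0; try lra. rewrite (cos_acos x) by exact Hx. lra.
  - exists 1. split; [lra|]. intros x Hx _. pose proof (acos_bound x). lra. }
destruct Hup as (d1 & Hd1 & H1). destruct Hlo as (d2 & Hd2 & H2).
exists (Rmin d1 d2). split; [now apply Rmin_pos|]. intros x Hx Hd.
pose proof (Rmin_l d1 d2). pose proof (Rmin_r d1 d2).
apply Rabs_def2 in Hd. specialize (H1 x Hx ltac:(lra)).
specialize (H2 x Hx ltac:(lra)). apply Rabs_def1; lra.
Qed.

Lemma Re_over_Cmod (z : C) : z <> 0%C -> -1 <= Re z / Cmod z <= 1.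
Proof.
intro Hz. assert (Hm : 0 < Cmod z) by now apply Cmod_gt_0.
pose proof (re_le_Cmod z) as H. apply Rabs_le_between in H.
split; (apply Rmult_le_reg_r with (Cmod z); [exact Hm|]); unfold Rdiv;
  rewrite Rmult_assoc, Rinv_l; lra.
Qed.

Lemma upper_neq_0 (z : C) : 0 < Im z -> z <> 0%C.
Proof. intros Hz H. rewrite H in Hz. unfold Im in Hz; simpl in Hz. lra. Qed.

(** The neighbourhood is a full disc even at real points: below the axis the arccosine gives the
    absolute value of the argument, which is continuous across the axis. *)
Lemma Clog_upper_cont (z0 : C) (e : R) : z0 <> 0%C -> 0 < e ->
  exists d, 0 < d /\ forall z, Cmod (z - z0) < d ->
    Cmod (Clog_upper z - Clog_upper z0) < e.
Proof.
intros Hz0 He. assert (Hm : 0 < Cmod z0) by now apply Cmod_gt_0.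
destruct (derivable_pt_lim_bound _ _ _ (derivable_pt_lim_ln _ Hm) 1 Rlt_0_1)
  as (r & Hr & Hln).
destruct (acos_cont (Re z0 / Cmod z0) (e / 2) (Re_over_Cmod z0 Hz0) ltac:(lra))
  as (t & Ht & Hac).
set (k := 1 + / Cmod z0).
assert (Hk : 0 < k) by (pose proof (Rinv_0_lt_compat _ Hm); unfold k; lra).
set (d := Rmin (Rmin r (Cmod z0 / 2)) (Rmin (e / (2 * k)) (t * Cmod z0 / 4))).
assert (Hd : 0 < d).
{ unfold d. repeat apply Rmin_pos; try lra.
  - apply Rdiv_lt_0_compat; lra.
  - apply Rdiv_lt_0_compat; [apply Rmult_lt_0_compat|]; lra. }
assert (Hd' : d <= r /\ d <= Cmod z0 / 2 /\ d <= e / (2 * k) /\ d <= t * Cmod z0 / 4).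
{ unfold d, Rmin. repeat destruct Rle_dec; lra. }
exists d. split; [exact Hd|]. intros z Hz.
pose proof (Cmod_triang_sub z z0) as T.
set (u := Cmod z - Cmod z0) in *.
assert (HT := T). apply Rabs_le_between in HT.
assert (Hmz : Cmod z0 / 2 <= Cmod z) by (unfold u in *; lra).
assert (Hz' : z <> 0%C) by (apply Cmod_gt_0; lra).
assert (H1 : Rabs (ln (Cmod z) - ln (Cmod z0)) < e / 2).
{ specialize (Hln u ltac:(lra)).
  replace (Cmod z0 + u) with (Cmod z) in Hln by (unfold u; ring).
  assert (H : Rabs (ln (Cmod z) - ln (Cmod z0)) <= k * Rabs u).
  { replace (ln (Cmod z) - ln (Cmod z0)) with
      ((ln (Cmod z) - ln (Cmod z0) - / Cmod z0 * u) + / Cmod z0 * u) by ring.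
    eapply Rle_trans; [apply Rabs_triang|]. rewrite Rabs_mult.
    rewrite (Rabs_pos_eq (/ Cmod z0)) by (apply Rlt_le, Rinv_0_lt_compat, Hm).
    unfold k. lra. }
  apply Rle_lt_trans with (1 := H).
  apply Rlt_le_trans with (k * (e / (2 * k))); [|right; field; lra].
  apply Rmult_lt_compat_l; lra. }
assert (H2 : Rabs (acos (Re z / Cmod z) - acos (Re z0 / Cmod z0)) < e / 2).
{ apply Hac; [now apply Re_over_Cmod|].
  replace (Re z / Cmod z - Re z0 / Cmod z0) with
    ((Re (z - z0)%C * Cmod z0 - Re z0 * u) / (Cmod z * Cmod z0))
    by (unfold u, Re; simpl; field; lra).
  unfold Rdiv. rewrite Rabs_mult, (Rabs_pos_eq (/ _)).
  2:{ apply Rlt_le, Rinv_0_lt_compat, Rmult_lt_0_compat; lra. }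
  apply Rmult_lt_reg_r with (Cmod z * Cmod z0); [apply Rmult_lt_0_compat; lra|].
  rewrite Rmult_assoc, Rinv_l by (apply Rgt_not_eq, Rmult_lt_0_compat; lra).
  rewrite Rmult_1_r. unfold Rminus at 1.
  eapply Rle_lt_trans; [apply Rabs_triang|].
  rewrite Rabs_Ropp, !Rabs_mult, (Rabs_pos_eq (Cmod z0)) by lra.
  pose proof (re_le_Cmod (z - z0)) as R1. pose proof (re_le_Cmod z0) as R2.
  pose proof (Rabs_pos (Re z0)). pose proof (Rabs_pos u).
  apply Rle_lt_trans with (2 * (Cmod (z - z0) * Cmod z0)); [nra|].
  apply Rlt_le_trans with (2 * (d * Cmod z0)); [nra|].
  apply Rle_trans with (2 * (t * Cmod z0 / 4 * Cmod z0)); [nra|].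
  nra. }
eapply Rle_lt_trans; [apply Cmod_le_Re_Im|].
unfold Clog_upper, Re, Im in *; simpl. unfold Rminus in *. lra.
Qed.

Lemma Cexp_Clog_upper (z : C) : z <> 0%C -> 0 <= Im z -> Cexp (Clog_upper z) = z.
Proof.
intros Hz Hi. assert (Hm : 0 < Cmod z) by now apply Cmod_gt_0.
unfold Cexp.
change (Re (Clog_upper z)) with (ln (Cmod z)).
change (Im (Clog_upper z)) with (acos (Re z / Cmod z)).
rewrite exp_ln by exact Hm.
pose proof (Re_over_Cmod z Hz) as Hr.
rewrite cos_acos, sin_acos by exact Hr.
pose proof (Cmod2_alt z) as H2.
replace (1 - (Re z / Cmod z)²) with ((Im z / Cmod z)²).
- rewrite sqrt_Rsqr.
  + apply injective_projections; simpl.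
    * unfold Re. field. lra.
    * unfold Im. field. lra.
  + apply Rmult_le_pos; [exact Hi|]. apply Rlt_le, Rinv_0_lt_compat, Hm.
- unfold Rsqr. apply Rmult_eq_reg_r with (Cmod z ^ 2); [|nra].
  transitivity (Im z ^ 2); [field; lra|].
  transitivity (Cmod z ^ 2 - Re z ^ 2); [lra|field; lra].
Qed.

(** Inverse function argument: with k the increment of the logarithm, the expansion of exp gives |h
    - z k| <= e' |k|. First e' <= |z| / 2 yields |z| |k| <= 2 |h|, and then the error is linear in
    |h|. *)
Lemma cderiv_log (z : C) : 0 < Im z -> cderiv Clog_upper z (/ z).
Proof.
intros Hz e He. assert (Hz0 := upper_neq_0 z Hz).
assert (Hm : 0 < Cmod z) by now apply Cmod_gt_0.
set (e' := Rmin (Cmod z / 2) (e * (Cmod z * Cmod z) / 2)).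
assert (He' : 0 < e' /\ e' <= Cmod z / 2 /\ e' <= e * (Cmod z * Cmod z) / 2).
{ unfold e'. split; [|split; [apply Rmin_l|apply Rmin_r]].
  apply Rmin_pos; [lra|]. apply Rmult_lt_0_compat; [|lra].
  repeat apply Rmult_lt_0_compat; lra. }
destruct (cderiv_exp (Clog_upper z) e' ltac:(lra)) as (r & Hr & H).
destruct (Clog_upper_cont z r Hz0 Hr) as (t & Ht & Hc).
exists (Rmin t (Im z)). split; [now apply Rmin_pos|]. intros h Hh.
pose proof (Rmin_l t (Im z)). pose proof (Rmin_r t (Im z)).
pose proof (Im_le_Cmod h) as Hih. apply Rabs_le_between in Hih.
assert (Hzh : 0 < Im (z + h)%C) by (unfold Im in *; simpl; lra).
specialize (Hc (z + h)%C). replace (z + h - z)%C with h in Hc by ring.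
specialize (Hc ltac:(lra)). specialize (H _ Hc).
set (k := (Clog_upper (z + h) - Clog_upper z)%C) in *.
replace (Clog_upper z + k)%C with (Clog_upper (z + h)%C) in H by (unfold k; ring).
rewrite !Cexp_Clog_upper in H by (try apply upper_neq_0; lra).
replace (z + h - z - z * k)%C with (- (z * (k - / z * h)))%C in H by (field; exact Hz0).
rewrite Cmod_opp, Cmod_mult in H.
pose proof (Cmod_triangle (k - / z * h) (/ z * h)) as T.
replace (k - / z * h + / z * h)%C with k in T by ring.
rewrite Cmod_mult, Cmod_inv in T by exact Hz0.
set (p := Cmod (k - / z * h)) in *. set (q := Cmod k) in *.
assert (Hp : 0 <= p) by apply Cmod_ge_0. assert (Hq : 0 <= q) by apply Cmod_ge_0.
assert (Hqh : Cmod z * q <= 2 * Cmod h).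
{ apply Rmult_le_compat_l with (r := Cmod z) in T; [|lra].
  replace (Cmod z * (p + / Cmod z * Cmod h)) with (Cmod z * p + Cmod h) in T
    by (field; lra).
  assert (e' * q <= Cmod z / 2 * q) by (apply Rmult_le_compat_r; lra). lra. }
apply Rmult_le_reg_l with (Cmod z * Cmod z); [now apply Rmult_lt_0_compat|].
apply Rle_trans with (Cmod z * (e' * q)); [nra|].
apply Rle_trans with (e' * (2 * Cmod h)); [nra|].
pose proof (Cmod_ge_0 h). nra.
Qed.

Lemma arg_bounds (z : C) : 0 < Im z -> 0 < Im (Clog_upper z) < PI.
Proof.
intro Hz. change (Im (Clog_upper z)) with (acos (Re z / Cmod z)).
assert (Hz0 := upper_neq_0 z Hz).
assert (Hm : 0 < Cmod z) by now apply Cmod_gt_0.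
apply acos_bound_lt. pose proof (Cmod2_alt z) as H2.
split; (apply Rmult_lt_reg_r with (Cmod z); [exact Hm|]); unfold Rdiv;
  rewrite Rmult_assoc, Rinv_l by lra; nra.
Qed.

Lemma arg_near_axis (x0 e : R) : 0 < x0 -> 0 < e -> exists d, 0 < d /\
  forall z, 0 < Im z < d ->
    (x0 <= Re z -> Im (Clog_upper z) < e) /\
    (Re z <= - x0 -> PI - e < Im (Clog_upper z)).
Proof.
intros Hx0 He.
destruct (acos_cont 1 e ltac:(lra) He) as (d & Hd & H).
rewrite acos_1 in H.
exists (x0 * d). split; [now apply Rmult_lt_0_compat|]. intros z Hz.
assert (Hz0 := upper_neq_0 z ltac:(lra)).
assert (Hm : 0 < Cmod z) by now apply Cmod_gt_0.
pose proof (Cmod_le_Re_Im z) as Hc. rewrite (Rabs_pos_eq (Im z)) in Hc by lra.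
pose proof (Re_over_Cmod z Hz0) as Hr.
change (Im (Clog_upper z)) with (acos (Re z / Cmod z)).
assert (K : x0 <= Rabs (Re z) -> 1 - d < Rabs (Re z) / Cmod z).
{ intro Hx. apply Rmult_lt_reg_r with (Cmod z); [exact Hm|]. unfold Rdiv.
  rewrite Rmult_assoc, Rinv_l by lra.
  pose proof (re_le_Cmod z). nra. }
split; intro Hx.
- rewrite (Rabs_pos_eq (Re z)) in K by lra. specialize (K Hx).
  assert (Ha : Rabs (Re z / Cmod z - 1) < d) by (apply Rabs_def1; lra).
  specialize (H _ Hr Ha). apply Rabs_def2 in H. lra.
- rewrite (Rabs_left1 (Re z)) in K by lra. specialize (K ltac:(lra)).
  unfold Rdiv in K. rewrite Ropp_mult_distr_l_reverse in K.
  assert (Ha : Rabs (- (Re z / Cmod z) - 1) < d)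
    by (apply Rabs_def1; unfold Rdiv in *; lra).
  specialize (H (- (Re z / Cmod z)) ltac:(lra) Ha). rewrite acos_opp in H.
  apply Rabs_def2 in H. lra.
Qed.

(** * Signs near the boundary of the slit strip *)

(* [Omega] in the real coordinates u, y = v / pi. *)
Definition slit_strip (n : nat) (alpha beta u y : R) : Prop :=
  - beta < y < alpha + INR n /\ ~ (exists j, (j <= n)%nat /\ y = INR j /\ u <= 0).

Lemma pos_propagates (f : R -> R) (x1 x2 : R) :
  (forall x, Rmin x1 x2 <= x <= Rmax x1 x2 -> continuity_pt f x /\ f x <> 0) ->
  0 < f x1 -> 0 < f x2.
Proof.
intros Hf H1. apply Rnot_le_lt. intro H2.
assert (H2' : f x2 < 0).
{ destruct H2 as [H2|H2]; [exact H2|]. exfalso.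
  apply (Hf x2); [split; [apply Rmin_r|apply Rmax_r]|exact H2]. }
destruct (Rtotal_order x1 x2) as [H|[H|H]].
- rewrite Rmin_left, Rmax_right in Hf by lra.
  destruct (Ranalysis5.IVT_interv (fun x => - f x) x1 x2) as (z & Hz & Hz0);
    [|exact H|lra|lra|].
  + intros x Hx. apply continuity_pt_opp, Hf, Hx.
  + apply (Hf z Hz). lra.
- subst x2. lra.
- rewrite Rmin_right, Rmax_left in Hf by lra.
  destruct (Ranalysis5.IVT_interv f x2 x1) as (z & Hz & Hz0);
    [|exact H|lra|lra|].
  + intros x Hx. apply Hf, Hx.
  + now apply (Hf z Hz).
Qed.

Lemma INR_between (j i : nat) (y : R) : INR j < y < INR j + 1 -> y <> INR i.
Proof.
intros Hy ->. destruct Hy as [H1 H2]. apply INR_lt in H1.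
rewrite <- S_INR in H2. apply INR_lt in H2. lia.
Qed.

(** In the application [phi u y] is, up to orientation, Re z - xi for the preimage z of the point
    with coordinates u, y. It has no zeros near the finite boundary or far to the left, except in
    the strip that ends at xi. Its sign is transported from a base point (ub, - beta) on the lower
    edge, where it is known, up to the level a. *)
Section SignPropagation.

Context (n : nat) (alpha beta a b m0 ub : R) (phi : R -> R -> R).
Let D := slit_strip n alpha beta.
(* [Good] excludes the far left part of the strip between the levels a and b,
   which is where phi may change sign. *)
Let Good (u y : R) := ~ (u < m0 /\ a < y < b).
Context (Hbeta : 0 <= beta) (Hm0 : m0 <= 0) (Hub : 1 <= ub) (Ha : a < alpha + INR n).
Context (Hcont : forall u y, D u y -> continuity_2d_pt phi u y).
Context (Hleft : exists m, forall u y, D u y -> u < m -> Good u y -> phi u y <> 0).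
Context (Hcollar : forall u0 y0, ~ D u0 y0 -> exists del, 0 < del /\
  forall u y, D u y -> Rabs (u - u0) < del -> Rabs (y - y0) < del -> Good u y ->
    phi u y <> 0).
Context (Hbase : forall del, 0 < del -> exists u y, D u y /\
  Rabs (u - ub) < del /\ Rabs (y + beta) < del /\ 0 < phi u y).

Lemma horizontal_propagates (u1 u2 y : R) :
  (forall u, Rmin u1 u2 <= u <= Rmax u1 u2 -> D u y /\ phi u y <> 0) ->
  0 < phi u1 y -> 0 < phi u2 y.
Proof.
intro H. apply (pos_propagates (fun u => phi u y)). intros x Hx.
destruct (H x Hx) as [HD Hphi]. split; [|exact Hphi].
apply continuity_pt_filterlim. apply (continuity_2d_pt_section phi x y), Hcont, HD.
Qed.

Lemma vertical_propagates (u y1 y2 : R) :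
  (forall y, Rmin y1 y2 <= y <= Rmax y1 y2 -> D u y /\ phi u y <> 0) ->
  0 < phi u y1 -> 0 < phi u y2.
Proof.
intro H. apply (pos_propagates (fun y => phi u y)). intros x Hx.
destruct (H x Hx) as [HD Hphi]. split; [|exact Hphi].
apply continuity_pt_filterlim. apply (continuity_2d_pt_section phi u x), Hcont, HD.
Qed.

(** Compactness of the segment: zeros of [phi] in ever thinner collars would accumulate at one of
    its points, against [Hcollar]. *)
Lemma uniform_collar (u1 u2 y0 : R) :
  (forall u, u1 <= u <= u2 -> ~ D u y0) ->
  exists del, 0 < del /\ forall u y, D u y -> u1 - del < u < u2 + del ->
    Rabs (y - y0) < del -> Good u y -> phi u y <> 0.
Proof.
intro Hno. apply NNPP. intro Hc.
destruct (cluster_point (fun del u y => D u y /\ u1 - del < u < u2 + del /\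
   Rabs (y - y0) < del /\ Good u y /\ phi u y = 0) (u1 - 1) (u2 + 1) (y0 - 1) (y0 + 1))
  as (u & y & Hu & Hy & Hcl).
- intros del del' u y Hle (H1 & H2 & H3 & H4).
  refine (conj H1 (conj _ (conj _ H4))); lra.
- intros del Hdel. apply NNPP. intro Hc'. apply Hc. exists (Rmin del 1).
  split; [apply Rmin_pos; lra|].
  pose proof (Rmin_l del 1). pose proof (Rmin_r del 1).
  intros u y H1 H2 H3 H4 H5. apply Hc'. exists u, y.
  assert (H6 := H3). apply Rabs_def2 in H6.
  refine (conj _ (conj _ (conj H1 (conj _ (conj _ (conj H4 H5)))))); lra.
- assert (Hy0 : y = y0).
  { apply Rminus_diag_uniq. apply NNPP. intro Hne. apply Rabs_pos_lt in Hne.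
    destruct (Hcl (Rabs (y - y0) / 2) ltac:(lra)) as (u' & y' & H1 & H2 & _ & _ & H3 & _).
    pose proof (Rabs_triang (y' - y0) (y - y')) as T.
    replace (y' - y0 + (y - y')) with (y - y0) in T by ring.
    rewrite (Rabs_minus_sym y y') in T. lra. }
  subst y.
  assert (Hu' : u1 <= u <= u2).
  { split; apply Rnot_lt_le; intro Hlt.
    - destruct (Hcl ((u1 - u) / 2) ltac:(lra)) as (u' & y' & H1 & _ & _ & H2 & _).
      apply Rabs_def2 in H1. lra.
    - destruct (Hcl ((u - u2) / 2) ltac:(lra)) as (u' & y' & H1 & _ & _ & H2 & _).
      apply Rabs_def2 in H1. lra. }
  destruct (Hcollar u y0 (Hno u Hu')) as (del & Hdel & H).
  destruct (Hcl del Hdel) as (u' & y' & H1 & H2 & H3 & _ & _ & H4 & H5).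
  now apply (H u' y').
Qed.

Lemma total_height_pos : - beta < alpha + INR n.
Proof. destruct (Hbase 1 Rlt_0_1) as (u & y & [H _] & _). lra. Qed.

(** If a = - beta, the region excluded by [Good] reaches the lower edge and the collar has to stay
    to the right of m0. Otherwise a collar of height at most a + beta passes below that region and
    may extend to the left. *)
Lemma bottom_sign (ul ur : R) :
  (m0 <= ul \/ - beta < a) -> ul + 1 <= ub -> ub + 1 <= ur ->
  exists del, 0 < del /\ forall u y, ul <= u <= ur -> - beta < y < - beta + del ->
    D u y /\ 0 < phi u y.
Proof.
intros Hul Hl Hr. pose proof total_height_pos as Hh.
destruct (uniform_collar ul ur (- beta)) as (d & Hd & Hcol).
{ intros u _ [H _]. lra. }
assert (Hfree : exists e, 0 < e /\ (- beta < a -> e <= a + beta) /\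
   - beta + e <= alpha + INR n /\
   forall y, - beta < y < - beta + e -> forall j : nat, y <> INR j).
{ assert (E1 : exists e, 0 < e /\ (- beta < a -> e <= a + beta)).
  { destruct (Rlt_dec (- beta) a); [exists (a + beta)|exists 1]; lra. }
  destruct E1 as (e1 & He1 & He1').
  assert (E2 : exists e, 0 < e /\ forall y, - beta < y < - beta + e ->
    forall j : nat, y <> INR j).
  { destruct (Rle_lt_or_eq_dec 0 beta Hbeta) as [Hb|<-].
    - exists beta. split; [exact Hb|]. intros y Hy j ->. pose proof (pos_INR j). lra.
    - exists 1. split; [lra|]. intros y Hy j. apply (INR_between 0). simpl. lra. }
  destruct E2 as (e2 & He2 & He2').
  set (e := Rmin (Rmin e1 e2) (alpha + INR n + beta)).
  assert (He : 0 < e) by (unfold e; repeat apply Rmin_pos; lra).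
  assert (He' : e <= e1 /\ e <= e2 /\ e <= alpha + INR n + beta)
    by (unfold e, Rmin; repeat destruct Rle_dec; lra).
  exists e. split; [exact He|]. split; [intro; specialize (He1' ltac:(lra)); lra|].
  split; [lra|]. intros y Hy. apply He2'. lra. }
destruct Hfree as (e & He & Hea & Hen & Hint).
set (del := Rmin d e). assert (Hdel : 0 < del) by (apply Rmin_pos; lra).
assert (Hdd : del <= d) by apply Rmin_l. assert (Hde : del <= e) by apply Rmin_r.
assert (HD : forall u y, - beta < y < - beta + del -> D u y).
{ intros u y Hy. split; [lra|]. intros (j & _ & Hj & _).
  apply (Hint y ltac:(lra) j Hj). }
assert (Hnz : forall u y, ul <= u <= ur -> - beta < y < - beta + del ->
  D u y /\ phi u y <> 0).
{ intros u y Hu Hy. split; [now apply HD|]. apply Hcol; [now apply HD|lra| |].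
  - apply Rabs_def1; lra.
  - intros [H1 H2]. destruct Hul as [H|H]; [lra|]. specialize (Hea H). lra. }
exists del. split; [exact Hdel|]. intros u y Hu Hy. split; [now apply HD|].
destruct (Hbase (Rmin del 1) ltac:(apply Rmin_pos; lra)) as (u1 & y1 & HD1 & H1 & H2 & H3).
pose proof (Rmin_l del 1). pose proof (Rmin_r del 1).
apply Rabs_def2 in H1. apply Rabs_def2 in H2. destruct HD1 as [HD1 _].
apply (horizontal_propagates u1 u y).
- intros x Hx. apply Hnz; [|exact Hy]. unfold Rmin, Rmax in Hx.
  repeat destruct Rle_dec; lra.
- apply (vertical_propagates u1 y1 y); [|exact H3].
  intros x Hx. apply Hnz; [lra|]. unfold Rmin, Rmax in Hx.
  repeat destruct Rle_dec; lra.
Qed.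

(* The path goes from the far left along the lower side of the slit, around
   its tip, and back along the upper side. *)
Lemma slit_sign (m : R) (j : nat) :
  (j <= n)%nat -> INR j <= a -> - beta < INR j -> m < m0 ->
  (forall y, - beta < y < INR j -> (forall i : nat, y <> INR i) -> 0 < phi m y) ->
  exists del, 0 < del /\ forall u y, D u y -> m <= u < del ->
    Rabs (y - INR j) < del -> (m0 <= u \/ y < a \/ y <= INR j) -> 0 < phi u y.
Proof.
intros Hjn Hja Hj Hm HC.
destruct (uniform_collar m 0 (INR j)) as (d & Hd & Hcol).
{ intros u Hu [_ H]. apply H. exists j. repeat split; try lra. exact Hjn. }
(* Thin enough to meet no other slit level and to stay inside the open strip. *)
set (del := Rmin (Rmin d (1 / 2)) (Rmin (INR j + beta) (alpha + INR n - INR j))).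
assert (Hdel : 0 < del) by (unfold del; repeat apply Rmin_pos; lra).
assert (Hdel' : del <= d /\ del <= 1 / 2 /\ del <= INR j + beta /\
  del <= alpha + INR n - INR j) by (unfold del, Rmin; repeat destruct Rle_dec; lra).
exists del. split; [exact Hdel|].
assert (Hlow_int : forall y, INR j - del < y < INR j -> forall i : nat, y <> INR i).
{ intros y Hy i. destruct j as [|j'].
  - intro. subst y. pose proof (pos_INR i). simpl in Hy. lra.
  - apply (INR_between j'). rewrite S_INR in Hy. lra. }
assert (HDoff : forall u y, Rabs (y - INR j) < del -> y <> INR j -> D u y).
{ intros u y Hy Hne. apply Rabs_def2 in Hy. split; [lra|].
  intros (i & _ & Hi & _). destruct (Rtotal_order y (INR j)) as [H|[H|H]].
  - apply (Hlow_int y ltac:(lra) i Hi).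
  - contradiction.
  - apply (INR_between j i y); [lra|exact Hi]. }
assert (HDpos : forall u y, Rabs (y - INR j) < del -> 0 < u -> D u y).
{ intros u y Hy Hu. apply Rabs_def2 in Hy. split; [lra|].
  intros (i & _ & _ & Hi). lra. }
assert (Hnz : forall u y, D u y -> m <= u < del -> Rabs (y - INR j) < del ->
  (m0 <= u \/ y < a \/ y <= INR j) -> D u y /\ phi u y <> 0).
{ intros u y HD Hu Hy Hor. split; [exact HD|]. apply Hcol; [exact HD|lra|lra|].
  intros [H1 H2]. lra. }
assert (Hlow : forall u y, m <= u < del -> INR j - del < y < INR j -> 0 < phi u y).
{ intros u y Hu Hy. assert (Hya : Rabs (y - INR j) < del) by (apply Rabs_def1; lra).
  apply (horizontal_propagates m u y).
  - intros x Hx. rewrite Rmin_left, Rmax_right in Hx by lra.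
    apply Hnz; [apply HDoff; [exact Hya|lra]|lra|exact Hya|lra].
  - apply HC; [lra|]. now apply Hlow_int. }
assert (Hright : forall u y, 0 < u < del -> Rabs (y - INR j) < del -> 0 < phi u y).
{ intros u y Hu Hy. apply (vertical_propagates u (INR j - del / 2) y).
  - apply Rabs_def2 in Hy. intros x Hx.
    assert (Hx' : Rabs (x - INR j) < del).
    { unfold Rmin, Rmax in Hx. apply Rabs_def1; repeat destruct Rle_dec; lra. }
    apply Hnz; [apply HDpos; [exact Hx'|lra]|lra|exact Hx'|lra].
  - apply Hlow; lra. }
intros u y HD Hu Hy Hor.
destruct (Rlt_dec 0 u) as [Hu0|Hu0]; [apply Hright; lra|].
destruct (Rtotal_order y (INR j)) as [H|[H|H]].
- apply Rabs_def2 in Hy. apply Hlow; lra.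
- exfalso. apply HD. exists j. repeat split; [exact Hjn|exact H|lra].
- apply (horizontal_propagates (del / 2) u y).
  + intros x Hx. rewrite Rmin_right, Rmax_left in Hx by lra.
    apply Hnz; [apply HDoff; [exact Hy|lra]|lra|exact Hy|]. lra.
  + apply Hright; [lra|exact Hy].
Qed.

Lemma far_left_sign : - beta < a -> exists m, m < m0 /\ forall j : nat, (j <= n)%nat ->
  INR j <= a -> forall y, - beta < y < INR j -> (forall i : nat, y <> INR i) ->
  0 < phi m y.
Proof.
intro Hba. destruct Hleft as [m1 Hm1]. set (m := Rmin m1 m0 - 1).
assert (Hm : m < m1 /\ m < m0)
  by (pose proof (Rmin_l m1 m0); pose proof (Rmin_r m1 m0); unfold m; lra).
exists m. split; [lra|].
destruct (bottom_sign m (ub + 1)) as (d0 & Hd0 & Hbot); [lra|lra|lra|].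
induction j as [|j IH]; intros Hjn Hja y Hy Hint.
- set (y1 := - beta + Rmin (y + beta) d0 / 2).
  assert (Hy1 : - beta < y1 < - beta + d0 /\ y1 < y).
  { assert (0 < Rmin (y + beta) d0) by (apply Rmin_pos; lra).
    pose proof (Rmin_l (y + beta) d0). pose proof (Rmin_r (y + beta) d0).
    unfold y1. lra. }
  apply (vertical_propagates m y1 y).
  + intros x Hx. rewrite Rmin_left, Rmax_right in Hx by lra. simpl in *.
    assert (HD : D m x).
    { split; [pose proof (pos_INR n); lra|]. intros (i & _ & Hi & _).
      pose proof (pos_INR i). lra. }
    split; [exact HD|]. apply Hm1; [exact HD|lra|]. unfold Good. lra.
  + apply Hbot; lra.
- rewrite S_INR in *.
  destruct (Rtotal_order y (INR j)) as [H|[H|H]];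
    [apply IH; [lia|lra|lra|exact Hint]|now destruct (Hint j)|].
  assert (Hjn' : INR j + 1 <= INR n) by (rewrite <- S_INR; now apply le_INR).
  assert (HD : forall x, - beta < x -> INR j < x < INR j + 1 -> D m x).
  { intros x Hxb Hx. split; [lra|]. intros (i & _ & Hi & _).
    now apply (INR_between j i x Hx). }
  assert (Hnear : exists d, 0 < d /\ forall x, - beta < x -> INR j < x < INR j + d -> x < INR j + 1 ->
    0 < phi m x).
  (* The first case means j = 0 and beta = 0: the slit lies on the lower edge and the bottom collar
     replaces the turn around the tip. *)
  { destruct (Rle_lt_dec (INR j) (- beta)) as [Hjb|Hjb].
    - exists d0. split; [exact Hd0|]. intros x Hxb Hx _.
      pose proof (pos_INR j). apply Hbot; lra.
    - destruct (slit_sign m j) as (d & Hd & Hs); [lia|lra|exact Hjb|lra| |].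
      + intros x Hx Hxi. apply IH; [lia|lra|exact Hx|exact Hxi].
      + exists d. split; [exact Hd|]. intros x Hxb Hx Hx1.
        apply Hs; [apply HD; lra|lra|apply Rabs_def1; lra|lra]. }
  destruct Hnear as (d & Hd & Hnear).
  set (y1 := INR j + Rmin (y - INR j) d / 2).
  assert (Hy1 : INR j < y1 < INR j + d /\ y1 < y).
  { assert (0 < Rmin (y - INR j) d) by (apply Rmin_pos; lra).
    pose proof (Rmin_l (y - INR j) d). pose proof (Rmin_r (y - INR j) d).
    unfold y1. lra. }
  pose proof (pos_INR j).
  apply (vertical_propagates m y1 y).
  + intros x Hx. rewrite Rmin_left, Rmax_right in Hx by lra.
    assert (HDx : D m x) by (apply HD; lra).
    split; [exact HDx|]. apply Hm1; [exact HDx|lra|]. unfold Good. lra.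
  + apply Hnear; lra.
Qed.

(** The condition m0 < u0 keeps a whole neighbourhood outside the region excluded by [Good], so the
    upper side of a slit at level a is included. *)
Lemma lower_boundary_sign (u0 y0 : R) :
  ~ D u0 y0 -> m0 < u0 -> - beta <= y0 <= a ->
  exists del, 0 < del /\ forall u y, D u y -> Rabs (u - u0) < del ->
    Rabs (y - y0) < del -> 0 < phi u y.
Proof.
intros HnD Hu0 Hy0. destruct (Rle_lt_or_eq_dec (- beta) y0) as [Hy|<-]; [lra| |].
- assert (Hslit : exists j, (j <= n)%nat /\ y0 = INR j /\ u0 <= 0).
  { apply NNPP. intro H. apply HnD. split; [lra|exact H]. }
  destruct Hslit as (j & Hjn & -> & Hu0').
  destruct (far_left_sign ltac:(lra)) as (m & Hm & HC).
  destruct (slit_sign m j Hjn) as (d & Hd & Hs); [lra|lra|exact Hm|apply HC; [exact Hjn|lra]|].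
  exists (Rmin d (u0 - m0)). split; [apply Rmin_pos; lra|].
  pose proof (Rmin_l d (u0 - m0)). pose proof (Rmin_r d (u0 - m0)).
  intros u y HD Hu Hy'. apply Rabs_def2 in Hu. apply Hs; [exact HD|lra|lra|lra].
- destruct (bottom_sign m0 (Rmax u0 ub + 1)) as (d & Hd & Hb);
    [lra|lra|pose proof (Rmax_r u0 ub); lra|].
  pose proof (Rmax_l u0 ub).
  exists (Rmin (Rmin d 1) (u0 - m0)). split; [repeat apply Rmin_pos; lra|].
  pose proof (Rmin_l (Rmin d 1) (u0 - m0)). pose proof (Rmin_r (Rmin d 1) (u0 - m0)).
  pose proof (Rmin_l d 1). pose proof (Rmin_r d 1).
  intros u y HD Hu Hy'. apply Rabs_def2 in Hu. apply Rabs_def2 in Hy'.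
  destruct HD as [HD _]. apply Hb; lra.
Qed.

End SignPropagation.

(** * The logarithm of the product *)

Fixpoint log_sum (xi : nat -> R) (m : nat) (z : C) : C :=
  match m with
  | O => RtoC 0
  | S m => (log_sum xi m z + Clog_upper (z - RtoC (xi (S m))))%C
  end.

(* The logarithm of z^alpha (1 - z)^beta e^c (z - xi 1) ... (z - xi n), with
   arg (1 - z) in [-pi, 0] on the closed upper half-plane. *)
Definition log_product (n : nat) (alpha beta c : R) (xi : nat -> R) (z : C) : C :=
  (RtoC alpha * Clog_upper z + RtoC beta * (Clog_upper (z - RtoC 1) - RtoC PI * Ci)
   + log_sum xi n z + RtoC c)%C.

Lemma Re_log_product (n : nat) (alpha beta c : R) (xi : nat -> R) (z : C) :
  Re (log_product n alpha beta c xi z) = alpha * ln (Cmod z) +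
    beta * ln (Cmod (z - RtoC 1)) + Re (log_sum xi n z) + c.
Proof. unfold log_product, Clog_upper, Re; simpl. ring. Qed.

Lemma Im_log_product (n : nat) (alpha beta c : R) (xi : nat -> R) (z : C) :
  Im (log_product n alpha beta c xi z) = alpha * Im (Clog_upper z) +
    beta * (Im (Clog_upper (z - RtoC 1)) - PI) + Im (log_sum xi n z).
Proof.
unfold log_product. generalize (Clog_upper (z - RtoC 1)) (Clog_upper z).
intros p q. unfold Im; simpl. ring.
Qed.

Lemma upper_shift (z : C) (x : R) : upper z -> upper (z - RtoC x).
Proof. unfold upper, Im; simpl. lra. Qed.

Lemma cderiv_log_shift (x : R) (z : C) : upper z ->
  exists d, cderiv (fun z => Clog_upper (z - RtoC x)) z d.
Proof.
intro Hz. eexists. apply (cderiv_comp Clog_upper (fun z => z - RtoC x)%C).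
- apply cderiv_minus; [apply cderiv_id|apply cderiv_const].
- apply cderiv_log. now apply upper_shift.
Qed.

Lemma log_sum_cderiv (xi : nat -> R) (m : nat) (z : C) : upper z ->
  exists d, cderiv (log_sum xi m) z d.
Proof.
intro Hz. induction m as [|m [d Hd]]; [exists (RtoC 0); exact (cderiv_const (RtoC 0) z)|].
destruct (cderiv_log_shift (xi (S m)) z Hz) as [d' Hd'].
eexists. exact (cderiv_plus _ _ _ _ _ Hd Hd').
Qed.

Lemma log_product_cderiv (n : nat) (alpha beta c : R) (xi : nat -> R) (z : C) :
  upper z -> exists d, cderiv (log_product n alpha beta c xi) z d.
Proof.
intro Hz. destruct (log_sum_cderiv xi n z Hz) as [d Hd].
destruct (cderiv_log_shift 1 z Hz) as [d1 Hd1]. eexists. unfold log_product.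
apply cderiv_plus; [|apply cderiv_const].
apply cderiv_plus; [|exact Hd].
apply cderiv_plus; apply cderiv_scal; [now apply cderiv_log|].
apply cderiv_minus; [exact Hd1|apply cderiv_const].
Qed.

Lemma log_sum_Im_bounds (xi : nat -> R) (m : nat) (z : C) : upper z ->
  0 <= Im (log_sum xi m z) <= INR m * PI.
Proof.
intro Hz. induction m as [|m IH]; [unfold Im; simpl; lra|].
pose proof (arg_bounds _ (upper_shift z (xi (S m)) Hz)). rewrite S_INR.
change (Im (log_sum xi (S m) z)) with
  (Im (log_sum xi m z) + Im (Clog_upper (z - RtoC (xi (S m))))). lra.
Qed.

(** Comparing logarithms along the imaginary axis alone suffices to fix the additive constant in
    [map_formula]. *)
Lemma ln_Cmod_vertical (x e : R) : 0 < e -> exists m, 0 < m /\ forall y, m < y ->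
  Rabs (ln (Cmod ((0, y) - RtoC x)) - ln y) < e.
Proof.
intro He. pose proof (Rabs_pos x) as Hx.
exists (Rmax 1 (Rabs x / e)). split; [pose proof (Rmax_l 1 (Rabs x / e)); lra|].
intros y Hy. pose proof (Rmax_l 1 (Rabs x / e)). pose proof (Rmax_r 1 (Rabs x / e)).
assert (H1 : y <= Cmod ((0, y) - RtoC x)).
{ pose proof (Im_le_Cmod ((0, y) - RtoC x)) as T. unfold Im in T; simpl in T.
  pose proof (Rle_abs (y + - 0)). lra. }
assert (H2 : Cmod ((0, y) - RtoC x) <= y + Rabs x).
{ eapply Rle_trans; [apply Cmod_le_Re_Im|]. unfold Re, Im; simpl.
  rewrite Rplus_0_l, Rabs_Ropp, Ropp_0, Rplus_0_r, (Rabs_pos_eq y); lra. }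
assert (L1 := Rcomplements.ln_le y _ ltac:(lra) H1).
assert (L2 := Rcomplements.ln_le (Cmod ((0, y) - RtoC x)) _ ltac:(lra) H2).
assert (L3 : ln (y + Rabs x) <= ln y + Rabs x / y).
{ replace (y + Rabs x) with (y * (1 + Rabs x / y)) by (field; lra).
  assert (0 <= Rabs x / y) by (apply Rmult_le_pos; [lra|apply Rlt_le, Rinv_0_lt_compat; lra]).
  rewrite ln_mult by lra. apply Rplus_le_compat_l.
  rewrite <- (ln_exp (Rabs x / y)) at 2. apply Rcomplements.ln_le; [lra|].
  apply exp_ineq1_le. }
assert (L4 : Rabs x / y < e).
{ apply Rmult_lt_reg_r with y; [lra|]. unfold Rdiv.
  rewrite Rmult_assoc, Rinv_l, Rmult_1_r by lra.
  replace (Rabs x) with (e * (Rabs x / e)) by (field; lra).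
  apply Rmult_lt_compat_l; lra. }
apply Rabs_def1; lra.
Qed.

Lemma log_sum_vertical (xi : nat -> R) (k : nat) (e : R) : 0 < e ->
  exists m, 0 < m /\ forall y, m < y ->
  Rabs (Re (log_sum xi k (0, y)) - INR k * ln y) < e.
Proof.
revert e. induction k as [|k IH]; intros e He.
- exists 1. split; [lra|]. intros y _. unfold Re; simpl.
  rewrite Rmult_0_l, Rminus_0_r, Rabs_R0. exact He.
- destruct (IH (e / 2) ltac:(lra)) as (m1 & Hm1 & H1).
  destruct (ln_Cmod_vertical (xi (S k)) (e / 2) ltac:(lra)) as (m2 & Hm2 & H2).
  exists (Rmax m1 m2). pose proof (Rmax_l m1 m2). pose proof (Rmax_r m1 m2).
  split; [lra|]. intros y Hy. specialize (H1 y ltac:(lra)). specialize (H2 y ltac:(lra)).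
  rewrite S_INR.
  change (Re (log_sum xi (S k) (0, y))) with
    (Re (log_sum xi k (0, y)) + ln (Cmod ((0, y) - RtoC (xi (S k))))).
  apply Rabs_def2 in H1. apply Rabs_def2 in H2. apply Rabs_def1; lra.
Qed.

(** * Values and singularities of the logarithm of the product on the real line *)

Definition continuous_at (f : C -> C) (z0 : C) : Prop :=
  forall e, 0 < e -> exists d, 0 < d /\ forall z, Cmod (z - z0) < d ->
    Cmod (f z - f z0) < e.

Lemma continuous_at_plus (f g : C -> C) (z0 : C) :
  continuous_at f z0 -> continuous_at g z0 -> continuous_at (fun z => f z + g z)%C z0.
Proof.
intros Hf Hg e He. destruct (Hf (e / 2) ltac:(lra)) as (d1 & Hd1 & H1).
destruct (Hg (e / 2) ltac:(lra)) as (d2 & Hd2 & H2).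
exists (Rmin d1 d2). split; [now apply Rmin_pos|]. intros z Hz.
pose proof (Rmin_l d1 d2). pose proof (Rmin_r d1 d2).
specialize (H1 z ltac:(lra)). specialize (H2 z ltac:(lra)).
replace (f z + g z - (f z0 + g z0))%C with ((f z - f z0) + (g z - g z0))%C by ring.
eapply Rle_lt_trans; [apply Cmod_triangle|]. lra.
Qed.

Lemma continuous_at_const (c z0 : C) : continuous_at (fun _ => c) z0.
Proof.
intros e He. exists 1. split; [lra|]. intros z _.
replace (c - c)%C with (RtoC 0) by ring. now rewrite Cmod_0.
Qed.

Lemma continuous_at_log_shift (x t : R) : t <> x ->
  continuous_at (fun z => Clog_upper (z - RtoC x)) (RtoC t).
Proof.
intros Hne e He.
assert (H0 : (RtoC t - RtoC x)%C <> RtoC 0).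
{ rewrite <- RtoC_minus. intro H. apply RtoC_inj in H. lra. }
destruct (Clog_upper_cont _ e H0 He) as (d & Hd & H). exists d. split; [exact Hd|].
intros z Hz. apply H. now replace (z - RtoC x - (RtoC t - RtoC x))%C with (z - RtoC t)%C by ring.
Qed.

(** The alternative q = 0 serves alpha = 0 or beta = 0, where the factor 0 hides the singularity of
    the logarithm at 0 or 1. *)
Lemma continuous_at_scal (q : R) (f : C -> C) (z0 : C) :
  q = 0 \/ continuous_at f z0 -> continuous_at (fun z => RtoC q * f z)%C z0.
Proof.
intros Hor e He. destruct (Req_dec q 0) as [->|Hq].
- exists 1. split; [lra|]. intros z _.
  replace (RtoC 0 * f z - RtoC 0 * f z0)%C with (RtoC 0) by ring. now rewrite Cmod_0.
- destruct Hor as [Hor|Hf]; [contradiction|]. apply Rabs_pos_lt in Hq.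
  destruct (Hf (e / Rabs q)) as (d & Hd & H); [now apply Rdiv_lt_0_compat|].
  exists d. split; [exact Hd|]. intros z Hz. specialize (H z Hz).
  replace (RtoC q * f z - RtoC q * f z0)%C with (RtoC q * (f z - f z0))%C by ring.
  rewrite Cmod_mult, Cmod_R. replace e with (Rabs q * (e / Rabs q)) by (field; lra).
  now apply Rmult_lt_compat_l.
Qed.

(* The points where no logarithm with a positive coefficient is singular. *)
Definition regular (n : nat) (alpha beta : R) (xi : nat -> R) (t : R) : Prop :=
  (alpha = 0 \/ t <> 0) /\ (beta = 0 \/ t <> 1) /\
  forall j, (1 <= j <= n)%nat -> t <> xi j.

Lemma log_sum_continuous (xi : nat -> R) (m : nat) (t : R) :
  (forall j, (1 <= j <= m)%nat -> t <> xi j) -> continuous_at (log_sum xi m) (RtoC t).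
Proof.
intro Hj. induction m as [|m IH]; [exact (continuous_at_const (RtoC 0) (RtoC t))|].
apply (continuous_at_plus (log_sum xi m)).
- apply IH. intros j Hj'. apply Hj. lia.
- apply continuous_at_log_shift, Hj. lia.
Qed.

Lemma log_product_continuous (n : nat) (alpha beta c : R) (xi : nat -> R) (t : R) :
  regular n alpha beta xi t -> continuous_at (log_product n alpha beta c xi) (RtoC t).
Proof.
intros (H0 & H1 & Hj). unfold log_product.
apply (continuous_at_plus (fun z => _ + _ + _)%C); [|apply continuous_at_const].
apply (continuous_at_plus (fun z => _ + _)%C); [|now apply log_sum_continuous].
apply (continuous_at_plus (fun z => _)%C); apply continuous_at_scal.
- destruct H0 as [H0|H0]; [now left|right].
  intros e He. destruct (continuous_at_log_shift 0 t H0 e He) as (d & Hd & H).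
  exists d. split; [exact Hd|]. intros z Hz. specialize (H z Hz).
  now replace (z - RtoC 0)%C with z in H by ring;
    replace (RtoC t - RtoC 0)%C with (RtoC t) in H by ring.
- destruct H1 as [H1|H1]; [now left|right].
  apply (continuous_at_plus (fun z => Clog_upper (z - RtoC 1)));
    [now apply continuous_at_log_shift|apply continuous_at_const].
Qed.

Lemma Clog_upper_real (x : R) : x <> 0 ->
  Clog_upper (RtoC x) = (ln (Rabs x), if Rlt_dec x 0 then PI else 0).
Proof.
intro Hx. unfold Clog_upper. rewrite Cmod_R. unfold Re at 1; simpl. f_equal.
unfold Rabs. destruct Rcase_abs; destruct Rlt_dec; try lra.
- replace (x / - x) with (- (1)) by (field; lra). rewrite acos_opp, acos_1. ring.
- replace (x / x) with 1 by (field; lra). apply acos_1.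
Qed.

Lemma Cexp_zero : Cexp (RtoC 0) = RtoC 1.
Proof.
unfold Cexp, Re, Im; simpl. rewrite exp_0, cos_0, sin_0.
apply injective_projections; simpl; ring.
Qed.

Lemma Cexp_polar (a b : R) : Cexp (a, b) = (RtoC (exp a) * Cexp (0, b)%R)%C.
Proof.
unfold Cexp, Re, Im; simpl. rewrite exp_0. apply injective_projections; simpl; ring.
Qed.

Lemma Jtilde_S (m : nat) (xi : nat -> R) (t : R) :
  Jtilde (S m) xi t = Jtilde m xi t * (t - xi (S m)).
Proof.
unfold Jtilde. rewrite seq_S, map_app, fold_right_app. simpl.
rewrite Rmult_1_r. generalize (t - xi (S m)) (map (fun j => t - xi j) (seq 1 m)).
intros x l. induction l as [|y l IH]; simpl; [ring|]. rewrite IH. ring.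
Qed.

Lemma Jtilde_root (m j : nat) (xi : nat -> R) : (1 <= j <= m)%nat ->
  Jtilde m xi (xi j) = 0.
Proof.
induction m as [|m IH]; intro Hj; [lia|]. rewrite Jtilde_S.
destruct (Nat.eq_dec j (S m)) as [->|Hne]; [ring|]. rewrite IH by lia. ring.
Qed.

Lemma Cexp_log_sum (xi : nat -> R) (m : nat) (t : R) :
  (forall j, (1 <= j <= m)%nat -> t <> xi j) ->
  Cexp (log_sum xi m (RtoC t)) = RtoC (Jtilde m xi t).
Proof.
intro Hj. induction m as [|m IH]; [exact Cexp_zero|].
change (log_sum xi (S m) (RtoC t)) with
  (log_sum xi m (RtoC t) + Clog_upper (RtoC t - RtoC (xi (S m))))%C.
rewrite Cexp_plus, IH, Cexp_Clog_upper, Jtilde_S, RtoC_mult, RtoC_minus;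
  [reflexivity| |unfold Im; simpl; lra|intros; apply Hj; lia].
rewrite <- RtoC_minus. intro H. apply RtoC_inj in H.
apply (Hj (S m)); [lia|lra].
Qed.

Lemma rpow_nonzero (x a : R) : 0 < x -> rpow x a = exp (a * ln x).
Proof. intro Hx. unfold rpow. destruct Req_EM_T; [lra|reflexivity]. Qed.

Lemma Cexp_log_product (n : nat) (alpha beta c : R) (xi : nat -> R) (t : R) :
  regular n alpha beta xi t ->
  Cexp (log_product n alpha beta c xi (RtoC t)) =
    (cweight alpha beta t * RtoC (exp c) * RtoC (Jtilde n xi t))%C.
Proof.
intros (H0 & H1 & Hj). unfold log_product, cweight.
rewrite !Cexp_plus, Cexp_log_sum by exact Hj.
assert (E0 : Cexp (RtoC alpha * Clog_upper (RtoC t)) =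
  (RtoC (rpow (Rabs t) alpha) *
     Cexp (0, if Rlt_dec t 0 then (alpha * PI)%R else 0%R))%C).
{ destruct (Req_dec t 0) as [->|Ht].
  - destruct H0 as [->|H0]; [|contradiction].
    rewrite Cmult_0_l, Rabs_R0. unfold rpow. destruct Req_EM_T; [|lra].
    destruct Rlt_dec; [lra|].
    change (0, 0) with (RtoC 0). rewrite Cexp_zero. ring.
  - rewrite Clog_upper_real, rpow_nonzero by (try apply Rabs_pos_lt; exact Ht).
    rewrite <- Cexp_polar. f_equal. apply injective_projections; simpl.
    + ring.
    + destruct Rlt_dec; ring. }
assert (E1 : Cexp (RtoC beta * (Clog_upper (RtoC t - RtoC 1) - RtoC PI * Ci)) =
  (RtoC (rpow (Rabs (1 - t)) beta) *
     Cexp (0, if Rlt_dec 1 t then (- (beta * PI))%R else 0%R))%C).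
{ destruct (Req_dec t 1) as [->|Ht].
  - destruct H1 as [->|H1]; [|contradiction].
    rewrite Cmult_0_l, Rminus_diag, Rabs_R0. unfold rpow. destruct Req_EM_T; [|lra].
    destruct (Rlt_dec 1 1); [lra|].
    change (0, 0) with (RtoC 0). rewrite Cexp_zero. ring.
  - rewrite <- RtoC_minus, Clog_upper_real, rpow_nonzero by (try apply Rabs_pos_lt; lra).
    rewrite <- Cexp_polar, (Rabs_minus_sym t 1). f_equal.
    apply injective_projections; simpl.
    + ring.
    + repeat destruct Rlt_dec; try lra; ring. }
assert (E2 : Cexp (RtoC c) = RtoC (exp c)).
{ change (RtoC c) with (c, 0). rewrite Cexp_polar.
  change (0, 0) with (RtoC 0). rewrite Cexp_zero. ring. }
rewrite E0, E1, E2. ring.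
Qed.

Lemma cweight_unit_interval (alpha beta t : R) : 0 <= t <= 1 ->
  cweight alpha beta t = RtoC (weight alpha beta t).
Proof.
intro Ht. unfold cweight, weight.
destruct Rlt_dec; [lra|]. destruct Rlt_dec; [lra|].
change (0, 0) with (RtoC 0). rewrite Cexp_zero, !Rabs_pos_eq, RtoC_mult by lra. ring.
Qed.

Lemma irregular_zero (n : nat) (alpha beta : R) (xi : nat -> R) (t : R) :
  ~ regular n alpha beta xi t -> 0 <= alpha -> 0 <= beta ->
  ((t = 0 /\ 0 < alpha) \/ (t = 1 /\ 0 < beta) \/
   exists j, (1 <= j <= n)%nat /\ t = xi j) /\
  forall s, (cweight alpha beta t * s * RtoC (Jtilde n xi t))%C = RtoC 0.
Proof.
intros Hr Ha Hb.
assert (H : (t = 0 /\ 0 < alpha) \/ (t = 1 /\ 0 < beta) \/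
   exists j, (1 <= j <= n)%nat /\ t = xi j).
{ apply NNPP. intro H. apply Hr. split; [|split].
  - destruct (Req_dec alpha 0); [now left|right]. intro. apply H. left. lra.
  - destruct (Req_dec beta 0); [now left|right]. intro. apply H. right; left. lra.
  - intros j Hj Ht. apply H. right; right. now exists j. }
split; [exact H|]. intro s. destruct H as [[-> H]|[[-> H]|(j & Hj & ->)]].
- unfold cweight, rpow. rewrite Rabs_R0. destruct Req_EM_T; [|lra].
  destruct Req_EM_T; [lra|]. ring.
- unfold cweight, rpow. rewrite Rminus_diag, Rabs_R0.
  destruct (Req_EM_T 0 0); [|lra]. destruct (Req_EM_T beta 0); [lra|]. ring.
- rewrite Jtilde_root by exact Hj. ring.
Qed.

Lemma ln_Cmod_bounded (x t : R) : exists b, forall z, upper z ->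
  Cmod (z - RtoC t) < 1 -> ln (Cmod (z - RtoC x)) <= b.
Proof.
exists (ln (1 + Rabs (t - x))). intros z Hz Hzt.
assert (Hp : 0 < Cmod (z - RtoC x)) by (apply Cmod_gt_0, upper_neq_0, upper_shift, Hz).
apply Rcomplements.ln_le; [exact Hp|].
pose proof (Cmod_triangle (z - RtoC t) (RtoC t - RtoC x)) as T.
replace (z - RtoC t + (RtoC t - RtoC x))%C with (z - RtoC x)%C in T by ring.
rewrite <- (RtoC_minus t x), Cmod_R in T. lra.
Qed.

Lemma ln_Cmod_singular (t m : R) : exists d, 0 < d /\ forall z, upper z ->
  Cmod (z - RtoC t) < d -> ln (Cmod (z - RtoC t)) < m.
Proof.
exists (exp m). split; [apply exp_pos|]. intros z Hz Hzt.
assert (Hp : 0 < Cmod (z - RtoC t)) by (apply Cmod_gt_0, upper_neq_0, upper_shift, Hz).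
rewrite <- (ln_exp m). now apply ln_increasing.
Qed.

Lemma log_sum_S_Re (xi : nat -> R) (m : nat) (z : C) :
  Re (log_sum xi (S m) z) = Re (log_sum xi m z) + ln (Cmod (z - RtoC (xi (S m)))).
Proof. reflexivity. Qed.

Lemma log_sum_bounded (xi : nat -> R) (k : nat) (t : R) : exists b, forall z, upper z ->
  Cmod (z - RtoC t) < 1 -> Re (log_sum xi k z) <= b.
Proof.
induction k as [|k [b IH]]; [exists 0; intros; unfold Re; simpl; lra|].
destruct (ln_Cmod_bounded (xi (S k)) t) as [b' H]. exists (b + b').
intros z Hz Hzt. rewrite log_sum_S_Re. specialize (IH z Hz Hzt). specialize (H z Hz Hzt). lra.
Qed.

Lemma log_sum_singular (xi : nat -> R) (k j : nat) (m : R) : (1 <= j <= k)%nat ->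
  exists d, 0 < d /\ forall z, upper z ->
  Cmod (z - RtoC (xi j)) < d -> Re (log_sum xi k z) < m.
Proof.
revert m. induction k as [|k IH]; intros m Hj; [lia|].
destruct (Nat.eq_dec j (S k)) as [->|Hne].
- destruct (log_sum_bounded xi k (xi (S k))) as [b Hb].
  destruct (ln_Cmod_singular (xi (S k)) (m - b)) as (d & Hd & H).
  exists (Rmin d 1). pose proof (Rmin_l d 1). pose proof (Rmin_r d 1).
  split; [apply Rmin_pos; lra|]. intros z Hz Hzt. rewrite log_sum_S_Re.
  specialize (Hb z Hz ltac:(lra)). specialize (H z Hz ltac:(lra)). lra.
- destruct (ln_Cmod_bounded (xi (S k)) (xi j)) as [b Hb].
  destruct (IH (m - b) ltac:(lia)) as (d & Hd & H).
  exists (Rmin d 1). pose proof (Rmin_l d 1). pose proof (Rmin_r d 1).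
  split; [apply Rmin_pos; lra|]. intros z Hz Hzt. rewrite log_sum_S_Re.
  specialize (Hb z Hz ltac:(lra)). specialize (H z Hz ltac:(lra)). lra.
Qed.

(** One logarithm with positive coefficient tends to minus infinity and the others are bounded
    above. One-sided bounds suffice, so the argument also covers roots that coincide with each other
    or with 0 or 1. *)
Lemma log_product_singular (n : nat) (alpha beta c : R) (xi : nat -> R) (t : R) :
  0 <= alpha -> 0 <= beta -> ~ regular n alpha beta xi t ->
  forall m, exists d, 0 < d /\ forall z, upper z -> Cmod (z - RtoC t) < d ->
    Re (log_product n alpha beta c xi z) < m.
Proof.
intros Ha Hb Hr m.
destruct (irregular_zero n alpha beta xi t Hr Ha Hb) as [Hcase _].
destruct (ln_Cmod_bounded 0 t) as [b0 H0]. destruct (ln_Cmod_bounded 1 t) as [b1 H1].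
destruct (log_sum_bounded xi n t) as [b2 H2].
assert (A0 : forall z, upper z -> Cmod (z - RtoC t) < 1 -> alpha * ln (Cmod z) <= alpha * b0).
{ intros z Hz Hzt. apply Rmult_le_compat_l; [exact Ha|]. specialize (H0 z Hz Hzt).
  now replace (z - RtoC 0)%C with z in H0 by ring. }
assert (A1 : forall z, upper z -> Cmod (z - RtoC t) < 1 ->
  beta * ln (Cmod (z - RtoC 1)) <= beta * b1).
{ intros z Hz Hzt. apply Rmult_le_compat_l; [exact Hb|]. now apply H1. }
assert (K : exists d, 0 < d /\ forall z, upper z -> Cmod (z - RtoC t) < d ->
  Cmod (z - RtoC t) < 1 -> Re (log_product n alpha beta c xi z) < m).
{ destruct Hcase as [[Ht Hq]|[[Ht Hq]|(j & Hj & Ht)]].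
  - destruct (ln_Cmod_singular t ((m - beta * b1 - b2 - c) / alpha)) as (d & Hd & H).
    exists d. split; [exact Hd|]. intros z Hz Hzd Hzt. specialize (H z Hz Hzd).
    specialize (A1 z Hz Hzt). specialize (H2 z Hz Hzt). rewrite Re_log_product.
    rewrite Ht in H. replace (z - RtoC 0)%C with z in H by ring.
    apply Rmult_lt_compat_l with (r := alpha) in H; [|exact Hq].
    replace (alpha * ((m - beta * b1 - b2 - c) / alpha)) with (m - beta * b1 - b2 - c) in H
      by (field; lra). lra.
  - destruct (ln_Cmod_singular t ((m - alpha * b0 - b2 - c) / beta)) as (d & Hd & H).
    exists d. split; [exact Hd|]. intros z Hz Hzd Hzt. specialize (H z Hz Hzd).
    specialize (A0 z Hz Hzt). specialize (H2 z Hz Hzt). rewrite Re_log_product.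
    rewrite Ht in H.
    apply Rmult_lt_compat_l with (r := beta) in H; [|exact Hq].
    replace (beta * ((m - alpha * b0 - b2 - c) / beta)) with (m - alpha * b0 - b2 - c) in H
      by (field; lra). lra.
  - destruct (log_sum_singular xi n j (m - alpha * b0 - beta * b1 - c) Hj) as (d & Hd & H).
    exists d. split; [exact Hd|]. intros z Hz Hzd Hzt.
    specialize (A0 z Hz Hzt). specialize (A1 z Hz Hzt). rewrite Re_log_product.
    rewrite <- Ht in H. specialize (H z Hz Hzd). lra. }
destruct K as (d & Hd & H). exists (Rmin d 1). pose proof (Rmin_l d 1). pose proof (Rmin_r d 1).
split; [apply Rmin_pos; lra|]. intros z Hz Hzt. apply H; [exact Hz|lra|lra].
Qed.

(** Each root to the right of t contributes an argument pi. For regular t in [0, 1] the count is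
    therefore the level Im w / pi of the boundary value, and its parity is the sign of the
    polynomial. *)
Fixpoint roots_above (xi : nat -> R) (m : nat) (t : R) : nat :=
  match m with
  | O => O
  | S m => ((if Rlt_dec t (xi (S m)) then 1 else 0) + roots_above xi m t)%nat
  end.

Lemma roots_above_le (xi : nat -> R) (m : nat) (t : R) : (roots_above xi m t <= m)%nat.
Proof. induction m as [|m IH]; simpl; [lia|]. destruct Rlt_dec; lia. Qed.

Lemma roots_above_antitone (xi : nat -> R) (m : nat) (s t : R) : s <= t ->
  (roots_above xi m t <= roots_above xi m s)%nat.
Proof.
intro Hst. induction m as [|m IH]; simpl; [lia|].
repeat destruct Rlt_dec; lia || lra.
Qed.

Lemma roots_above_0 (xi : nat -> R) (m : nat) (t : R) : roots_above xi m t = 0%nat ->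
  forall j, (1 <= j <= m)%nat -> xi j <= t.
Proof.
induction m as [|m IH]; simpl; intros H j Hj; [lia|].
destruct Rlt_dec; [lia|].
destruct (Nat.eq_dec j (S m)) as [->|Hne]; [lra|]. apply IH; [exact H|lia].
Qed.

Lemma roots_above_all (xi : nat -> R) (m : nat) (t : R) : roots_above xi m t = m ->
  forall j, (1 <= j <= m)%nat -> t < xi j.
Proof.
induction m as [|m IH]; simpl; intros H j Hj; [lia|].
pose proof (roots_above_le xi m t). destruct Rlt_dec; [|lia].
destruct (Nat.eq_dec j (S m)) as [->|Hne]; [assumption|]. apply IH; lia.
Qed.

Lemma Im_log_sum_real (xi : nat -> R) (m : nat) (t : R) :
  (forall j, (1 <= j <= m)%nat -> t <> xi j) ->
  Im (log_sum xi m (RtoC t)) = INR (roots_above xi m t) * PI.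
Proof.
intro Hj. induction m as [|m IH]; [unfold Im; simpl; ring|].
change (Im (log_sum xi (S m) (RtoC t))) with
  (Im (log_sum xi m (RtoC t)) + Im (Clog_upper (RtoC t - RtoC (xi (S m))))).
rewrite IH by (intros; apply Hj; lia). specialize (Hj (S m) ltac:(lia)).
rewrite <- RtoC_minus, Clog_upper_real by lra.
change (Im (ln (Rabs (t - xi (S m))), if Rlt_dec (t - xi (S m)) 0 then PI else 0))
  with (if Rlt_dec (t - xi (S m)) 0 then PI else 0).
cbn [roots_above]. rewrite plus_INR. repeat destruct Rlt_dec; simpl; lra.
Qed.

Lemma Jtilde_sign (xi : nat -> R) (m : nat) (t : R) :
  Jtilde m xi t = (-1) ^ roots_above xi m t * Rabs (Jtilde m xi t).
Proof.
induction m as [|m IH].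
- unfold Jtilde; simpl. rewrite Rabs_R1. ring.
- rewrite Jtilde_S, Rabs_mult. rewrite IH at 1. cbn [roots_above].
  unfold Rabs at 3. destruct Rcase_abs; destruct Rlt_dec; simpl; lra.
Qed.

Lemma Im_log_product_real (n : nat) (alpha beta c : R) (xi : nat -> R) (t : R) :
  regular n alpha beta xi t ->
  Im (log_product n alpha beta c xi (RtoC t)) =
    ((if Rlt_dec t 0 then alpha else 0) - (if Rlt_dec 1 t then beta else 0) +
     INR (roots_above xi n t)) * PI.
Proof.
intros (H0 & H1 & Hj). rewrite Im_log_product, Im_log_sum_real by exact Hj.
assert (E0 : alpha * Im (Clog_upper (RtoC t)) = (if Rlt_dec t 0 then alpha else 0) * PI).
{ destruct H0 as [->|H0]; [destruct (Rlt_dec t 0); ring|].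
  rewrite Clog_upper_real by exact H0. unfold Im; simpl. destruct Rlt_dec; ring. }
assert (E1 : beta * (Im (Clog_upper (RtoC t - RtoC 1)) - PI) =
  - (if Rlt_dec 1 t then beta else 0) * PI).
{ destruct H1 as [->|H1]; [destruct (Rlt_dec 1 t); ring|].
  rewrite <- RtoC_minus, Clog_upper_real by lra. unfold Im; simpl.
  repeat destruct Rlt_dec; lra. }
rewrite E0, E1. ring.
Qed.

Lemma exp_Re_log_product (n : nat) (alpha beta c : R) (xi : nat -> R) (t : R) :
  regular n alpha beta xi t -> 0 <= t <= 1 ->
  exp (Re (log_product n alpha beta c xi (RtoC t))) =
    weight alpha beta t * Rabs (Jtilde n xi t) * exp c /\ 0 < weight alpha beta t.
Proof.
intros Hr Ht.
assert (Hp : forall x a, 0 <= x -> (a = 0 \/ x <> 0) -> 0 < rpow x a).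
{ intros x a Hx H. destruct (Req_dec x 0) as [->|Hx0].
  - unfold rpow. repeat destruct Req_EM_T; lra.
  - rewrite rpow_nonzero by lra. apply exp_pos. }
assert (Hw : 0 < weight alpha beta t).
{ destruct Hr as (H0 & H1 & _). apply Rmult_lt_0_compat; apply Hp; lra. }
split; [|exact Hw].
rewrite <- Cmod_Cexp, Cexp_log_product, cweight_unit_interval by assumption.
rewrite !Cmod_mult, !Cmod_R, (Rabs_pos_eq (weight alpha beta t)) by lra.
rewrite (Rabs_pos_eq (exp c)) by apply Rlt_le, exp_pos. ring.
Qed.

(** * The normalized map *)

Section NormalizedMap.

Context (n : nat) (alpha beta : R) (w : C -> C) (c : R).
Context (Hw : normalized_map n alpha beta w).
Context (Hc : asymptotic_const n alpha beta w c).

Lemma map_cderiv (z : C) : upper z -> exists d, cderiv w z d.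
Proof. intro Hz. apply ex_derive_cderiv, Hw, Hz. Qed.

Lemma map_cont (z : C) (e : R) : upper z -> 0 < e ->
  exists r, 0 < r /\ forall y, Cmod (y - z) < r -> Cmod (w y - w z) < e.
Proof.
intros Hz He. destruct (map_cderiv z Hz) as [d Hd].
exact (cderiv_cont w z d Hd e He).
Qed.

Lemma map_Omega (z : C) : upper z -> Omega n alpha beta (w z).
Proof. intro Hz. now apply Hw. Qed.

Lemma map_band (z : C) : upper z ->
  - beta * PI < Im (w z) < (alpha + INR n) * PI.
Proof.
intro Hz. destruct (map_Omega z Hz) as [H _]. pose proof PI_RGT_0.
replace (Im (w z)) with (Im (w z) / PI * PI) by (field; lra).
split; apply Rmult_lt_compat_r; lra.
Qed.

Lemma total_width_pos : 0 < alpha + beta + INR n.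
Proof.
assert (Hi : upper Ci) by (unfold upper, Im; simpl; lra).
pose proof (map_band Ci Hi). pose proof PI_RGT_0. nra.
Qed.

(** * The inverse map and the behaviour of w near the boundary of Omega *)

Definition map_inv (v : C) : C :=
  epsilon (inhabits (RtoC 0)) (fun z => upper z /\ w z = v).

Lemma map_inv_spec (v : C) : Omega n alpha beta v ->
  upper (map_inv v) /\ w (map_inv v) = v.
Proof.
intro Hv. unfold map_inv. apply epsilon_spec. now apply Hw.
Qed.

Lemma map_inv_map (z : C) : upper z -> map_inv (w z) = z.
Proof.
intro Hz. destruct (map_inv_spec (w z) (map_Omega z Hz)) as [H1 H2].
now apply Hw.
Qed.

Lemma upper_ball (z0 z : C) : Cmod (z - z0) < Im z0 -> upper z.
Proof.
intro H. pose proof (Im_le_Cmod (z - z0)) as T. apply Rabs_le_between in T.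
unfold upper, Im in *; simpl in T. lra.
Qed.

Lemma map_inv_cont (z0 : C) (e : R) : upper z0 -> 0 < e ->
  exists rho, 0 < rho /\ forall v, Cmod (v - w z0) < rho ->
    Omega n alpha beta v /\ Cmod (map_inv v - z0) < e.
Proof.
intros Hz0 He. unfold upper in Hz0.
set (r := Rmin (e / 2) (Im z0 / 2)).
assert (Hr : 0 < r) by (apply Rmin_pos; lra).
assert (Hr1 : r <= e / 2) by apply Rmin_l.
assert (Hr2 : r <= Im z0 / 2) by apply Rmin_r.
destruct (injective_open w z0 r Hr) as (rho & Hrho & H).
- intros z Hz. apply map_cderiv, (upper_ball z0). lra.
- intros z Hz Heq. assert (z = z0).
  { apply Hw; [apply (upper_ball z0); lra|exact Hz0|exact Heq]. }
  subst z. replace (z0 - z0)%C with (RtoC 0) in Hz by ring.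
  rewrite Cmod_0 in Hz. lra.
- exists rho. split; [exact Hrho|]. intros v Hv.
  destruct (H v Hv) as (z & Hz & <-).
  assert (Hu : upper z) by (apply (upper_ball z0); lra).
  split; [now apply map_Omega|]. rewrite map_inv_map by exact Hu. lra.
Qed.

(** If v were in Omega, values of w close to v would have preimages close to the preimage of v,
    hence at a height bounded below. *)
Lemma not_Omega_of_cluster (v : C) :
  (forall e, 0 < e -> exists z, upper z /\ Im z < e /\ Cmod (w z - v) < e) ->
  ~ Omega n alpha beta v.
Proof.
intros H Hv. destruct (map_inv_spec v Hv) as [Hu Hwv].
set (z0 := map_inv v) in *. unfold upper in Hu.
destruct (map_inv_cont z0 (Im z0 / 2) Hu ltac:(lra)) as (rho & Hrho & Hr).
destruct (H (Rmin rho (Im z0 / 2)) ltac:(apply Rmin_pos; lra)) as (z & Hz & H1 & H2).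
pose proof (Rmin_l rho (Im z0 / 2)). pose proof (Rmin_r rho (Im z0 / 2)).
rewrite Hwv in Hr. destruct (Hr (w z) ltac:(lra)) as [_ K].
rewrite map_inv_map in K by exact Hz.
pose proof (Im_le_Cmod (z - z0)) as T. apply Rabs_le_between in T.
unfold Im in *; simpl in T. lra.
Qed.

Lemma map_right (m : R) : exists r, 0 < r /\ forall z, upper z -> r < Cmod z ->
  m < Re (w z).
Proof.
destruct Hw as (_ & _ & _ & H).
destruct (H (fun v => m < Re v)) as [r Hr].
{ exists m. auto. }
exists (Rmax r 1). split; [pose proof (Rmax_r r 1); lra|]. intros z Hz Hm.
apply Hr; [exact Hz|]. pose proof (Rmax_l r 1). lra.
Qed.

Lemma map_left (a b xi : R) : filterlim w (near_real xi) (left_end a b) ->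
  forall m, exists r, 0 < r /\ forall z, upper z -> Cmod (z - RtoC xi) < r ->
    Re (w z) < m /\ a < Im (w z) / PI < b.
Proof.
intros H m. destruct (H (fun v => Re v < m /\ a < Im v / PI < b)) as [r Hr].
{ exists m. auto. }
exists r. split; [apply cond_pos|]. intros z Hz Hzr. apply Hr; [|exact Hz].
now apply C_NormedModule_mixin_compat1.
Qed.

(* A sequence whose images stay away from the right end and leave every compact
   subset of Omega tends to the real line. *)
Lemma Im_small (E : R -> C -> Prop) (m e : R) :
  (forall del del' v, del <= del' -> E del v -> E del' v) ->
  (forall v, E 1 v -> Re v < m) ->
  (forall v, Omega n alpha beta v -> exists rho, 0 < rho /\
     forall v', Cmod (v' - v) < rho -> ~ E rho v') ->
  0 < e ->
  exists del, 0 < del /\ forall z, upper z -> E del (w z) -> Im z < e.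
Proof.
intros Hmon Hm HE He. apply NNPP. intro Hno.
destruct (map_right m) as (r & Hr & Hright).
destruct (cluster_point_C (fun del z => upper z /\ E del (w z) /\ e <= Im z)
  (- r) r e r) as (z & _ & Hz & Hcl).
- intros del del' z Hdel (H1 & H2 & H3). repeat split; try assumption.
  now apply Hmon with del.
- intros del Hdel. apply NNPP. intro Hno'. apply Hno. exists (Rmin del 1).
  pose proof (Rmin_l del 1). pose proof (Rmin_r del 1).
  split; [apply Rmin_pos; lra|]. intros z Hz HEz. apply Rnot_le_lt. intro Hle.
  apply Hno'. exists z.
  assert (Hzr : Cmod z <= r).
  { apply Rnot_lt_le. intro Hlt. specialize (Hright z Hz Hlt).
    specialize (Hm (w z) (Hmon (Rmin del 1) 1 _ ltac:(lra) HEz)). lra. }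
  pose proof (re_le_Cmod z) as A. pose proof (Im_le_Cmod z) as B.
  apply Rabs_le_between in A. apply Rabs_le_between in B.
  repeat split; try lra; try assumption. apply Hmon with (Rmin del 1); [lra|exact HEz].
- assert (Hu : upper z) by (unfold upper; lra).
  destruct (HE (w z) (map_Omega z Hu)) as (rho & Hrho & H).
  destruct (map_cont z rho Hu Hrho) as (t & Ht & Hcont).
  destruct (Hcl (Rmin t rho) ltac:(apply Rmin_pos; lra)) as (z' & H1 & H2 & H3 & _).
  pose proof (Rmin_l t rho). pose proof (Rmin_r t rho).
  apply (H (w z')); [apply Hcont; lra|].
  apply Hmon with (Rmin t rho); [lra|exact H3].
Qed.

Lemma Im_small_boundary (v : C) (e : R) : ~ Omega n alpha beta v -> 0 < e ->
  exists del, 0 < del /\ forall z, upper z -> Cmod (w z - v) < del -> Im z < e.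
Proof.
intros Hv He.
apply (Im_small (fun del v' => Cmod (v' - v) < del) (Re v + 1) e); [| | |exact He].
- intros del del' v' H1 H2. lra.
- intros v' H. pose proof (re_le_Cmod (v' - v)) as T. apply Rabs_le_between in T.
  unfold Re in *; simpl in T. lra.
- intros v' Hv'. assert (Hne : (v' - v)%C <> 0%C).
  { intro H0. apply Hv. replace v with (v' - (v' - v))%C by ring. rewrite H0.
    now replace (v' - 0)%C with v' by ring. }
  apply Cmod_gt_0 in Hne. exists (Cmod (v' - v) / 2). split; [lra|].
  intros v'' H1 H2. pose proof (Cmod_triangle (v' - v'') (v'' - v)) as T.
  replace (v' - v'' + (v'' - v))%C with (v' - v)%C in T by ring.
  rewrite (Cmod_minus_sym v' v'') in T. lra.
Qed.

Lemma Im_small_left (e : R) : 0 < e ->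
  exists m, forall z, upper z -> Re (w z) < m -> Im z < e.
Proof.
intros He.
(* The half-planes Re v < - 1 / del shrink to the left end as del tends to 0; the conjunct 0 < del
   makes the family monotone in del. *)
destruct (Im_small (fun del v => Re v < - / del /\ 0 < del) 0 e)
  as (del & Hdel & H); [| | |exact He|].
- intros del del' v Hle [H1 H2]. split; [|lra].
  apply Rlt_le_trans with (1 := H1). apply Ropp_le_contravar.
  now apply Rinv_le_contravar.
- intros v [H _]. rewrite Rinv_1 in H. lra.
- intros v _. exists (/ (Rabs (Re v) + 1)).
  pose proof (Rabs_pos (Re v)) as Hp.
  assert (Hi : 0 < / (Rabs (Re v) + 1)) by (apply Rinv_0_lt_compat; lra).
  split; [exact Hi|]. intros v' H1 [H2 _]. rewrite Rinv_inv in H2.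
  assert (Hi1 : / (Rabs (Re v) + 1) <= 1)
    by (rewrite <- Rinv_1 at 2; apply Rinv_le_contravar; lra).
  pose proof (re_le_Cmod (v' - v)) as T. apply Rabs_le_between in T.
  pose proof (Rle_abs (- Re v)) as A. rewrite Rabs_Ropp in A.
  unfold Re in *; simpl in T. lra.
- exists (- / del). intros z Hz Hm. apply H; auto.
Qed.

Lemma asymptotics : exists k m, 0 < k /\ 0 < m /\ forall z, upper z -> m < Cmod z ->
  Rabs (Re (w z) - ((alpha + beta + INR n) * ln (Cmod z) + c)) <= k / Cmod z /\
  Rabs (Im (w z) - ((alpha + beta + INR n) * Im (Clog_upper z) - beta * PI))
    <= k / Cmod z.
Proof.
destruct Hc as (k & m & H). exists (Rmax k 1), (Rmax m 1).
split; [pose proof (Rmax_r k 1); lra|]. split; [pose proof (Rmax_r m 1); lra|].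
intros z Hz Hm. pose proof (Rmax_l m 1). pose proof (Rmax_r m 1).
specialize (H z Hz ltac:(lra)).
assert (Hk : k / Cmod z <= Rmax k 1 / Cmod z).
{ apply Rmult_le_compat_r; [apply Rlt_le, Rinv_0_lt_compat; lra|apply Rmax_l]. }
match type of H with Cmod ?x <= _ =>
  pose proof (re_le_Cmod x) as A; pose proof (Im_le_Cmod x) as B end.
split; eapply Rle_trans with (k / Cmod z); try lra;
  [eapply Rle_trans with (2 := H); eapply Rle_trans with (2 := A)
  |eapply Rle_trans with (2 := H); eapply Rle_trans with (2 := B)];
  right; f_equal; unfold Re, Im; simpl; ring.
Qed.

(* Boundary points of the strip that are limits of w along vertical rays
   descending to a real point of large absolute value. *)
Lemma right_end_boundary (x : R) : exists x0, 0 < x0 /\ x <= x0 /\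
  forall s, s = x0 \/ s = - x0 -> exists v, 1 <= Re v /\
    Im v = (if Rlt_dec 0 s then - beta * PI else (alpha + INR n) * PI) /\
    forall del, 0 < del -> exists z, upper z /\ Re z = s /\ Cmod (w z - v) < del.
Proof.
destruct (map_right 1) as (r1 & Hr1 & H1).
destruct asymptotics as (k & m & Hk & Hm & Has).
pose proof total_width_pos as HL. pose proof PI_RGT_0 as HPI.
set (L := alpha + beta + INR n) in *.
assert (HLP : 0 < L * PI) by now apply Rmult_lt_0_compat.
(* Beyond [r1] the images lie to the right of all slits, and the last term makes the asymptotic
   error at most a quarter of the height L pi of the strip. *)
set (x0 := Rmax (Rmax x r1) (Rmax m (4 * k / (L * PI))) + 1).
assert (Hx0 : x < x0 /\ r1 < x0 /\ m < x0 /\ 4 * k / (L * PI) < x0).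
{ unfold x0. pose proof (Rmax_l (Rmax x r1) (Rmax m (4 * k / (L * PI)))).
  pose proof (Rmax_r (Rmax x r1) (Rmax m (4 * k / (L * PI)))).
  pose proof (Rmax_l x r1). pose proof (Rmax_r x r1).
  pose proof (Rmax_l m (4 * k / (L * PI))).
  pose proof (Rmax_r m (4 * k / (L * PI))). lra. }
exists x0. split; [lra|]. split; [lra|]. intros s Hs.
assert (Habs : Rabs s = x0).
{ destruct Hs as [->| ->]; [|rewrite Rabs_Ropp]; apply Rabs_pos_eq; lra. }
assert (Hkx : k / x0 <= L * PI / 4).
{ apply Rmult_le_reg_r with x0; [lra|]. unfold Rdiv at 1.
  rewrite Rmult_assoc, Rinv_l, Rmult_1_r by lra.
  destruct Hx0 as (_ & _ & _ & Hx). apply Rmult_lt_compat_l with (r := L * PI / 4) in Hx;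
    [|lra]. replace (L * PI / 4 * (4 * k / (L * PI))) with k in Hx by (field; lra). lra. }
assert (Hz : forall y, 0 < y < 1 -> upper (s, y) /\ x0 <= Cmod (s, y) <= x0 + 1).
{ intros y Hy. split; [unfold upper, Im; simpl; lra|]. split.
  - rewrite <- Habs. exact (re_le_Cmod (s, y)).
  - eapply Rle_trans; [apply Cmod_le_Re_Im|]. unfold Re, Im; simpl.
    rewrite Habs, (Rabs_pos_eq y); lra. }
set (U := L * ln (x0 + 1) + c + k / x0).
assert (Hest : forall y, 0 < y < 1 -> 1 <= Re (w (s, y)) <= U /\
  Rabs (Im (w (s, y)) - (L * Im (Clog_upper (s, y)) - beta * PI)) <= L * PI / 4).
{ intros y Hy. destruct (Hz y Hy) as (Hu & Hc1 & Hc2).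
  specialize (H1 (s, y) Hu ltac:(lra)).
  destruct (Has (s, y) Hu ltac:(lra)) as [A B].
  assert (Hk' : k / Cmod (s, y) <= k / x0).
  { apply Rmult_le_compat_l; [lra|]. apply Rinv_le_contravar; lra. }
  split; [|lra]. split; [lra|]. unfold U.
  apply Rabs_le_between in A.
  assert (Hln : ln (Cmod (s, y)) <= ln (x0 + 1)).
  { apply Rcomplements.ln_le; lra. }
  apply Rmult_le_compat_l with (r := L) in Hln; lra. }
destruct (cluster_point_C (fun del v => exists y, 0 < y < 1 /\ y < del /\ w (s, y) = v)
  1 U (- beta * PI) ((alpha + INR n) * PI)) as (v & Hv1 & Hv2 & Hv).
- intros del del' v Hle (y & Hy & Hy' & Hwy). exists y. repeat split; try lra; assumption.
- intros del Hdel. set (y := Rmin (del / 2) (1 / 2)).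
  pose proof (Rmin_l (del / 2) (1 / 2)). pose proof (Rmin_r (del / 2) (1 / 2)).
  assert (Hy : 0 < y) by (apply Rmin_pos; lra). fold y in H, H0.
  exists (w (s, y)). destruct (Hest y ltac:(lra)) as [A _].
  pose proof (map_band (s, y) (proj1 (Hz y ltac:(lra)))).
  repeat split; try lra. exists y. repeat split; lra.
- exists v. split; [lra|].
  assert (Hcl : forall del, 0 < del -> exists y, 0 < y < 1 /\ y < del /\
    Cmod (w (s, y) - v) < del).
  { intros del Hdel. destruct (Hv del Hdel) as (v' & H2 & y & H3 & H4 & <-).
    now exists y. }
  split.
  + assert (HnO : ~ Omega n alpha beta v).
    { apply not_Omega_of_cluster. intros e He.
      destruct (Hcl e He) as (y & Hy & Hy' & Hvy). exists (s, y).
      split; [apply Hz; lra|]. split; [exact Hy'|exact Hvy]. }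
    (* As Re v >= 1, the point v is on no slit, so it lies on one of the two edges. *)
    assert (Hedge : Im v = - beta * PI \/ Im v = (alpha + INR n) * PI).
    { apply NNPP. intro Hno. apply HnO. split.
      - split; (apply Rmult_lt_reg_r with PI; [exact HPI|]);
          replace (Im v / PI * PI) with (Im v) by (field; lra); lra.
      - intros (j & _ & _ & H). lra. }
    (* The errors L pi / 4, L pi / 8 and L pi / 8 add up to half of the distance between the edges,
       so the argument of z decides which edge it is. *)
    destruct (arg_near_axis x0 (PI / 8) ltac:(lra) ltac:(lra)) as (d & Hd & Harg).
    destruct (Hcl (Rmin d (L * PI / 8)) ltac:(apply Rmin_pos; lra)) as (y & Hy & Hy' & Hvy).
    pose proof (Rmin_l d (L * PI / 8)). pose proof (Rmin_r d (L * PI / 8)).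
    destruct (Harg (s, y)) as [Ha1 Ha2]; [unfold Im; simpl; lra|].
    destruct (Hest y Hy) as [_ He]. apply Rabs_le_between in He.
    pose proof (Im_le_Cmod (w (s, y) - v)) as T. apply Rabs_le_between in T.
    replace (Im (w (s, y) - v)%C) with (Im (w (s, y)) - Im v) in T
      by (unfold Im; simpl; ring).
    change (Re (s, y)) with s in Ha1, Ha2.
    assert (Hexp : (alpha + INR n) * PI = L * PI - beta * PI) by (unfold L; ring).
    destruct (Rlt_dec 0 s) as [Hs0|Hs0].
    * assert (s = x0) by (destruct Hs; lra). specialize (Ha1 ltac:(lra)).
      apply Rmult_lt_compat_l with (r := L) in Ha1; [|exact HL]. lra.
    * assert (s = - x0) by (destruct Hs; lra). specialize (Ha2 ltac:(lra)).
      apply Rmult_lt_compat_l with (r := L) in Ha2; [|exact HL]. lra.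
  + intros del Hdel. destruct (Hcl del Hdel) as (y & Hy & _ & Hvy).
    exists (s, y). split; [apply Hz; lra|]. split; [reflexivity|exact Hvy].
Qed.

(** * The side of xi on which a boundary point of Omega is approached *)

Context (Halpha : 0 <= alpha) (Hbeta : 0 <= beta).

Lemma slit_strip_Omega (u y : R) :
  slit_strip n alpha beta u y <-> Omega n alpha beta (u, y * PI).
Proof.
pose proof PI_RGT_0. unfold slit_strip, Omega, Re, Im; simpl.
replace (y * PI / PI) with y by (field; lra). tauto.
Qed.

Lemma slit_strip_reflect (al be u y : R) :
  slit_strip n be al u y <-> slit_strip n al be u (INR n - y).
Proof.
unfold slit_strip. split; intros [H1 H2]; (split; [lra|]);
  intros (j & Hj & Hy & Hu); apply H2; exists (n - j)%nat;
  (split; [lia|]); rewrite minus_INR by exact Hj; split; lra.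
Qed.

Lemma Rabs_half_plane_dist (z : C) (x r : R) :
  r <= Cmod (z - RtoC x) -> 0 < Im z < r / 2 -> r / 2 < Rabs (Re z - x).
Proof.
intros H1 H2. pose proof (Cmod_le_Re_Im (z - RtoC x)) as T.
replace (Re (z - RtoC x)%C) with (Re z - x) in T by (unfold Re; simpl; ring).
replace (Im (z - RtoC x)%C) with (Im z) in T by (unfold Im; simpl; ring).
rewrite (Rabs_pos_eq (Im z)) in T by lra. lra.
Qed.

Lemma Cmod_strip_lt (u y u0 y0 del : R) :
  Rabs (u - u0) < del / 8 -> Rabs (y - y0) < del / 8 ->
  Cmod ((u, (y * PI)%R) - (u0, (y0 * PI)%R)) < del.
Proof.
intros Hu Hy. pose proof PI_4. pose proof PI_RGT_0.
eapply Rle_lt_trans; [apply Cmod_le_Re_Im|]. unfold Re, Im; simpl.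
replace (y * PI + - (y0 * PI)) with ((y - y0) * PI) by ring.
rewrite Rabs_mult, (Rabs_pos_eq PI) by lra.
pose proof (Rabs_pos (y - y0)). unfold Rminus in *. nra.
Qed.

(* For s = -1 the lower boundary of the reflected strip (v -> pi n - v, which
   exchanges alpha and beta) is the upper boundary. *)
Lemma boundary_sign (xi a b s : R) (v : C) :
  filterlim w (near_real xi) (left_end a b) ->
  - beta <= a -> a < b -> b <= alpha + INR n ->
  ~ Omega n alpha beta v -> - beta <= Im v / PI <= alpha + INR n ->
  (s = 1 /\ Im v / PI <= a) \/ (s = -1 /\ b <= Im v / PI) ->
  exists e del, 0 < e /\ 0 < del /\ forall z, upper z -> Cmod (w z - v) < del ->
    e <= s * (Re z - xi).
Proof.
intros Hlim Hba Hab Hbn HvO Hvb Hs. pose proof PI_RGT_0 as HPI.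
(* At least one unit to the left of v, so the unit ball about v avoids the excluded part of the
   strip. *)
set (m0 := Rmin 0 (Re v) - 1).
assert (Hm0 : m0 <= 0 /\ m0 + 1 <= Re v)
  by (pose proof (Rmin_l 0 (Re v)); pose proof (Rmin_r 0 (Re v)); unfold m0; lra).
destruct (map_left a b xi Hlim m0) as (r & Hr & Hlr).
set (k := if Rlt_dec 0 s then 0 else INR n).
set (al := if Rlt_dec 0 s then alpha else beta).
set (be := if Rlt_dec 0 s then beta else alpha).
set (a' := if Rlt_dec 0 s then a else INR n - b).
set (b' := if Rlt_dec 0 s then b else INR n - a).
set (phi := fun u y => s * (Re (map_inv (u, ((k + s * y) * PI)%R)) - xi)).
assert (Hs1 : s * s = 1 /\ Rabs s = 1).
{ destruct Hs as [[-> _]|[-> _]]; (split; [ring|]).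
  - apply Rabs_R1.
  - rewrite <- Rabs_Ropp. replace (- (-1)) with 1 by ring. apply Rabs_R1. }
assert (HD : forall u y, slit_strip n al be u y <->
  Omega n alpha beta (u, ((k + s * y) * PI)%R)).
{ intros u y. rewrite <- slit_strip_Omega. unfold k, al, be.
  destruct Hs as [[-> _]|[-> _]]; destruct Rlt_dec; try lra.
  - now replace (0 + 1 * y) with y by ring.
  - replace (INR n + -1 * y) with (INR n - y) by ring. apply slit_strip_reflect. }
assert (Hbad : forall y, a' < y < b' <-> a < k + s * y < b).
{ intro y. unfold a', b', k. destruct Hs as [[-> _]|[-> _]]; destruct Rlt_dec; lra. }
assert (Hbe : 0 <= be /\ a' < al + INR n).
{ unfold be, al, a'. destruct Rlt_dec; lra. }
(* Within r of xi, the image is in the excluded far left part. A point outside it is at distance at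
   least r from xi, and if it is also low, then Re z itself is away from xi. *)
assert (Hfar : forall z, upper z -> ~ (Re (w z) < m0 /\ a < Im (w z) / PI < b) ->
  Im z < r / 2 -> r / 2 < Rabs (Re z - xi)).
{ intros z Hz Hgood Him. apply Rabs_half_plane_dist; [|split; [exact Hz|exact Him]].
  apply Rnot_lt_le. intro Hlt. apply Hgood, (Hlr z Hz Hlt). }
assert (Hnz : forall u y, slit_strip n al be u y -> ~ (u < m0 /\ a' < y < b') ->
  Im (map_inv (u, ((k + s * y) * PI)%R)) < r / 2 -> phi u y <> 0).
{ intros u y HDu Hg Him. apply HD, map_inv_spec in HDu. destruct HDu as [Hu Hwu].
  assert (K : r / 2 < Rabs (Re (map_inv (u, ((k + s * y) * PI)%R)) - xi)).
  { apply Hfar; [exact Hu| |exact Him]. rewrite Hwu. unfold Re, Im; simpl.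
    replace ((k + s * y) * PI / PI) with (k + s * y) by (field; lra).
    now rewrite <- Hbad. }
  intro H0. apply Rmult_integral in H0. destruct H0 as [H0|H0].
  - rewrite H0 in Hs1. lra.
  - rewrite H0, Rabs_R0 in K. lra. }
assert (Hdist : forall u y u0 y0 del, Rabs (u - u0) < del / 8 ->
  Rabs (y - y0) < del / 8 ->
  Cmod ((u, ((k + s * y) * PI)%R) - (u0, ((k + s * y0) * PI)%R)) < del).
{ intros u y u0 y0 del H1 H2. apply Cmod_strip_lt; [exact H1|].
  replace (k + s * y - (k + s * y0)) with (s * (y - y0)) by ring.
  rewrite Rabs_mult. destruct Hs1 as [_ ->]. lra. }
assert (Hcont : forall u y, slit_strip n al be u y -> continuity_2d_pt phi u y).
{ intros u y HDu e. apply HD in HDu. destruct (map_inv_spec _ HDu) as [Hu Hwu].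
  destruct (map_inv_cont _ e Hu (cond_pos e)) as (rho & Hrho & H).
  rewrite Hwu in H. assert (Hrho8 : 0 < rho / 8) by lra.
  exists (mkposreal _ Hrho8). intros u' y' Hu' Hy'.
  destruct (H _ (Hdist u' y' u y rho Hu' Hy')) as [_ K].
  unfold phi. rewrite <- Rmult_minus_distr_l, Rabs_mult.
  destruct Hs1 as [_ ->]. rewrite Rmult_1_l.
  match goal with |- Rabs (?p - xi - (?q - xi)) < _ =>
    replace (p - xi - (q - xi)) with (p - q) by ring end.
  eapply Rle_lt_trans; [|exact K].
  eapply Rle_trans; [|apply re_le_Cmod]. right. f_equal. }
assert (Hleft : exists m, forall u y, slit_strip n al be u y -> u < m ->
  ~ (u < m0 /\ a' < y < b') -> phi u y <> 0).
{ destruct (Im_small_left (r / 2) ltac:(lra)) as [m Hm]. exists m.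
  intros u y HDu Hum Hg. apply Hnz; [exact HDu|exact Hg|].
  apply HD, map_inv_spec in HDu. destruct HDu as [Hu Hwu].
  apply Hm; [exact Hu|]. rewrite Hwu. exact Hum. }
assert (Hcollar : forall u0 y0, ~ slit_strip n al be u0 y0 -> exists del, 0 < del /\
  forall u y, slit_strip n al be u y -> Rabs (u - u0) < del -> Rabs (y - y0) < del ->
  ~ (u < m0 /\ a' < y < b') -> phi u y <> 0).
{ intros u0 y0 HnD. rewrite HD in HnD.
  destruct (Im_small_boundary _ (r / 2) HnD ltac:(lra)) as (del & Hdel & H).
  exists (del / 8). split; [lra|]. intros u y HDu Hu Hy Hg.
  apply Hnz; [exact HDu|exact Hg|]. apply HD, map_inv_spec in HDu.
  destruct HDu as [Hu' Hwu]. apply H; [exact Hu'|]. rewrite Hwu. now apply Hdist. }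
(* Base point of the sign propagation: with x0 > |xi| the sign of s * (s * x0 - xi) is evident. *)
destruct (right_end_boundary (Rabs xi + 1)) as (x0 & Hx0 & Hx0' & Hend).
destruct (Hend (s * x0)) as (vb & Hvb1 & Hvb2 & Hvbl).
{ destruct Hs as [[-> _]|[-> _]]; [left|right]; ring. }
assert (Hbase : forall del, 0 < del -> exists u y, slit_strip n al be u y /\
  Rabs (u - Re vb) < del /\ Rabs (y + be) < del /\ 0 < phi u y).
{ intros del Hdel. destruct (Hvbl del Hdel) as (z & Hz & HRe & Hd).
  set (y := s * (Im (w z) / PI - k)).
  assert (Hy : (k + s * y) * PI = Im (w z)).
  { unfold y. replace (k + s * (s * (Im (w z) / PI - k))) with
      (k + (s * s) * (Im (w z) / PI - k)) by ring.
    destruct Hs1 as [-> _]. field. lra. }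
  assert (Hpt : (Re (w z), ((k + s * y) * PI)%R) = w z).
  { rewrite Hy. now destruct (w z). }
  exists (Re (w z)), y. split; [|split; [|split]].
  - apply HD. rewrite Hpt. now apply map_Omega.
  - eapply Rle_lt_trans; [|exact Hd]. eapply Rle_trans; [|apply re_le_Cmod].
    right. f_equal.
  - assert (Him : y + be = s * (Im (w z - vb)%C / PI)).
    { replace (Im (w z - vb)%C) with (Im (w z) - Im vb) by (unfold Im; simpl; ring).
      rewrite Hvb2. unfold y, k, be.
      destruct Hs as [[-> _]|[-> _]]; repeat destruct Rlt_dec; try lra; field; lra. }
    rewrite Him, Rabs_mult. destruct Hs1 as [_ ->]. rewrite Rmult_1_l.
    unfold Rdiv. rewrite Rabs_mult.
    rewrite (Rabs_pos_eq (/ PI)) by (apply Rlt_le, Rinv_0_lt_compat, HPI).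
    pose proof (Im_le_Cmod (w z - vb)) as T. pose proof PI2_1 as HP2.
    assert (HP1 : / PI < 1) by (rewrite <- Rinv_1; apply Rinv_lt_contravar; lra).
    pose proof (Rinv_0_lt_compat _ HPI). pose proof (Rabs_pos (Im (w z - vb)%C)).
    nra.
  - unfold phi. rewrite Hpt, map_inv_map, HRe by exact Hz.
    replace (s * (s * x0 - xi)) with (s * s * x0 - s * xi) by ring.
    destruct Hs1 as [-> Hs1]. pose proof (Rle_abs (s * xi)) as T.
    rewrite Rabs_mult, Hs1 in T. lra. }
assert (HvI : forall z, z = (Re z, ((k + s * (s * (Im z / PI - k))) * PI)%R)).
{ intro z. replace ((k + s * (s * (Im z / PI - k))) * PI) with (Im z).
  - now destruct z.
  - transitivity ((k + s * s * (Im z / PI - k)) * PI); [|ring].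
    destruct Hs1 as [-> _]. field. lra. }
destruct (lower_boundary_sign n al be a' b' m0 (Re vb) phi) with
  (u0 := Re v) (y0 := s * (Im v / PI - k)) as (d1 & Hd1 & Hpos);
  try assumption; try apply Hbe; try lra.
{ rewrite HD, <- HvI. exact HvO. }
{ unfold be, a', k. destruct Hs as [[-> ?]|[-> ?]]; destruct Rlt_dec; lra. }
destruct (Im_small_boundary v (r / 2) HvO ltac:(lra)) as (d2 & Hd2 & Hsm).
exists (r / 2), (Rmin (Rmin d1 d2) 1).
split; [lra|]. split; [repeat apply Rmin_pos; lra|]. intros z Hz Hzv.
pose proof (Rmin_l (Rmin d1 d2) 1). pose proof (Rmin_r (Rmin d1 d2) 1).
pose proof (Rmin_l d1 d2). pose proof (Rmin_r d1 d2).
pose proof (re_le_Cmod (w z - v)) as TR. pose proof (Im_le_Cmod (w z - v)) as TI.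
replace (Re (w z - v)%C) with (Re (w z) - Re v) in TR by (unfold Re; simpl; ring).
replace (Im (w z - v)%C) with (Im (w z) - Im v) in TI by (unfold Im; simpl; ring).
set (y := s * (Im (w z) / PI - k)).
assert (Hphi : 0 < phi (Re (w z)) y).
{ apply Hpos.
  - apply HD. unfold y. rewrite <- HvI. now apply map_Omega.
  - lra.
  - unfold y. replace (s * (Im (w z) / PI - k) - s * (Im v / PI - k)) with
      (s * ((Im (w z) - Im v) * / PI)) by (field; lra).
    rewrite Rabs_mult. destruct Hs1 as [_ ->]. rewrite Rmult_1_l, Rabs_mult.
    rewrite (Rabs_pos_eq (/ PI)) by (apply Rlt_le, Rinv_0_lt_compat, HPI).
    pose proof PI2_1.
    assert (HP1 : / PI < 1) by (rewrite <- Rinv_1; apply Rinv_lt_contravar; lra).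
    pose proof (Rinv_0_lt_compat _ HPI). pose proof (Rabs_pos (Im (w z) - Im v)).
    nra. }
unfold phi, y in Hphi. rewrite <- HvI, map_inv_map in Hphi by exact Hz.
assert (HK : r / 2 < Rabs (Re z - xi)).
{ apply Hfar; [exact Hz| |apply Hsm; [exact Hz|lra]].
  apply Rabs_le_between in TR. intros [Hlt _]. lra. }
rewrite <- (Rmult_1_l (Rabs _)) in HK. destruct Hs1 as [_ Hs1].
rewrite <- Hs1, <- Rabs_mult, (Rabs_pos_eq (s * _)) in HK by lra. lra.
Qed.

(** Near v, Re z stays a fixed distance to one side of xi while Im z tends to 0, which drives the
    argument of z - xi to 0 or to pi. *)
Lemma boundary_arg (xi a b e : R) (v : C) :
  filterlim w (near_real xi) (left_end a b) ->
  - beta <= a -> a < b -> b <= alpha + INR n ->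
  ~ Omega n alpha beta v -> - beta <= Im v / PI <= alpha + INR n -> 0 < e ->
  exists del, 0 < del /\ forall z, upper z -> Cmod (w z - v) < del ->
    (Im v / PI <= a -> Im (Clog_upper (z - RtoC xi)) < e) /\
    (b <= Im v / PI -> PI - e < Im (Clog_upper (z - RtoC xi))).
Proof.
intros Hlim Hba Hab Hbn HvO Hvb He.
assert (K : forall s, (s = 1 /\ Im v / PI <= a) \/ (s = -1 /\ b <= Im v / PI) ->
  exists del, 0 < del /\ forall z, upper z -> Cmod (w z - v) < del ->
    (s = 1 -> Im (Clog_upper (z - RtoC xi)) < e) /\
    (s = -1 -> PI - e < Im (Clog_upper (z - RtoC xi)))).
{ intros s Hs.
  destruct (boundary_sign xi a b s v Hlim Hba Hab Hbn HvO Hvb Hs)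
    as (x0 & d1 & Hx0 & Hd1 & H1).
  destruct (arg_near_axis x0 e Hx0 He) as (d & Hd & Harg).
  destruct (Im_small_boundary v d HvO Hd) as (d2 & Hd2 & H2).
  exists (Rmin d1 d2). split; [now apply Rmin_pos|]. intros z Hz Hzv.
  pose proof (Rmin_l d1 d2). pose proof (Rmin_r d1 d2).
  specialize (H1 z Hz ltac:(lra)). specialize (H2 z Hz ltac:(lra)).
  destruct (Harg (z - RtoC xi)%C) as [A B].
  { unfold upper in Hz. unfold Im in *; simpl. lra. }
  replace (Re (z - RtoC xi)%C) with (Re z - xi) in A, B by (unfold Re; simpl; ring).
  split; intros ->; [apply A|apply B]; lra. }
destruct (Rle_dec (Im v / PI) a) as [H|H].
- destruct (K 1) as (d & Hd & HK); [left; split; [reflexivity|exact H]|].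
  exists d. split; [exact Hd|]. intros z Hz Hzv. split; [|lra].
  intros _. now apply HK.
- destruct (Rle_dec b (Im v / PI)) as [H'|H'].
  + destruct (K (-1)) as (d & Hd & HK); [right; split; [reflexivity|exact H']|].
    exists d. split; [exact Hd|]. intros z Hz Hzv. split; [lra|].
    intros _. now apply HK.
  + exists 1. split; [lra|]. intros z _ _. split; lra.
Qed.
(** This is cosh (k (w - i m)) with m the height of the midline of the strip. The strip has
    half-height L pi / 2, where L = alpha + beta + n, so k = 2 / (3 L) keeps k |Im w - m| below pi /
    3 and the cosine factor of the real part above 1 / 2. *)
Definition barrier (z : C) : C :=
  let k := (2 / (3 * (alpha + beta + INR n)))%R in
  let m := ((alpha + INR n - beta) * PI / 2)%R in
  (RtoC (/ 2) * (Cexp (RtoC k * (w z - RtoC m * Ci)) +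
                 Cexp (RtoC (- k) * (w z - RtoC m * Ci))))%C.

Lemma barrier_cderiv (z : C) : upper z -> exists d, cderiv barrier z d.
Proof.
intro Hz. destruct (map_cderiv z Hz) as [d Hd]. eexists. unfold barrier.
apply cderiv_scal. apply cderiv_plus;
  (apply (cderiv_comp Cexp (fun z => _ * (w z - _))%C); [|apply cderiv_exp]);
  apply cderiv_scal, cderiv_minus; [exact Hd|apply cderiv_const|exact Hd|apply cderiv_const].
Qed.

Lemma cos_ge_half (x : R) : Rabs x <= PI / 3 -> 1 / 2 <= cos x.
Proof.
intro Hx. pose proof PI_RGT_0. rewrite <- cos_PI3.
assert (H0 : cos x = cos (Rabs x)).
{ unfold Rabs. destruct Rcase_abs; [now rewrite cos_neg|reflexivity]. }
rewrite H0. pose proof (Rabs_pos x). apply cos_decr_1; lra.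
Qed.

(** The real part is cosh (k u) cos (k (v - m)); the cosine is at least 1 / 2, and exp x + exp (- x)
    is at least 1 + |x|. *)
Lemma barrier_lower (z : C) : upper z ->
  (1 + 2 / (3 * (alpha + beta + INR n)) * Rabs (Re (w z))) / 4 <= Re (barrier z).
Proof.
intro Hz. pose proof total_width_pos as HL. pose proof PI_RGT_0.
pose proof (map_band z Hz) as Hb.
unfold barrier. set (L := alpha + beta + INR n) in *.
set (k := 2 / (3 * L)). set (m := (alpha + INR n - beta) * PI / 2).
assert (Hk : 0 < k) by (apply Rdiv_lt_0_compat; lra).
set (u := Re (w z)). set (v := Im (w z)) in *.
assert (Hre : Re (RtoC (/ 2) * (Cexp (RtoC k * (w z - RtoC m * Ci)) +
   Cexp (RtoC (- k) * (w z - RtoC m * Ci))))%C =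
   / 2 * (exp (k * u) * cos (k * (v - m)) + exp (- (k * u)) * cos (k * (v - m)))).
{ unfold Cexp, u, v, Re, Im; simpl.
  rewrite <- (cos_neg (k * (snd (w z) - m))) at 2.
  match goal with |- / 2 * (exp ?a * cos ?b + exp ?c * cos ?d) - _ = _ =>
    replace a with (k * fst (w z)) by ring;
    replace b with (k * (snd (w z) - m)) by ring;
    replace c with (- (k * fst (w z))) by ring;
    replace d with (- (k * (snd (w z) - m))) by ring end.
  ring. }
rewrite Hre.
assert (Hcos : 1 / 2 <= cos (k * (v - m))).
{ apply cos_ge_half. rewrite Rabs_mult, (Rabs_pos_eq k) by lra.
  replace (PI / 3) with (k * (L * PI / 2)) by (unfold k; field; lra).
  apply Rmult_le_compat_l; [lra|].
  assert (HLP : L * PI / 2 = (alpha + INR n) * PI - m /\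
    L * PI / 2 = m + beta * PI) by (unfold m, L; split; field).
  apply Rabs_le. lra. }
pose proof (exp_ineq1_le (k * u)) as E1. pose proof (exp_ineq1_le (- (k * u))) as E2.
pose proof (exp_pos (k * u)). pose proof (exp_pos (- (k * u))).
assert (Hsum : 1 + k * Rabs u <= exp (k * u) + exp (- (k * u)))
  by (unfold Rabs; destruct Rcase_abs; lra).
nra.
Qed.

(* A Phragmen-Lindelof maximum principle.  If h minus a multiple of the barrier
   had a positive supremum, it would be attained, and by the mean value property
   it would be attained along a whole vertical ray, where the barrier is
   unbounded. *)
Lemma phragmen_lindelof (h : C -> C) (B : R) :
  (forall z, upper z -> exists d, cderiv h z d) ->
  (forall z, upper z -> Re (h z) <= B) ->
  (forall v e, ~ Omega n alpha beta v -> 0 < e -> exists del, 0 < del /\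
     forall z, upper z -> Cmod (w z - v) < del -> Re (h z) < e) ->
  forall z, upper z -> Re (h z) <= 0.
Proof.
intros Hh HB Hbd z0 Hz0. apply Rnot_lt_le. intro Hpos.
pose proof total_width_pos as HL.
set (k := 2 / (3 * (alpha + beta + INR n))).
assert (Hk : 0 < k) by (apply Rdiv_lt_0_compat; lra).
assert (Hbar : forall z, upper z -> (1 + k * Rabs (Re (w z))) / 4 <= Re (barrier z))
  by (intros z Hz; exact (barrier_lower z Hz)).
assert (Hbar0 : forall z, upper z -> 0 < Re (barrier z)).
{ intros z Hz. specialize (Hbar z Hz). pose proof (Rabs_pos (Re (w z))). nra. }
(* Chosen so that h - eps * barrier still has real part Re (h z0) / 2 > 0 at z0. *)
set (eps := Re (h z0) / (2 * Re (barrier z0))).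
pose proof (Hbar0 z0 Hz0) as Hb0.
assert (Heps : 0 < eps) by (apply Rdiv_lt_0_compat; lra).
set (f := fun z => (h z - RtoC eps * barrier z)%C).
assert (HRef : forall z, Re (f z) = Re (h z) - eps * Re (barrier z)).
{ intro z. unfold f, Re; simpl. ring. }
assert (Hf : forall z, upper z -> exists d, cderiv f z d).
{ intros z Hz. destruct (Hh z Hz) as [d Hd]. destruct (barrier_cderiv z Hz) as [d' Hd'].
  eexists. apply cderiv_minus; [exact Hd|]. apply cderiv_scal, Hd'. }
assert (HfB : forall z, upper z -> Re (f z) <= B).
{ intros z Hz. rewrite HRef. specialize (HB z Hz). specialize (Hbar0 z Hz). nra. }
destruct (completeness (fun x => exists z, upper z /\ x = Re (f z))) as [S [HS1 HS2]].
{ exists B. intros x (z & Hz & ->). now apply HfB. }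
{ exists (Re (f z0)), z0. auto. }
assert (HSle : forall z, upper z -> Re (f z) <= S).
{ intros z Hz. apply HS1. now exists z. }
assert (HS : 0 < S).
{ specialize (HSle z0 Hz0). rewrite HRef in HSle. unfold eps in HSle.
  replace (Re (h z0) / (2 * Re (barrier z0)) * Re (barrier z0)) with
    (Re (h z0) / 2) in HSle by (field; lra). lra. }
assert (Hap : forall e, 0 < e -> exists z, upper z /\ S - e < Re (f z)).
{ intros e He. apply NNPP. intro Hno. specialize (HS2 (S - e)).
  assert (S <= S - e); [|lra]. apply HS2. intros x (z & Hz & ->).
  apply Rnot_lt_le. intro Hlt. apply Hno. now exists z. }
(* Where Re f > 0, the lower bound of the barrier gives eps (1 + k |Re w|) / 4 < B, hence |Re w| <
   U. *)
set (U := 4 * B / (eps * k)).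
assert (HU : forall z, upper z -> 0 < Re (f z) -> Rabs (Re (w z)) < U).
{ intros z Hz Hp. rewrite HRef in Hp. specialize (HB z Hz). specialize (Hbar z Hz).
  assert (Hek : 0 < eps * k) by now apply Rmult_lt_0_compat.
  apply Rmult_lt_reg_l with (eps * k); [exact Hek|].
  unfold U. replace (eps * k * (4 * B / (eps * k))) with (4 * B) by (field; lra).
  nra. }
(* The images of a maximizing sequence stay in a rectangle. A cluster point outside Omega is ruled
   out by [Hbd]; one inside pulls back to a point where the supremum is attained. *)
destruct (cluster_point_C (fun del v => exists z, upper z /\ w z = v /\ S - del < Re (f z))
  (- U) U (- beta * PI) ((alpha + INR n) * PI)) as (v & _ & _ & Hv).
{ intros del del' v Hle (z & H1 & H2 & H3). exists z. repeat split; [exact H1|exact H2|lra]. }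
{ intros del Hdel. pose proof (Rmin_l del S). pose proof (Rmin_r del S).
  destruct (Hap (Rmin del S)) as (z & Hz & Hlt); [now apply Rmin_pos|].
  exists (w z). specialize (HU z Hz ltac:(lra)). apply Rabs_def2 in HU.
  pose proof (map_band z Hz). repeat split; try lra. exists z. repeat split; [exact Hz|lra]. }
assert (HvO : Omega n alpha beta v).
{ apply NNPP. intro HvO. destruct (Hbd v (S / 2) HvO ltac:(lra)) as (del & Hdel & H).
  pose proof (Rmin_l del (S / 2)). pose proof (Rmin_r del (S / 2)).
  destruct (Hv (Rmin del (S / 2))) as (v' & K1 & z & Hz & <- & K2); [apply Rmin_pos; lra|].
  specialize (H z Hz ltac:(lra)). rewrite HRef in K2. specialize (Hbar0 z Hz). nra. }
destruct (map_inv_spec v HvO) as [Hu Hwv]. set (z1 := map_inv v) in *.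
assert (Hmax : Re (f z1) = S).
{ apply Rle_antisym; [now apply HSle|]. apply le_epsilon. intros e He.
  destruct (Hf z1 Hu) as [d Hd].
  destruct (cderiv_cont f z1 d Hd (e / 2) ltac:(lra)) as (t & Ht & Hct).
  destruct (map_inv_cont z1 t Hu Ht) as (rho & Hrho & Hr). rewrite Hwv in Hr.
  pose proof (Rmin_l rho (e / 2)). pose proof (Rmin_r rho (e / 2)).
  destruct (Hv (Rmin rho (e / 2))) as (v' & K1 & z & Hz & <- & K2); [apply Rmin_pos; lra|].
  destruct (Hr (w z) ltac:(lra)) as [_ K3]. rewrite map_inv_map in K3 by exact Hz.
  specialize (Hct z K3). pose proof (re_le_Cmod (f z - f z1)) as T.
  replace (Re (f z - f z1)%C) with (Re (f z) - Re (f z1)) in T by (unfold Re; simpl; ring).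
  apply Rabs_le_between in T. lra. }
(* The disc of radius Im z / 2 stays in the half-plane and its top is 3 / 2 times as high as z. High
   enough, Re w exceeds U, against Re f = S > 0. *)
assert (Hray : forall N, exists z, Im z = (3 / 2) ^ N * Im z1 /\ Re (f z) = S).
{ induction N as [|N (z & Hz & HfS)].
  - exists z1. split; [simpl; ring|exact Hmax].
  - assert (Hzu : 0 < Im z).
    { rewrite Hz. apply Rmult_lt_0_compat; [apply pow_lt; lra|exact Hu]. }
    exists (z + RtoC (Im z / 2) * Ci)%C. split.
    + transitivity (3 / 2 * Im z); [unfold Im; simpl; field|]. rewrite Hz. simpl. ring.
    + assert (Hball : forall y, Cmod (y - z) <= Im z / 2 -> upper y)
        by (intros y Hy; apply (upper_ball z); lra).
      apply Re_max_circle; [lra| | |exact HfS].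
      * intros y Hy. apply Hf, Hball, Hy.
      * intros y Hy. apply HSle, Hball. lra. }
destruct (map_right U) as (r & Hr & Hright).
destruct (Pow_x_infinity (3 / 2) ltac:(rewrite Rabs_pos_eq; lra) (r / Im z1 + 1))
  as [N HN].
specialize (HN N (Nat.le_refl N)).
assert (HpN : 0 < (3 / 2) ^ N) by (apply pow_lt; lra).
rewrite Rabs_pos_eq in HN by lra. unfold upper in Hu.
destruct (Hray N) as (z & Hz & HfS).
assert (HzI : r < Im z).
{ rewrite Hz. replace r with (r / Im z1 * Im z1) at 1 by (field; lra). nra. }
assert (Hzu : upper z) by (unfold upper; lra).
pose proof (Im_le_Cmod z) as T. rewrite Rabs_pos_eq in T by lra.
specialize (Hright z Hzu ltac:(lra)). specialize (HU z Hzu ltac:(lra)).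
apply Rabs_def2 in HU. lra.
Qed.

(** * Boundary values of the arguments and the formula for w *)

Context (xi : nat -> R).
Context (Hxi : forall j : nat, (1 <= j <= n)%nat ->
  filterlim w (near_real (xi j)) (infty_mid n j)).

Lemma limit_at_0 : 0 < alpha ->
  filterlim w (near_real 0) (left_end (INR n) (alpha + INR n)).
Proof.
intro H. destruct Hw as (_ & H0 & _). unfold infty_first in H0.
destruct Req_EM_T; [lra|]. now rewrite Rplus_comm.
Qed.

Lemma limit_at_1 : 0 < beta -> filterlim w (near_real 1) (left_end (- beta) 0).
Proof.
intro H. destruct Hw as (_ & _ & H0 & _). unfold infty_last in H0.
destruct Req_EM_T; [lra|exact H0].
Qed.

Lemma Omega_band (v : C) : ~ (- beta <= Im v / PI <= alpha + INR n) ->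
  exists del, 0 < del /\ forall z, upper z -> del <= Cmod (w z - v).
Proof.
intro Hv. pose proof PI_RGT_0 as HPI.
assert (Hv' : Im v < - beta * PI \/ (alpha + INR n) * PI < Im v).
{ apply NNPP. intro H. apply Hv.
  split; (apply Rmult_le_reg_r with PI; [exact HPI|]);
    replace (Im v / PI * PI) with (Im v) by (field; lra); lra. }
exists (if Rlt_dec (Im v) (- beta * PI) then - beta * PI - Im v
        else Im v - (alpha + INR n) * PI).
split; [destruct Rlt_dec; lra|]. intros z Hz. pose proof (map_band z Hz).
pose proof (Im_le_Cmod (w z - v)) as T.
replace (Im (w z - v)%C) with (Im (w z) - Im v) in T by (unfold Im; simpl; ring).
apply Rabs_le_between in T. destruct Rlt_dec; lra.
Qed.

(** The strip of infinity_j lies between the levels n - j and n - j + 1. For v at level k, the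
    arguments with j > n - k tend to pi and the others to 0; truncated subtraction counts the former
    among the first m. *)
Lemma boundary_log_sum (v : C) (k m : nat) (e : R) :
  ~ Omega n alpha beta v -> - beta <= Im v / PI <= alpha + INR n ->
  (k <= n)%nat ->
  (forall j, (1 <= j <= n)%nat ->
     ((j <= n - k)%nat -> Im v / PI <= INR n - INR j) /\
     ((n - k < j)%nat -> INR n - INR j + 1 <= Im v / PI)) ->
  (m <= n)%nat -> 0 < e ->
  exists del, 0 < del /\ forall z, upper z -> Cmod (w z - v) < del ->
    Rabs (Im (log_sum xi m z) - INR (m - (n - k)) * PI) < e.
Proof.
intros HvO Hvb Hk Hlev. revert e. induction m as [|m IH]; intros e Hm He.
- exists 1. split; [lra|]. intros z _ _. unfold Im; simpl.
  rewrite Rmult_0_l, Rminus_0_r, Rabs_R0. exact He.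
- destruct (IH (e / 2) ltac:(lia) ltac:(lra)) as (d1 & Hd1 & H1).
  destruct (Hlev (S m) ltac:(lia)) as [Hl1 Hl2].
  assert (Hmn : INR (S m) <= INR n) by now apply le_INR.
  assert (Hm1 : 1 <= INR (S m)) by (rewrite S_INR; pose proof (pos_INR m); lra).
  destruct (boundary_arg (xi (S m)) (INR n - INR (S m)) (INR n - INR (S m) + 1) (e / 2) v)
    as (d2 & Hd2 & H2); try lra; try assumption.
  { apply Hxi. lia. }
  exists (Rmin d1 d2). split; [now apply Rmin_pos|]. intros z Hz Hzv.
  pose proof (Rmin_l d1 d2). pose proof (Rmin_r d1 d2).
  specialize (H1 z Hz ltac:(lra)). destruct (H2 z Hz ltac:(lra)) as [A B].
  pose proof (arg_bounds _ (upper_shift z (xi (S m)) Hz)) as Hab.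
  change (Im (log_sum xi (S m) z)) with
    (Im (log_sum xi m z) + Im (Clog_upper (z - RtoC (xi (S m))))).
  apply Rabs_def2 in H1.
  destruct (Nat.le_gt_cases (S m) (n - k)) as [Hc1|Hc1].
  + replace (S m - (n - k))%nat with 0%nat by lia.
    replace (m - (n - k))%nat with 0%nat in H1 by lia. simpl INR in *.
    specialize (A (Hl1 Hc1)). apply Rabs_def1; lra.
  + replace (S m - (n - k))%nat with (S (m - (n - k))) by lia.
    rewrite S_INR. specialize (B (Hl2 Hc1)). apply Rabs_def1; lra.
Qed.

(** Used for the points 0 and 1 with weights alpha and beta. A zero weight has no strip attached to
    it, but then the term vanishes. *)
Lemma boundary_weighted_arg (x a b t q e : R) (v : C) :
  0 <= q -> (0 < q -> filterlim w (near_real x) (left_end a b)) ->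
  - beta <= a -> (0 < q -> a < b) -> b <= alpha + INR n ->
  ~ Omega n alpha beta v -> - beta <= Im v / PI <= alpha + INR n ->
  (Im v / PI <= a /\ t = 0) \/ (b <= Im v / PI /\ t = PI) -> 0 < e ->
  exists del, 0 < del /\ forall z, upper z -> Cmod (w z - v) < del ->
    Rabs (q * Im (Clog_upper (z - RtoC x)) - q * t) < e.
Proof.
intros Hq Hlim Ha Hab Hb HvO Hvb Ht He.
destruct (Rle_lt_or_eq_dec 0 q Hq) as [Hq0|<-].
- assert (Heq : 0 < e / q) by now apply Rdiv_lt_0_compat.
  destruct (boundary_arg x a b (e / q) v) as (d & Hd & H); try assumption; try tauto.
  exists d. split; [exact Hd|]. intros z Hz Hzv. destruct (H z Hz Hzv) as [A B].
  pose proof (arg_bounds _ (upper_shift z x Hz)) as Hab'.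
  rewrite <- Rmult_minus_distr_l, Rabs_mult, (Rabs_pos_eq q Hq).
  replace e with (q * (e / q)) by (field; lra). apply Rmult_lt_compat_l; [exact Hq0|].
  destruct Ht as [[Ht ->]|[Ht ->]].
  + specialize (A Ht). apply Rabs_def1; lra.
  + specialize (B Ht). apply Rabs_def1; lra.
- exists 1. split; [lra|]. intros z _ _.
  rewrite !Rmult_0_l, Rminus_0_r, Rabs_R0. exact He.
Qed.

(** Lower edge, upper edge and slit k are brought to one form: t0 and t1 are the limiting arguments
    of z and z - 1, and k is the number of roots whose argument tends to pi. *)
Lemma boundary_levels (v : C) :
  ~ Omega n alpha beta v -> - beta <= Im v / PI <= alpha + INR n ->
  exists (k : nat) (t0 t1 : R), (k <= n)%nat /\
    (forall j, (1 <= j <= n)%nat ->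
       ((j <= n - k)%nat -> Im v / PI <= INR n - INR j) /\
       ((n - k < j)%nat -> INR n - INR j + 1 <= Im v / PI)) /\
    ((Im v / PI <= INR n /\ t0 = 0) \/ (alpha + INR n <= Im v / PI /\ t0 = PI)) /\
    ((Im v / PI <= - beta /\ t1 = 0) \/ (0 <= Im v / PI /\ t1 = PI)) /\
    Im v = alpha * t0 + beta * (t1 - PI) + INR k * PI.
Proof.
intros HvO Hvb. pose proof PI_RGT_0 as HPI. pose proof (pos_INR n) as Hn0.
assert (Hv : Im v = Im v / PI * PI) by (field; lra).
set (y := Im v / PI) in *. rewrite Hv.
destruct (Req_dec y (- beta)) as [H1|H1].
{ exists 0%nat, 0, 0. rewrite H1. split; [lia|]. split.
  { intros j Hj. split; [|lia]. intros _.
    assert (INR j <= INR n) by (apply le_INR; lia). lra. }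
  split; [left; lra|]. split; [left; lra|]. simpl. ring. }
destruct (Req_dec y (alpha + INR n)) as [H2|H2].
{ exists n, PI, PI. rewrite H2. split; [lia|]. split.
  { intros j Hj. split; [lia|]. intros _.
    assert (1 <= INR j) by (apply (le_INR 1); lia). lra. }
  split; [right; lra|]. split; [right; lra|]. ring. }
assert (Hs : exists j, (j <= n)%nat /\ y = INR j /\ Re v <= 0).
{ apply NNPP. intro H. apply HvO. split; [fold y; lra|exact H]. }
destruct Hs as (k & Hk & Hy & _). exists k, 0, PI. rewrite Hy.
split; [exact Hk|]. split.
{ intros j Hj. split; intro Hjk.
  - assert (INR (j + k) <= INR n) by (apply le_INR; lia). rewrite plus_INR in *. lra.
  - assert (INR (S n) <= INR (j + k)) by (apply le_INR; lia).
    rewrite S_INR, plus_INR in *. lra. }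
split; [left; split; [now apply le_INR|reflexivity]|].
split; [right; split; [apply pos_INR|reflexivity]|]. ring.
Qed.

Lemma boundary_Im_log_product (v : C) (e : R) :
  ~ Omega n alpha beta v -> 0 < e -> exists del, 0 < del /\
  forall z, upper z -> Cmod (w z - v) < del ->
    Rabs (Im (w z) - Im (log_product n alpha beta c xi z)) < e.
Proof.
intros HvO He.
destruct (classic (- beta <= Im v / PI <= alpha + INR n)) as [Hvb|Hvb].
2:{ destruct (Omega_band v Hvb) as (d & Hd & H). exists d. split; [exact Hd|].
  intros z Hz Hzv. specialize (H z Hz). lra. }
destruct (boundary_levels v HvO Hvb) as (k & t0 & t1 & Hk & Hlev & Ht0 & Ht1 & Hv).
pose proof (pos_INR n) as Hn0.
destruct (boundary_log_sum v k n (e / 4) HvO Hvb Hk Hlev (Nat.le_refl n) ltac:(lra))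
  as (d1 & Hd1 & H1).
replace (n - (n - k))%nat with k in H1 by lia.
destruct (boundary_weighted_arg 0 (INR n) (alpha + INR n) t0 alpha (e / 4) v)
  as (d2 & Hd2 & H2); try assumption; try lra; [exact limit_at_0|].
destruct (boundary_weighted_arg 1 (- beta) 0 t1 beta (e / 4) v)
  as (d3 & Hd3 & H3); try assumption; try lra; [exact limit_at_1|].
set (d := Rmin (Rmin d1 d2) (Rmin d3 (e / 4))).
assert (Hd : 0 < d) by (unfold d; repeat apply Rmin_pos; lra).
assert (Hd' : d <= d1 /\ d <= d2 /\ d <= d3 /\ d <= e / 4)
  by (unfold d, Rmin; repeat destruct Rle_dec; lra).
exists d. split; [exact Hd|]. intros z Hz Hzv.
specialize (H1 z Hz ltac:(lra)). specialize (H2 z Hz ltac:(lra)).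
specialize (H3 z Hz ltac:(lra)).
replace (z - RtoC 0)%C with z in H2 by ring.
rewrite Im_log_product.
pose proof (Im_le_Cmod (w z - v)) as T.
replace (Im (w z - v)%C) with (Im (w z) - Im v) in T by (unfold Im; simpl; ring).
apply Rabs_le_between in T. apply Rabs_def2 in H1. apply Rabs_def2 in H2.
apply Rabs_def2 in H3. apply Rabs_def1; lra.
Qed.

Lemma Im_map (z : C) : upper z -> Im (w z) = Im (log_product n alpha beta c xi z).
Proof.
intro Hz.
set (f := fun z => (w z - log_product n alpha beta c xi z)%C).
assert (Hf : forall z, upper z -> exists d, cderiv f z d).
{ intros y Hy. destruct (map_cderiv y Hy) as [d Hd].
  destruct (log_product_cderiv n alpha beta c xi y Hy) as [d' Hd'].
  eexists. exact (cderiv_minus _ _ _ _ _ Hd Hd'). }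
assert (HIm : forall z, Im (f z) = Im (w z) - Im (log_product n alpha beta c xi z))
  by (intro y; unfold f, Im; simpl; ring).
pose proof PI_RGT_0 as HPI.
set (L := alpha + beta + INR n).
assert (HB : forall z, upper z -> Rabs (Im (f z)) <= 2 * L * PI).
{ intros y Hy. rewrite HIm, Im_log_product.
  pose proof (map_band y Hy). pose proof (log_sum_Im_bounds xi n y Hy).
  pose proof (arg_bounds y Hy). pose proof (arg_bounds _ (upper_shift y 1 Hy)).
  pose proof (pos_INR n).
  assert (0 <= alpha * Im (Clog_upper y) <= alpha * PI)
    by (split; [apply Rmult_le_pos|apply Rmult_le_compat_l]; lra).
  assert (0 <= beta * (PI - Im (Clog_upper (y - RtoC 1))) <= beta * PI)
    by (split; [apply Rmult_le_pos|apply Rmult_le_compat_l]; lra).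
  unfold L. apply Rabs_le. lra. }
(* The real part of - s i f is s Im f; the maximum principle for s = 1 and s = -1 gives both
   inequalities. *)
assert (K : forall s, s * s = 1 -> s * Im (f z) <= 0).
{ intros s Hs.
  assert (HsI : forall y, Re (RtoC (- s) * Ci * f y)%C = s * Im (f y))
    by (intro y; unfold Re, Im; simpl; ring).
  assert (Hs1 : Rabs s = 1).
  { pose proof (Rabs_pos s). apply (f_equal Rabs) in Hs.
    rewrite Rabs_mult, Rabs_R1 in Hs. nra. }
  rewrite <- HsI.
  apply (phragmen_lindelof (fun y => RtoC (- s) * Ci * f y)%C (2 * L * PI)); [| | |exact Hz].
  - intros y Hy. destruct (Hf y Hy) as [d Hd]. eexists. apply cderiv_scal, Hd.
  - intros y Hy. rewrite HsI. specialize (HB y Hy). pose proof (Rle_abs (s * Im (f y))) as T.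
    rewrite Rabs_mult, Hs1 in T. lra.
  - intros v e Hv He. destruct (boundary_Im_log_product v e Hv He) as (d & Hd & H).
    exists d. split; [exact Hd|]. intros y Hy Hyv. rewrite HsI.
    specialize (H y Hy Hyv). rewrite <- HIm in H. pose proof (Rle_abs (s * Im (f y))) as T.
    rewrite Rabs_mult, Hs1 in T. lra. }
pose proof (K 1 ltac:(ring)) as K1. pose proof (K (-1) ltac:(ring)) as K2.
rewrite HIm in K1, K2. lra.
Qed.

(** By the Cauchy-Riemann equations the gradient of the real part vanishes; the half-plane is
    convex, so the mean value theorem applies on the segment from z1 to z2. *)
Lemma real_valued_const (f : C -> C) :
  (forall z, upper z -> exists d, cderiv f z d) ->
  (forall z, upper z -> Im (f z) = 0) ->
  forall z1 z2, upper z1 -> upper z2 -> Re (f z1) = Re (f z2).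
Proof.
intros Hf HIm.
assert (Hd : forall x y, 0 < y -> differentiable_pt_lim (fun u v => Re (f (u, v))) x y 0 0).
{ intros x y Hy. assert (Hu : upper (x, y)) by exact Hy.
  destruct (Hf _ Hu) as [d Hd]. destruct (cderiv_differentiable f x y d Hd) as [D1 D2].
  assert (D3 : differentiable_pt_lim (fun _ _ => 0) x y (Im d) (Re d)).
  { apply differentiable_pt_lim_ext with (2 := D2). exists (mkposreal y Hy).
    intros u v _ Hv. simpl in Hv. apply Rabs_def2 in Hv.
    apply HIm. unfold upper, Im; simpl. lra. }
  apply differentiable_pt_lim_unique in D3. rewrite !Derive_const in D3.
  destruct D3 as [E1 E2]. rewrite <- E1, <- E2, Ropp_0 in D1. exact D1. }
intros [x1 y1] [x2 y2] H1 H2. unfold upper, Im in H1, H2; simpl in H1, H2.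
set (p := fun t => Re (f (x1 + t * (x2 - x1), y1 + t * (y2 - y1)))).
assert (Hp : forall t, 0 <= t <= 1 -> derivable_pt_lim p t 0).
{ intros t Ht.
  replace 0 with (0 * (x2 - x1) + 0 * (y2 - y1)) by ring.
  apply (derivable_pt_lim_comp_2d (fun u v => Re (f (u, v)))
    (fun t => x1 + t * (x2 - x1)) (fun t => y1 + t * (y2 - y1))).
  - apply Hd. nra.
  - apply is_derive_Reals. auto_derive; [exact I|ring].
  - apply is_derive_Reals. auto_derive; [exact I|ring]. }
destruct (MVT_cor2 p (fun _ => 0) 0 1 Rlt_0_1 Hp) as (t & Ht & _).
assert (E : forall a b, a + 0 * (b - a) = a /\ a + 1 * (b - a) = b)
  by (intros; split; ring).
unfold p in Ht. rewrite !(proj1 (E _ _)), !(proj2 (E _ _)) in Ht. lra.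
Qed.

Lemma map_formula (z : C) : upper z -> w z = log_product n alpha beta c xi z.
Proof.
intro Hz.
set (f := fun z => (w z - log_product n alpha beta c xi z)%C).
assert (Hconst : forall z1 z2, upper z1 -> upper z2 -> Re (f z1) = Re (f z2)).
{ apply real_valued_const.
  - intros y Hy. destruct (map_cderiv y Hy) as [d Hd].
    destruct (log_product_cderiv n alpha beta c xi y Hy) as [d' Hd'].
    eexists. exact (cderiv_minus _ _ _ _ _ Hd Hd').
  - intros y Hy. transitivity (Im (w y) - Im (log_product n alpha beta c xi y)).
    + reflexivity.
    + rewrite Im_map by exact Hy. apply Rminus_diag. }
assert (H0 : Re (f z) = 0).
{ apply NNPP. intro Hne. apply Rabs_pos_lt in Hne.
  destruct asymptotics as (k & m & Hk & Hm & Has).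
  (* High on the imaginary axis, the asymptotics and the sum of logarithms each contribute less than
     e and the factor at 1 at most beta e, in total less than (3 + beta) e. *)
  set (e := Rabs (Re (f z)) / (3 + beta)).
  assert (He : 0 < e) by (apply Rdiv_lt_0_compat; lra).
  destruct (ln_Cmod_vertical 1 e He) as (m1 & Hm1 & H1).
  destruct (log_sum_vertical xi n e He) as (m2 & Hm2 & H2).
  set (y := Rmax (Rmax m m1) (Rmax m2 (k / e)) + 1).
  assert (Hy : m < y /\ m1 < y /\ m2 < y /\ k / e < y)
    by (unfold y, Rmax; repeat destruct Rle_dec; lra).
  assert (Hu : upper (0, y)) by (unfold upper, Im; simpl; lra).
  assert (HC : Cmod (0, y) = y).
  { unfold Cmod; simpl. replace (0 * (0 * 1) + y * (y * 1)) with (y * y) by ring.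
    apply sqrt_square. lra. }
  specialize (H1 y ltac:(lra)). specialize (H2 y ltac:(lra)).
  destruct (Has (0, y) Hu ltac:(lra)) as [A _]. rewrite HC in A.
  assert (Hky : k / y < e).
  { apply Rmult_lt_reg_r with y; [lra|]. unfold Rdiv.
    rewrite Rmult_assoc, Rinv_l, Rmult_1_r by lra.
    replace k with (e * (k / e)) by (field; lra). apply Rmult_lt_compat_l; lra. }
  assert (HRe : Re (f z) = Re (w (0, y)) - Re (log_product n alpha beta c xi (0, y))).
  { rewrite (Hconst z (0, y) Hz Hu). unfold f, Re; simpl. ring. }
  rewrite Re_log_product, HC in HRe.
  set (l1 := ln (Cmod ((0, y) - RtoC 1))) in *.
  apply Rabs_def2 in H1. apply Rabs_def2 in H2. apply Rabs_le_between in A.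
  assert (Hb1 : Rabs (beta * (l1 - ln y)) <= beta * e).
  { rewrite Rabs_mult, (Rabs_pos_eq beta) by exact Hbeta.
    apply Rmult_le_compat_l; [exact Hbeta|]. apply Rabs_le. lra. }
  apply Rabs_le_between in Hb1.
  assert (Hlt : Rabs (Re (f z)) < (3 + beta) * e)
    by (rewrite HRe; apply Rabs_def1; lra).
  unfold e in Hlt. replace ((3 + beta) * (Rabs (Re (f z)) / (3 + beta))) with
    (Rabs (Re (f z))) in Hlt by (field; lra). lra. }
apply injective_projections; [|exact (Im_map z Hz)].
apply Rminus_diag_uniq. exact H0.
Qed.

(** * Boundary values at real points and the tips of the slits *)

Let reg := regular n alpha beta xi.
Let G := log_product n alpha beta c xi.

Lemma near_real_filterlim (t : R) (F : (C -> Prop) -> Prop) :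
  filterlim w (near_real t) F <->
  forall P, F P -> exists d, 0 < d /\ forall z, upper z -> Cmod (z - RtoC t) < d -> P (w z).
Proof.
split; intros H P HP.
- specialize (H P HP). apply locally_C_ball in H. destruct H as (d & Hd & H).
  exists d. split; [exact Hd|]. intros z Hz Hzt. now apply H.
- apply locally_C_ball. destruct (H P HP) as (d & Hd & H').
  exists d. split; [exact Hd|]. intros z Hzt Hz. now apply H'.
Qed.

Lemma map_limit (t e : R) : reg t -> 0 < e ->
  exists d, 0 < d /\ forall z, upper z -> Cmod (z - RtoC t) < d ->
    Cmod (w z - G (RtoC t)) < e.
Proof.
intros Ht He. destruct (log_product_continuous n alpha beta c xi t Ht e He) as (d & Hd & H).
exists d. split; [exact Hd|]. intros z Hz Hzt. rewrite map_formula by exact Hz.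
now apply H.
Qed.

Lemma map_boundary_eq (t : R) :
  exp_boundary_eq w t (cweight alpha beta t * RtoC (exp c) * RtoC (Jtilde n xi t))%C.
Proof.
destruct (classic (reg t)) as [Ht|Ht].
- exists (BFinite (G (RtoC t))). split; [|exact (Cexp_log_product n alpha beta c xi t Ht)].
  apply near_real_filterlim. intros P HP. apply locally_C_ball in HP.
  destruct HP as (e & He & HP). destruct (map_limit t e Ht He) as (d & Hd & H).
  exists d. split; [exact Hd|]. intros z Hz Hzt. apply HP. now apply H.
- exists BMinusInfty. split.
  + intros P [m HP]. apply locally_C_ball.
    destruct (log_product_singular n alpha beta c xi t Halpha Hbeta Ht m) as (d & Hd & H).
    exists d. split; [exact Hd|]. intros z Hzt Hz. apply HP.
    rewrite map_formula by exact Hz. now apply H.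
  + symmetry. apply (irregular_zero n alpha beta xi t Ht Halpha Hbeta).
Qed.

Lemma upper_near_real (t e : R) : 0 < e ->
  exists z, upper z /\ Im z < e /\ Cmod (z - RtoC t) < e.
Proof.
intro He. exists (t, e / 2). split; [unfold upper, Im; simpl; lra|].
split; [unfold Im; simpl; lra|]. eapply Rle_lt_trans; [apply Cmod_le_Re_Im|].
unfold Re, Im; simpl. rewrite Rplus_opp_r, Rabs_R0, (Rabs_pos_eq (e / 2 + - 0)); lra.
Qed.

Lemma boundary_value_not_Omega (t : R) : reg t -> ~ Omega n alpha beta (G (RtoC t)).
Proof.
intro Ht. apply not_Omega_of_cluster. intros e He.
destruct (map_limit t e Ht He) as (d & Hd & H).
destruct (upper_near_real t (Rmin d e)) as (z & Hz & H1 & H2); [now apply Rmin_pos|].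
pose proof (Rmin_l d e). pose proof (Rmin_r d e).
exists z. split; [exact Hz|]. split; [lra|]. apply H; [exact Hz|lra].
Qed.

Lemma limit_value (t : R) (v : C) : reg t ->
  filterlim w (near_real t) (@locally C_UniformSpace v) -> G (RtoC t) = v.
Proof.
intros Ht Hv. apply Cmod_small_eq. intros e He.
destruct (map_limit t (e / 2) Ht ltac:(lra)) as (d & Hd & H).
destruct (proj1 (near_real_filterlim t _) Hv (fun y => Cmod (y - v) < e / 2))
  as (d' & Hd' & H').
{ apply locally_C_ball. exists (e / 2). split; [lra|auto]. }
destruct (upper_near_real t (Rmin d d')) as (z & Hz & _ & Hzt); [now apply Rmin_pos|].
pose proof (Rmin_l d d'). pose proof (Rmin_r d d').
apply Cmod_sum_lt with (w z).
- rewrite Cmod_minus_sym. apply H; [exact Hz|lra].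
- apply H'; [exact Hz|lra].
Qed.

Lemma end_value_0 : alpha = 0 ->
  filterlim w (near_real 0) (@locally C_UniformSpace (0, INR n * PI)).
Proof.
intro H. destruct Hw as (_ & H0 & _). unfold infty_first in H0.
destruct Req_EM_T; [|lra]. now rewrite (Rmult_comm (INR n) PI).
Qed.

Lemma end_value_1 : beta = 0 ->
  filterlim w (near_real 1) (@locally C_UniformSpace (0, INR 0 * PI)).
Proof.
intro H. destruct Hw as (_ & _ & H0 & _). unfold infty_last in H0.
destruct Req_EM_T; [|lra]. simpl INR. now rewrite Rmult_0_l.
Qed.

Lemma tip_not_Omega (k : nat) : (k <= n)%nat -> ~ Omega n alpha beta (0, INR k * PI).
Proof.
intros Hk [_ H]. apply H. exists k. pose proof PI_RGT_0.
split; [exact Hk|]. unfold Im, Re; simpl. split; [field; lra|lra].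
Qed.

Lemma Omega_right_of_tip (k : nat) (s : R) : - beta < INR k < alpha + INR n -> 0 < s ->
  Omega n alpha beta (s, INR k * PI).
Proof.
intros Hk Hs. pose proof PI_RGT_0. unfold Omega, Im, Re; simpl.
replace (INR k * PI / PI) with (INR k) by (field; lra).
split; [exact Hk|]. intros (j & _ & _ & Hle). lra.
Qed.

Lemma map_near_tip (k : nat) (e : R) : - beta < INR k < alpha + INR n -> 0 < e ->
  exists z, upper z /\ Cmod (w z - (0, (INR k * PI)%R)) < e.
Proof.
intros Hk He.
destruct (map_inv_spec _ (Omega_right_of_tip k (e / 2) Hk ltac:(lra))) as [Hz Hwz].
exists (map_inv (e / 2, INR k * PI)). split; [exact Hz|]. rewrite Hwz.
eapply Rle_lt_trans; [apply Cmod_le_Re_Im|]. unfold Re, Im; simpl.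
rewrite Rplus_opp_r, Rabs_R0, Ropp_0, Rplus_0_r, Rabs_pos_eq; lra.
Qed.

Lemma map_near_end (t : R) (v : C) (d e : R) : 0 < d -> 0 < e ->
  filterlim w (near_real t) (@locally C_UniformSpace v) ->
  exists z, upper z /\ Cmod (w z - v) < d /\ Rabs (Re z - t) < e.
Proof.
intros Hd He Hv.
destruct (proj1 (near_real_filterlim t _) Hv (fun y => Cmod (y - v) < d)) as (d' & Hd' & H').
{ apply locally_C_ball. exists d. auto. }
destruct (upper_near_real t (Rmin e d')) as (z & Hz & _ & Hzt); [now apply Rmin_pos|].
pose proof (Rmin_l e d'). pose proof (Rmin_r e d').
exists z. split; [exact Hz|]. split; [apply H'; [exact Hz|lra]|].
pose proof (re_le_Cmod (z - RtoC t)) as T.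
replace (Re (z - RtoC t)%C) with (Re z - t) in T by (unfold Re; simpl; ring). lra.
Qed.

(** For images near the tip of slit n, z is to the left of xi j, whose strip is below, and to the
    right of 0, whose strip is above. Such z exist, so 0 < xi j. If alpha = 0, this tip is itself
    the limit at 0. The tip of slit 0 gives xi j < 1 in the same way. *)
Lemma roots_in_unit_interval (j : nat) : (1 <= j <= n)%nat -> 0 < xi j < 1.
Proof.
intro Hj. pose proof PI_RGT_0 as HPI.
assert (Hj1 : 1 <= INR j) by (apply (le_INR 1); lia).
assert (Hjn : INR j <= INR n) by (apply le_INR; lia).
assert (Hlev : forall k : nat, Im (0, INR k * PI) / PI = INR k)
  by (intro k; unfold Im; simpl; field; lra).
split.
- assert (Hv := tip_not_Omega n (Nat.le_refl n)).
  destruct (boundary_sign (xi j) (INR n - INR j) (INR n - INR j + 1) (-1) (0, INR n * PI))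
    as (e & d & He & Hd & H);
    [now apply Hxi|lra|lra|lra|exact Hv|rewrite Hlev; lra|right; rewrite Hlev; lra|].
  destruct (Rle_lt_or_eq_dec 0 alpha Halpha) as [Ha|Ha].
  + destruct (boundary_sign 0 (INR n) (alpha + INR n) 1 (0, INR n * PI))
      as (e' & d' & He' & Hd' & H');
      [now apply limit_at_0|lra|lra|lra|exact Hv|rewrite Hlev; lra|left; rewrite Hlev; lra|].
    destruct (map_near_tip n (Rmin d d')) as (z & Hz & Hzw); [lra|now apply Rmin_pos|].
    pose proof (Rmin_l d d'). pose proof (Rmin_r d d').
    specialize (H z Hz ltac:(lra)). specialize (H' z Hz ltac:(lra)). lra.
  + destruct (map_near_end 0 _ d e Hd He (end_value_0 (eq_sym Ha))) as (z & Hz & Hzw & Hz0).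
    specialize (H z Hz Hzw). apply Rabs_def2 in Hz0. lra.
- assert (Hv := tip_not_Omega 0 (Nat.le_0_l n)).
  destruct (boundary_sign (xi j) (INR n - INR j) (INR n - INR j + 1) 1 (0, INR 0 * PI))
    as (e & d & He & Hd & H);
    [now apply Hxi|lra|lra|lra|exact Hv|rewrite Hlev; simpl; lra
    |left; rewrite Hlev; simpl; lra|].
  destruct (Rle_lt_or_eq_dec 0 beta Hbeta) as [Hb|Hb].
  + destruct (boundary_sign 1 (- beta) 0 (-1) (0, INR 0 * PI))
      as (e' & d' & He' & Hd' & H');
      [now apply limit_at_1|lra|lra|lra|exact Hv|rewrite Hlev; simpl; lra
      |right; rewrite Hlev; simpl; lra|].
    destruct (map_near_tip 0 (Rmin d d')) as (z & Hz & Hzw); [simpl; lra|now apply Rmin_pos|].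
    pose proof (Rmin_l d d'). pose proof (Rmin_r d d').
    specialize (H z Hz ltac:(lra)). specialize (H' z Hz ltac:(lra)). lra.
  + destruct (map_near_end 1 _ d e Hd He (end_value_1 (eq_sym Hb))) as (z & Hz & Hzw & Hz0).
    specialize (H z Hz Hzw). apply Rabs_def2 in Hz0. lra.
Qed.

Lemma regular_0 : alpha = 0 -> reg 0.
Proof.
intro H. split; [now left|]. split; [right; lra|]. intros j Hj.
pose proof (roots_in_unit_interval j Hj). lra.
Qed.

Lemma regular_1 : beta = 0 -> reg 1.
Proof.
intro H. split; [right; lra|]. split; [now left|]. intros j Hj.
pose proof (roots_in_unit_interval j Hj). lra.
Qed.

Lemma Im_boundary_value (t : R) : reg t -> 0 <= t <= 1 ->
  Im (G (RtoC t)) = INR (roots_above xi n t) * PI.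
Proof.
intros Ht Ht01. unfold G. rewrite Im_log_product_real by exact Ht.
destruct (Rlt_dec t 0); [lra|]. destruct (Rlt_dec 1 t); [lra|]. ring.
Qed.

(** The tip is approached from its right along the line of the slit. The preimages are bounded by
    [map_right], and a cluster point of them is real because the tip is not in Omega. *)
Lemma tip_attained_inside (k : nat) : (k <= n)%nat -> - beta < INR k < alpha + INR n ->
  exists t, 0 <= t <= 1 /\ reg t /\ G (RtoC t) = (0, INR k * PI).
Proof.
intros Hk Hk'. pose proof PI_RGT_0 as HPI.
destruct (map_right 1) as (r & Hr & Hright).
destruct (cluster_point_C
  (fun del z => upper z /\ exists s, 0 < s < del /\ w z = (s, INR k * PI)) (- r) r 0 r)
  as (z & _ & Hz & Hcl).
- intros del del' z Hle (Hz & s & Hs & Hwz). split; [exact Hz|]. exists s. split; [lra|exact Hwz].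
- intros del Hdel. set (s := Rmin (del / 2) 1).
  assert (Hs : 0 < s < del /\ s <= 1).
  { pose proof (Rmin_l (del / 2) 1). pose proof (Rmin_r (del / 2) 1).
    assert (0 < s) by (apply Rmin_pos; lra). fold s in H, H0. lra. }
  destruct (map_inv_spec _ (Omega_right_of_tip k s Hk' ltac:(lra))) as [Hz Hwz].
  set (z := map_inv (s, INR k * PI)) in *. exists z.
  assert (Hzr : Cmod z <= r).
  { apply Rnot_lt_le. intro Hlt. specialize (Hright z Hz Hlt). rewrite Hwz in Hright.
    unfold Re in Hright; simpl in Hright. lra. }
  pose proof (re_le_Cmod z) as A. pose proof (Im_le_Cmod z) as B.
  apply Rabs_le_between in A. apply Rabs_le_between in B. unfold upper in Hz.
  repeat split; try lra; try exact Hz. exists s. split; [lra|exact Hwz].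
- assert (Hcl' : forall e, 0 < e -> exists z', upper z' /\ Cmod (z' - z) < e /\
    0 < Re (w z') /\ Cmod (w z' - (0, (INR k * PI)%R)) < e).
  { intros e He. destruct (Hcl e He) as (z' & H1 & Hz' & s & Hs & Hwz).
    exists z'. rewrite Hwz. split; [exact Hz'|]. split; [exact H1|].
    split; [unfold Re; simpl; lra|].
    eapply Rle_lt_trans; [apply Cmod_le_Re_Im|]. unfold Re, Im; simpl.
    rewrite Rplus_opp_r, Rabs_R0, Ropp_0, Rplus_0_r, Rabs_pos_eq; lra. }
  assert (Hz0 : Im z = 0).
  { apply Rle_antisym; [|lra]. apply Rnot_lt_le. intro Hu.
    apply (tip_not_Omega k Hk). rewrite <- (Cmod_small_eq (w z)); [now apply map_Omega|].
    intros e He. destruct (map_cont z (e / 2) Hu ltac:(lra)) as (d & Hd & H).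
    destruct (Hcl' (Rmin d (e / 2))) as (z' & _ & H1 & _ & H2); [apply Rmin_pos; lra|].
    pose proof (Rmin_l d (e / 2)). pose proof (Rmin_r d (e / 2)).
    apply Cmod_sum_lt with (w z'); [|lra]. rewrite Cmod_minus_sym. apply H. lra. }
  assert (Hzt : z = RtoC (Re z)) by (destruct z; unfold Im in Hz0; simpl in *; now subst).
  set (t := Re z) in *. rewrite Hzt in Hcl'.
  (* Near a singular point Re w would be negative, whereas it is positive along the approach. *)
  assert (Ht : reg t).
  { apply NNPP. intro Ht.
    destruct (log_product_singular n alpha beta c xi t Halpha Hbeta Ht 0) as (d & Hd & H).
    destruct (Hcl' d Hd) as (z' & Hz' & H1 & H2 & _). specialize (H z' Hz' H1).
    rewrite <- map_formula in H by exact Hz'. lra. }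
  assert (HG : G (RtoC t) = (0, INR k * PI)).
  { apply Cmod_small_eq. intros e He.
    destruct (map_limit t (e / 2) Ht ltac:(lra)) as (d & Hd & H).
    destruct (Hcl' (Rmin d (e / 2))) as (z' & Hz' & H1 & _ & H2); [apply Rmin_pos; lra|].
    pose proof (Rmin_l d (e / 2)). pose proof (Rmin_r d (e / 2)).
    apply Cmod_sum_lt with (w z'); [|lra]. rewrite Cmod_minus_sym.
    apply H; [exact Hz'|lra]. }
  exists t. split; [|split; [exact Ht|exact HG]].
  assert (HI : ((if Rlt_dec t 0 then alpha else 0) - (if Rlt_dec 1 t then beta else 0) +
     INR (roots_above xi n t)) * PI = INR k * PI).
  { rewrite <- (Im_log_product_real n alpha beta c xi t Ht). fold G. now rewrite HG. }
  apply Rmult_eq_reg_r in HI; [|lra].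
  (* All roots lie in (0, 1), so t < 0 would give the level alpha + n and t > 1 the level - beta;
     both differ from k. *)
  split; apply Rnot_lt_le; intro Hlt.
  + assert (Hall : roots_above xi n t = n).
    { assert (K : forall m, (m <= n)%nat -> roots_above xi m t = m).
      { induction m as [|m IH]; intro Hm; simpl; [reflexivity|].
        rewrite IH by lia. pose proof (roots_in_unit_interval (S m) ltac:(lia)).
        destruct (Rlt_dec t (xi (S m))); [reflexivity|lra]. }
      now apply K. }
    rewrite Hall in HI. destruct (Rlt_dec t 0); [|lra]. destruct (Rlt_dec 1 t); lra.
  + assert (Hnone : roots_above xi n t = 0%nat).
    { assert (K : forall m, (m <= n)%nat -> roots_above xi m t = 0%nat).
      { induction m as [|m IH]; intro Hm; simpl; [reflexivity|].
        rewrite IH by lia. pose proof (roots_in_unit_interval (S m) ltac:(lia)).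
        destruct (Rlt_dec t (xi (S m))); [lra|reflexivity]. }
      now apply K. }
    rewrite Hnone in HI. simpl in HI.
    destruct (Rlt_dec t 0); [lra|]. destruct (Rlt_dec 1 t); lra.
Qed.

(** When beta = 0 or alpha = 0, the tip of slit 0 or slit n lies on an edge of the strip; it is then
    attained at 1 or 0 by the normalization. *)
Lemma tip_attained (k : nat) : (k <= n)%nat ->
  exists t, 0 <= t <= 1 /\ reg t /\ G (RtoC t) = (0, INR k * PI).
Proof.
intro Hk. assert (Hkn : INR k <= INR n) by now apply le_INR. pose proof (pos_INR k).
destruct (Rle_dec (INR k) (- beta)) as [H1|H1].
- assert (Hb : beta = 0) by lra. assert (Hk0 : k = 0%nat) by (apply INR_eq; simpl; lra).
  subst k. exists 1. split; [lra|]. split; [now apply regular_1|].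
  apply limit_value; [now apply regular_1|now apply end_value_1].
- destruct (Rle_dec (alpha + INR n) (INR k)) as [H2|H2].
  + assert (Ha : alpha = 0) by lra. assert (Hkn' : k = n) by (apply INR_eq; lra).
    subst k. exists 0. split; [lra|]. split; [now apply regular_0|].
    apply limit_value; [now apply regular_0|now apply end_value_0].
  + apply tip_attained_inside; [exact Hk|lra].
Qed.

Lemma weighted_ln_le (q x y : R) : 0 <= q -> (q = 0 \/ 0 < x) -> x <= y -> q * ln x <= q * ln y.
Proof.
intros Hq [->|Hx] Hxy; [lra|]. apply Rmult_le_compat_l; [exact Hq|].
now apply Rcomplements.ln_le.
Qed.

Lemma log_sum_Re_le (t s : R) (m : nat) :
  (forall j, (1 <= j <= m)%nat -> 0 < Rabs (t - xi j) <= Rabs (s - xi j)) ->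
  Re (log_sum xi m (RtoC t)) <= Re (log_sum xi m (RtoC s)).
Proof.
induction m as [|m IH]; intro H; [simpl; lra|]. rewrite !log_sum_S_Re.
specialize (IH (fun j Hj => H j ltac:(lia))). destruct (H (S m) ltac:(lia)) as [H1 H2].
rewrite <- !RtoC_minus, !Cmod_R. pose proof (Rcomplements.ln_le _ _ H1 H2). lra.
Qed.

(* On the open slits the claim is that boundary values avoid Omega; along the
   two boundary lines of the strip, present when beta = 0 or alpha = 0, it follows
   from monotonicity and the value at the endpoint. *)
Lemma Re_boundary_value (t : R) : reg t -> 0 <= t <= 1 -> Re (G (RtoC t)) <= 0.
Proof.
intros Ht Ht01. pose proof PI_RGT_0 as HPI.
pose proof (Im_boundary_value t Ht Ht01) as HI.
pose proof (boundary_value_not_Omega t Ht) as HnO.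
pose proof (roots_above_le xi n t) as Hle. assert (Hle' := le_INR _ _ Hle).
pose proof (pos_INR (roots_above xi n t)) as Hge.
assert (HIp : Im (G (RtoC t)) / PI = INR (roots_above xi n t))
  by (rewrite HI; field; lra).
destruct Ht as (H0 & H1 & Hj).
destruct (Rle_dec (INR (roots_above xi n t)) (- beta)) as [Hb|Hb].
- assert (Hb0 : beta = 0) by lra.
  assert (Hr0 : roots_above xi n t = 0%nat) by (apply INR_eq; simpl; lra).
  pose proof (roots_above_0 xi n t Hr0) as Hr.
  pose proof (limit_value 1 _ (regular_1 Hb0) (end_value_1 Hb0)) as HG.
  apply (f_equal Re) in HG. change (Re (0, INR 0 * PI)) with 0 in HG. rewrite <- HG.
  unfold G. rewrite !Re_log_product, Hb0, !Cmod_R, Rabs_R1, (Rabs_pos_eq t) by lra.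
  assert (K : Re (log_sum xi n (RtoC t)) <= Re (log_sum xi n (RtoC 1))).
  { apply log_sum_Re_le. intros j Hj'. specialize (Hr j Hj'). specialize (Hj j Hj').
    rewrite !Rabs_pos_eq; lra. }
  pose proof (weighted_ln_le alpha t 1 Halpha) as K2.
  assert (K3 : alpha * ln t <= alpha * ln 1)
    by (apply K2; [destruct H0; [now left|right]|]; lra).
  lra.
- destruct (Rle_dec (alpha + INR n) (INR (roots_above xi n t))) as [Ha|Ha].
  + assert (Ha0 : alpha = 0) by lra.
    assert (Hrn : roots_above xi n t = n) by (apply INR_eq; lra).
    pose proof (roots_above_all xi n t Hrn) as Hr.
    pose proof (limit_value 0 _ (regular_0 Ha0) (end_value_0 Ha0)) as HG.
    apply (f_equal Re) in HG. change (Re (0, INR n * PI)) with 0 in HG. rewrite <- HG.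
    unfold G. rewrite !Re_log_product, Ha0, <- !RtoC_minus, !Cmod_R.
    rewrite (Rabs_left1 (t - 1)), (Rabs_left1 (0 - 1)) by lra.
    assert (K : Re (log_sum xi n (RtoC t)) <= Re (log_sum xi n (RtoC 0))).
    { apply log_sum_Re_le. intros j Hj'. specialize (Hr j Hj').
      rewrite !Rabs_left1; lra. }
    assert (K3 : beta * ln (- (t - 1)) <= beta * ln (- (0 - 1))).
    { apply weighted_ln_le; [exact Hbeta| |lra].
      destruct H1; [now left|right; lra]. }
    lra.
  + apply Rnot_lt_le. intro Hpos. apply HnO. split; [rewrite HIp; lra|].
    intros (j & _ & _ & H). lra.
Qed.

End NormalizedMap.

(** * Least deviation by alternation *)

(** Horner form of a polynomial function, in which division by t - r is a plain induction on n. *)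
Fixpoint degree_lt (n : nat) (p : R -> R) : Prop :=
  match n with
  | O => forall t, p t = 0
  | S n => exists a q, degree_lt n q /\ forall t, p t = a + t * q t
  end.

Lemma degree_lt_combine (n : nat) (p q : R -> R) (r : R) :
  degree_lt n p -> degree_lt n q -> degree_lt n (fun t => p t + r * q t).
Proof.
revert p q. induction n as [|n IH]; intros p q; simpl.
- intros Hp Hq t. rewrite Hp, Hq. ring.
- intros (a & p' & Hp' & Hp) (b & q' & Hq' & Hq).
  exists (a + r * b), (fun t => p' t + r * q' t). split; [now apply IH|].
  intro t. rewrite Hp, Hq. ring.
Qed.

Lemma degree_lt_weaken (n : nat) (p : R -> R) : degree_lt n p -> degree_lt (S n) p.
Proof.
revert p. induction n as [|n IH]; intros p Hp.
- exists 0, (fun _ => 0). split; [now intro|]. intro t. simpl in Hp. rewrite Hp. ring.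
- destruct Hp as (a & q & Hq & Hp). exists a, q. split; [now apply IH|exact Hp].
Qed.

Lemma degree_lt_factor (n : nat) (p : R -> R) (r : R) :
  degree_lt (S n) p -> exists q, degree_lt n q /\ forall t, p t = p r + (t - r) * q t.
Proof.
revert p. induction n as [|n IH]; intros p (a & q & Hq & Hp).
- exists q. split; [exact Hq|]. intro t. simpl in Hq. rewrite !Hp, !Hq. ring.
- destruct (IH q Hq) as (s & Hs & Hqs). exists (fun t => q t + r * s t). split.
  + apply degree_lt_combine; [exact Hq|now apply degree_lt_weaken].
  + intro t. rewrite !Hp, (Hqs t). ring.
Qed.

Lemma degree_lt_continuity (n : nat) (p : R -> R) : degree_lt n p -> continuity p.
Proof.
revert p. induction n as [|n IH]; intros p Hp x.
- apply (continuity_pt_ext (fun _ => 0)); [intro; now rewrite Hp|].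
  apply continuity_pt_const. now intros ? ?.
- destruct Hp as (a & q & Hq & Hp).
  apply (continuity_pt_ext (fun t => a + t * q t)); [intro; now rewrite Hp|].
  apply continuity_pt_plus; [apply continuity_pt_const; now intros ? ?|].
  apply continuity_pt_mult; [apply continuity_pt_id|now apply IH].
Qed.

(* A root between the two largest points is divided out; one of these two
   points then remains available for the quotient. *)
Lemma weak_alternation_zero (n : nat) (p : R -> R) (t : nat -> R) :
  degree_lt n p -> (forall j, (j < n)%nat -> t (S j) < t j) ->
  (forall j, (j <= n)%nat -> 0 <= (-1) ^ j * p (t j)) -> forall x, p x = 0.
Proof.
revert p t. induction n as [|n IH]; intros p t Hp Ht Halt; [exact Hp|].
assert (H10 : t 1%nat < t 0%nat) by (apply Ht; lia).
pose proof (Halt 0%nat ltac:(lia)) as A0. pose proof (Halt 1%nat ltac:(lia)) as A1.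
simpl in A0, A1.
destruct (IVT_cor p (t 1%nat) (t 0%nat) (degree_lt_continuity _ _ Hp)) as (r & Hr & Hpr);
  [lra|nra|].
destruct (degree_lt_factor n p r Hp) as (q & Hq & Hpq).
assert (Hpq' : forall x, p x = (x - r) * q x) by (intro x; rewrite (Hpq x), Hpr; ring).
assert (Hdec : forall k, (k <= n)%nat -> t (S k) <= t 1%nat).
{ induction k as [|k IHk]; intro Hk; [lra|].
  specialize (IHk ltac:(lia)). specialize (Ht (S k) ltac:(lia)). lra. }
(* If t 1 < r, then p <= 0 there and division by t 1 - r < 0 makes q nonnegative; otherwise r = t 1
   and t 0 > r serves. The remaining points lie to the left of r, where the sign flip of the
   division matches the index shift. *)
set (s := fun k => match k with
  | O => if Rlt_dec (t 1%nat) r then t 1%nat else t 0%nat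
  | S k => t (S (S k)) end).
assert (Hq0 : forall x, q x = 0).
{ apply (IH q s Hq).
  - intros [|j] Hj; [|apply (Ht (S (S j))); lia].
    specialize (Ht 1%nat ltac:(lia)). unfold s. destruct Rlt_dec; lra.
  - intros [|j] Hj.
    + unfold s. simpl. rewrite Hpq' in A0, A1. destruct Rlt_dec; nra.
    + specialize (Halt (S (S j)) ltac:(lia)). rewrite Hpq' in Halt.
      specialize (Ht (S j) ltac:(lia)). specialize (Hdec j ltac:(lia)).
      unfold s. simpl in *. nra. }
intro x. rewrite Hpq', Hq0. ring.
Qed.

Lemma monic_poly_O (p : R -> R) : monic_poly 0 p <-> forall t, p t = 1.
Proof.
split.
- intros (a & Ha & Hp) t. rewrite Hp. simpl. rewrite Ha. ring.
- intro Hp. exists (fun _ => 1). split; [reflexivity|]. intro t. rewrite Hp. simpl. ring.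
Qed.

Lemma monic_poly_S (n : nat) (p : R -> R) :
  monic_poly (S n) p <->
  exists a q, monic_poly n q /\ forall t, p t = a + t * q t.
Proof.
assert (K : forall (b : nat -> R) t, sum_f_R0 (fun k => b k * t ^ k) (S n) =
  b 0%nat + t * sum_f_R0 (fun k => b (S k) * t ^ k) n).
{ intros b t. rewrite decomp_sum by lia. simpl Init.Nat.pred. rewrite scal_sum.
  f_equal; [simpl; ring|]. apply sum_eq. intros i _. simpl. ring. }
split.
- intros (b & Hb & Hp). exists (b 0%nat), (fun t => sum_f_R0 (fun k => b (S k) * t ^ k) n).
  split; [now exists (fun k => b (S k))|]. intro t. now rewrite Hp, K.
- intros (a & q & (b & Hb & Hq) & Hp).
  exists (fun k => match k with O => a | S k => b k end). split; [exact Hb|].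
  intro t. now rewrite Hp, Hq, K.
Qed.

Lemma monic_poly_sub (n : nat) (p q : R -> R) :
  monic_poly n p -> monic_poly n q -> degree_lt n (fun t => p t - q t).
Proof.
revert p q. induction n as [|n IH]; intros p q.
- rewrite !monic_poly_O. intros Hp Hq t. rewrite Hp, Hq. ring.
- rewrite !monic_poly_S. intros (a & p' & Hp' & Hp) (b & q' & Hq' & Hq).
  exists (a - b), (fun t => p' t - q' t). split; [now apply IH|].
  intro t. rewrite Hp, Hq. ring.
Qed.

Lemma monic_poly_mul_root (n : nat) (p : R -> R) (r : R) :
  monic_poly n p -> monic_poly (S n) (fun t => p t * (t - r)).
Proof.
revert p. induction n as [|n IH]; intros p Hp; apply monic_poly_S.
- exists (- r), p. split; [exact Hp|]. intro t.
  rewrite monic_poly_O in Hp. rewrite Hp. ring.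
- apply monic_poly_S in Hp. destruct Hp as (a & q & Hq & Hp).
  exists (- (a * r)), (fun t => a + q t * (t - r)). split.
  + apply IH, monic_poly_S in Hq. destruct Hq as (b & s & Hs & Hqs).
    apply monic_poly_S. exists (a + b), s. split; [exact Hs|].
    intro t. rewrite Hqs. ring.
  + intro t. rewrite Hp. ring.
Qed.

Lemma monic_poly_Jtilde (n : nat) (xi : nat -> R) : monic_poly n (Jtilde n xi).
Proof.
induction n as [|n IH].
- apply monic_poly_O. reflexivity.
- destruct (monic_poly_mul_root n _ (xi (S n)) IH) as (a & Ha & Hp).
  exists a. split; [exact Ha|]. intro t. now rewrite Jtilde_S, <- Hp.
Qed.

(** At t j the value (-1)^j p is m / v and |q| is at most m / v, so p - q alternates weakly at n + 1
    points while having degree less than n. The weak inequality serves both minimality and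
    uniqueness. *)
Lemma alternation_unique (n : nat) (v p q : R -> R) (m : R) (t : nat -> R) :
  monic_poly n p -> monic_poly n q ->
  (forall j, (j < n)%nat -> t (S j) < t j) ->
  (forall j, (j <= n)%nat -> 0 < v (t j) /\ v (t j) * p (t j) = (-1) ^ j * m /\
     v (t j) * Rabs (q (t j)) <= m) ->
  forall x, q x = p x.
Proof.
intros Hp Hq Ht Halt.
assert (H0 : forall x, p x - q x = 0).
{ apply (weak_alternation_zero n (fun x => p x - q x) t (monic_poly_sub n p q Hp Hq) Ht).
  intros j Hj. destruct (Halt j Hj) as (Hv & Hpj & Hqj).
  apply Rmult_le_reg_l with (v (t j)); [exact Hv|]. rewrite Rmult_0_r.
  replace (v (t j) * ((-1) ^ j * (p (t j) - q (t j)))) with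
    ((-1) ^ j * (v (t j) * p (t j)) - v (t j) * ((-1) ^ j * q (t j))) by ring.
  rewrite Hpj, <- Rmult_assoc, <- Rpow_mult_distr.
  replace (-1 * -1) with 1 by ring. rewrite pow1, Rmult_1_l.
  pose proof (Rle_abs ((-1) ^ j * q (t j))) as T.
  rewrite Rabs_mult, pow_1_abs, Rmult_1_l in T. nra. }
intro x. specialize (H0 x). lra.
Qed.

Lemma wnorm_bound (alpha beta m : R) (q : R -> R) :
  Rbar_le (wnorm alpha beta q) (Finite m) ->
  forall t, 0 <= t <= 1 -> weight alpha beta t * Rabs (q t) <= m.
Proof.
intros Hm t Ht.
destruct (Lub_Rbar_correct (fun y => exists t : R,
    0 <= t <= 1 /\ y = weight alpha beta t * Rabs (q t))) as [Hub _].
assert (H1 : Rbar_le (Finite (weight alpha beta t * Rabs (q t))) (wnorm alpha beta q)).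
{ apply Hub. now exists t. }
exact (Rbar_le_trans _ _ _ H1 Hm).
Qed.

Lemma alternation_least_deviation (n : nat) (alpha beta m : R) (p : R -> R) (t : nat -> R) :
  monic_poly n p ->
  (forall x, 0 <= x <= 1 -> weight alpha beta x * Rabs (p x) <= m) ->
  (forall j, (j < n)%nat -> t (S j) < t j) ->
  (forall j, (j <= n)%nat -> 0 <= t j <= 1 /\ 0 < weight alpha beta (t j) /\
     weight alpha beta (t j) * p (t j) = (-1) ^ j * m) ->
  wnorm alpha beta p = Finite m /\ least_deviation n alpha beta p.
Proof.
intros Hp Hm Ht Halt.
assert (Hnorm : wnorm alpha beta p = Finite m).
{ apply is_lub_Rbar_unique. split.
  - intros y (x & Hx & ->). now apply Hm.
  - intros b Hb. destruct (Halt 0%nat (Nat.le_0_l n)) as (H1 & H2 & H3).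
    simpl in H3. eapply Rbar_le_trans; [|apply Hb; exists (t 0%nat); split; [exact H1|reflexivity]].
    simpl. pose proof (Rle_abs (p (t 0%nat))). nra. }
assert (K : forall q, monic_poly n q -> Rbar_le (wnorm alpha beta q) (Finite m) ->
  forall x, q x = p x).
{ intros q Hq Hqm. apply (alternation_unique n (weight alpha beta) p q m t Hp Hq Ht).
  intros j Hj. destruct (Halt j Hj) as (H1 & H2 & H3).
  split; [exact H2|]. split; [exact H3|].
  exact (wnorm_bound alpha beta m q Hqm (t j) H1). }
split; [exact Hnorm|]. split; [exact Hp|]. split.
(* A competitor with smaller norm would equal p by [K] and so have the same norm. *)
- intros q Hq. rewrite Hnorm. apply Rbar_not_lt_le. intro Hlt.
  pose proof (K q Hq (Rbar_lt_le _ _ Hlt)) as Heq.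
  assert (Hw : wnorm alpha beta q = wnorm alpha beta p).
  { apply Lub_Rbar_eqset. intro y. split; intros (x & Hx & ->); exists x;
      (split; [exact Hx|now rewrite Heq]). }
  rewrite Hw, Hnorm in Hlt. simpl in Hlt. lra.
- intros q Hq Hqn. apply K; [exact Hq|]. rewrite Hqn, Hnorm. apply Rbar_le_refl.
Qed.

(** * Norm, alternation points and conclusion *)

Lemma map_bound (n : nat) (alpha beta : R) (w : C -> C) (c : R) (xi : nat -> R) :
  0 <= alpha -> 0 <= beta ->
  normalized_map n alpha beta w -> asymptotic_const n alpha beta w c ->
  (forall j, (1 <= j <= n)%nat -> filterlim w (near_real (xi j)) (infty_mid n j)) ->
  forall t, 0 <= t <= 1 -> weight alpha beta t * Rabs (Jtilde n xi t) <= exp (- c).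
Proof.
intros Ha Hb Hw Hc Hxi t Ht. pose proof (exp_pos c) as Hec.
destruct (classic (regular n alpha beta xi t)) as [Hr|Hr].
- destruct (exp_Re_log_product n alpha beta c xi t Hr Ht) as [H _].
  pose proof (Re_boundary_value n alpha beta w c Hw Hc Ha Hb xi Hxi t Hr Ht) as Hle.
  apply Rmult_le_reg_r with (exp c); [exact Hec|].
  rewrite <- H, <- exp_plus, Rplus_opp_l, exp_0, <- exp_0.
  destruct Hle as [Hlt|Heq]; [apply Rlt_le, exp_increasing, Hlt|rewrite Heq; lra].
- destruct (irregular_zero n alpha beta xi t Hr Ha Hb) as [_ H]. specialize (H (RtoC 1)).
  rewrite cweight_unit_interval, Cmult_1_r, <- RtoC_mult in H by exact Ht.
  apply RtoC_inj in H. apply Rmult_integral in H.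
  assert (H0 : weight alpha beta t * Rabs (Jtilde n xi t) = 0).
  { destruct H as [-> | ->]; [ring|rewrite Rabs_R0; ring]. }
  rewrite H0. apply Rlt_le, exp_pos.
Qed.

(** At the tip i pi k the exponential of w is (-1)^k, so the weighted polynomial takes the extreme
    value (-1)^k e^(-c). *)
Lemma map_alternation (n : nat) (alpha beta : R) (w : C -> C) (c : R) (xi : nat -> R) :
  0 <= alpha -> 0 <= beta ->
  normalized_map n alpha beta w -> asymptotic_const n alpha beta w c ->
  (forall j, (1 <= j <= n)%nat -> filterlim w (near_real (xi j)) (infty_mid n j)) ->
  exists t : nat -> R, (forall j, (j < n)%nat -> t (S j) < t j) /\
    forall j, (j <= n)%nat -> 0 <= t j <= 1 /\ 0 < weight alpha beta (t j) /\
      weight alpha beta (t j) * Jtilde n xi (t j) = (-1) ^ j * exp (- c).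
Proof.
intros Ha Hb Hw Hc Hxi. pose proof PI_RGT_0 as HPI.
set (P := fun (k : nat) t => 0 <= t <= 1 /\ regular n alpha beta xi t /\
  log_product n alpha beta c xi (RtoC t) = (0, INR k * PI)).
set (t := fun k => epsilon (inhabits 0) (P k)).
assert (Ht : forall k, (k <= n)%nat -> P k (t k)).
{ intros k Hk. apply epsilon_spec.
  exact (tip_attained n alpha beta w c Hw Hc Ha Hb xi Hxi k Hk). }
(* The level of the tip counts the roots to the right of t k; since this count decreases with the
   point, the t k are strictly decreasing in k. *)
assert (Hcount : forall k, (k <= n)%nat -> roots_above xi n (t k) = k).
{ intros k Hk. destruct (Ht k Hk) as (H1 & H2 & H3). apply INR_eq.
  apply Rmult_eq_reg_r with PI; [|lra].
  rewrite <- (Im_boundary_value n alpha beta c xi (t k) H2 H1), H3. reflexivity. }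
exists t. split.
- intros j Hj. apply Rnot_le_lt. intro Hle.
  pose proof (roots_above_antitone xi n _ _ Hle) as H.
  rewrite !Hcount in H by lia. lia.
- intros j Hj. destruct (Ht j Hj) as (H1 & H2 & H3).
  destruct (exp_Re_log_product n alpha beta c xi (t j) H2 H1) as [H4 H5].
  split; [exact H1|]. split; [exact H5|].
  rewrite H3 in H4. change (Re (0, INR j * PI)) with 0 in H4. rewrite exp_0 in H4.
  rewrite Jtilde_sign, Hcount by exact Hj.
  rewrite exp_Ropp. pose proof (exp_pos c).
  apply Rmult_eq_reg_r with (exp c); [|lra].
  rewrite (Rmult_assoc ((-1) ^ j)), Rinv_l, Rmult_1_r by lra.
  transitivity ((-1) ^ j * (weight alpha beta (t j) * Rabs (Jtilde n xi (t j)) * exp c));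
    [ring|]. rewrite <- H4. ring.
Qed.

Theorem proposition1p2 (alpha beta : R) (n : nat) (w : C -> C) (c : R)
    (xi : nat -> R)
    (Halpha : 0 <= alpha) (Hbeta : 0 <= beta)
    (Hw : normalized_map n alpha beta w)
    (Hc : asymptotic_const n alpha beta w c)
    (Hxi : forall j : nat, (1 <= j <= n)%nat ->
       filterlim w (near_real (xi j)) (infty_mid n j)) :
  (forall t : R,
     exp_boundary_eq w t
       (cweight alpha beta t * RtoC (exp c) * RtoC (Jtilde n xi t))%C) /\
  least_deviation n alpha beta (Jtilde n xi) /\
  wnorm alpha beta (Jtilde n xi) = Finite (exp (- c)) /\
  (forall t : R,
     exp_boundary_eq w t
       (cweight alpha beta t * RtoC (Jnormalized n alpha beta xi t))%C).
Proof.
pose proof (map_boundary_eq n alpha beta w c Hw Hc Halpha Hbeta xi Hxi) as Hformula.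
destruct (map_alternation n alpha beta w c xi Halpha Hbeta Hw Hc Hxi)
  as (s & Hdec & Halt).
destruct (alternation_least_deviation n alpha beta (exp (- c)) (Jtilde n xi) s)
  as [Hnorm Hleast].
- apply monic_poly_Jtilde.
- exact (map_bound n alpha beta w c xi Halpha Hbeta Hw Hc Hxi).
- exact Hdec.
- exact Halt.
- split; [exact Hformula|]. split; [exact Hleast|]. split; [exact Hnorm|].
  intro t. destruct (Hformula t) as (b & Hb & Hv). exists b. split; [exact Hb|].
  rewrite Hv. unfold Jnormalized. rewrite Hnorm. simpl real.
  rewrite exp_Ropp. pose proof (exp_pos c). unfold Rdiv. rewrite Rinv_inv, RtoC_mult. ring.
Qed.
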